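(* Let $f:\mathbb{R}\to\mathbb{R}^n$ be globally Lipschitz continuous with $|f(x)|\le C|x|$ for all $x\in\mathbb{R}$, and let $u_0\in\mathrm{BMO}^{-1}_{\Delta_N}(\mathbb{R}^n)$. There exists $\epsilon>0$ such that, if $\|u_0\|_{\mathrm{BMO}^{-1}_{\Delta_N}(\mathbb{R}^n)}<\epsilon$, then the system $$\partial_tu-\Delta u=\mathrm{div}_x f(u^2)\ \ (x\in\Omega,\ t>0),\qquad u(x,0)=u_0(x)\ \ (x\in\Omega),\qquad \frac{\partial u}{\partial x_n}(x,t)=0\ \ (x_n=0),$$ with $\Omega=\mathbb{R}^n_+\cup\mathbb{R}^n_-$, has a global mild solution $u\in\mathcal{E}$, which is the unique one in the closed ball $\{u\in\mathcal{E}:\|u\|_{\mathcal{E}}\le 2\epsilon\}$.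
   Context: Write $x=(x',x_n)\in\mathbb{R}^{n-1}\times\mathbb{R}$, $\mathbb{R}^n_{\pm}=\{x:\pm x_n>0\}$. $\Delta_N$ is the self-adjoint operator on $L^2(\mathbb{R}^n)$ acting on each half-space $\mathbb{R}^n_\pm$ as the Neumann Laplacian of that half-space. Its heat semigroup is $e^{t\Delta_N}f(x)=\int_{\mathbb{R}^n}p_{t,\Delta_N}(x,y)f(y)\,dy$ with $$p_{t,\Delta_N}(x,y)=\frac{1}{(4\pi t)^{n/2}}e^{-\frac{|x'-y'|^2}{4t}}\Big(e^{-\frac{|x_n-y_n|^2}{4t}}+e^{-\frac{|x_n+y_n|^2}{4t}}\Big)H(x_ny_n),$$ where $H(\tau)=0$ for $\tau<0$, $H(\tau)=1$ for $\tau\ge0$. For a tempered distribution $f$, $e^{t\Delta_N}f(x)=\langle f,p_{t,\Delta_N}(x,\cdot)\rangle$. For an $\mathbb{R}^n$-valued function $\alpha$, $e^{t\Delta_N}\mathrm{div}_x\alpha$ is understood by duality: $e^{t\Delta_N}\mathrm{div}_x\alpha(x)=-\int_{\mathbb{R}^n}\nabla_yp_{t,\Delta_N}(x,y)\cdot\alpha(y)\,dy$ (derivatives taken for $y_n\neq0$). $\mathrm{BMO}^{-1}_{\Delta_N}(\mathbb{R}^n)$ is the space of tempered distributions $f$ on $\mathbb{R}^n$ with $$\|f\|_{\mathrm{BMO}^{-1}_{\Delta_N}(\mathbb{R}^n)}=\sup_{B(x_B,r_B)\subset\mathbb{R}^n}\Big(r_B^{-n}\int_0^{r_B^2}\int_{B(x_B,r_B)}|e^{t\Delta_N}f(x)|^2\,dx\,dt\Big)^{1/2}<\infty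 .$$ $\mathcal{E}$ is the space of measurable functions $u$ on $\mathbb{R}^n\times(0,\infty)$ with $\|u\|_{\mathcal{E}}=\|t^{1/2}u\|_{L^\infty(\mathbb{R}^n\times(0,\infty))}+\|u\|_{T^{\infty,2}(\mathbb{R}^{n+1}_+)}<\infty$, where $$\|u\|_{T^{\infty,2}(\mathbb{R}^{n+1}_+)}=\sup_{x\in\mathbb{R}^n,\,t>0}\Big(t^{-n/2}\int_0^t\int_{B(x,\sqrt t)}|u(y,s)|^2\,dy\,ds\Big)^{1/2}.$$ A (global) mild solution of the system is a function $u$ satisfying, for all $t>0$, $$u(\cdot,t)=e^{t\Delta_N}u_0+\int_0^te^{(t-s)\Delta_N}\mathrm{div}_x f(u^2(s,\cdot))\,ds .$$ *)

(* Defs.v *)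
From HB Require Import structures.
From mathcomp Require Import all_boot all_order all_algebra.
From mathcomp Require Import all_classical all_reals all_analysis.

Set Implicit Arguments.
Unset Strict Implicit.
Unset Printing Implicit Defensive.

Import Order.TTheory GRing.Theory Num.Theory.
Import numFieldNormedType.Exports.

Local Open Scope classical_set_scope.
Local Open Scope ring_scope.

(* Points of R^n are row vectors.  The coordinate x_n is [x 0 ord_max], and the
   dimension of the problem is written n.+1, so that x = (x', x_{n+1}) with x'
   in R^n, n >= 0.  The library's norm on row vectors is the max norm; [enorm]
   and [eball] are Euclidean. *)

(* ** Lebesgue measure on R^n *)

Definition rV_display : measure_display -> measure_display.
Proof. exact. Qed.

Section measurable_rV.
Context d (T : measurableType d) (n : nat).

Definition rV_coord (i : 'I_n) (x : 'rV[T]_n) : T := x ord0 i.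

Let rV_set0 : g_sigma_preimage rV_coord set0.
Proof. exact: sigma_algebra0. Qed.

Let rV_setC A : g_sigma_preimage rV_coord A -> g_sigma_preimage rV_coord (~` A).
Proof. exact: sigma_algebraC. Qed.

Let rV_bigcup (F : _^nat) : (forall i, g_sigma_preimage rV_coord (F i)) ->
  g_sigma_preimage rV_coord (\bigcup_i (F i)).
Proof. exact: sigma_algebra_bigcup. Qed.

HB.instance Definition _ := @isMeasurable.Build (rV_display d)
  'rV[T]_n (g_sigma_preimage rV_coord) rV_set0 rV_setC rV_bigcup.

End measurable_rV.

Lemma measurable_rV_coord d (T : measurableType d) n (i : 'I_n) :
  measurable_fun [set: 'rV[T]_n] (rV_coord i).
Proof.
move=> _ Y mY; rewrite setTI; apply: sub_sigma_algebra => /=.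
rewrite -bigcup_seq/=; exists i => /=; first by rewrite mem_index_enum.
by exists Y => //; rewrite setTI.
Qed.

Lemma measurable_fun_rV d1 d2 (T1 : measurableType d1) (T2 : measurableType d2)
    n (f : T1 -> 'rV[T2]_n) :
  (forall i, measurable_fun [set: T1] (rV_coord i \o f)) ->
  measurable_fun [set: T1] f.
Proof.
move=> mf _ A mA.
suff : preimage_set_system [set: T1] f (g_sigma_preimage (@rV_coord _ T2 n))
    `<=` measurable by apply; exists A.
rewrite -g_sigma_preimage_comp.
apply: smallest_sub; first exact: sigma_algebra_measurable.
case: n => [|n] in f A mA mf *; first by rewrite big_ord0.
rewrite -bigcup_mkord_ord; apply: bigcup_sub => i Ii.
by move=> B [C mC <-]; exact: mf.
Qed.

Section lebesgue_rV.
Context {R : realType}.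

Definition consrV n (p : measurableTypeR R * 'rV[R]_n) : 'rV[R]_n.+1 :=
  \row_i oapp (p.2 ord0) p.1 (unlift ord0 i).

Definition unconsrV n (x : 'rV[R]_n.+1) : measurableTypeR R * 'rV[R]_n :=
  (x ord0 ord0, \row_j x ord0 (lift ord0 j)).

Lemma consrVK n : cancel (@consrV n) (@unconsrV n).
Proof.
move=> [a v]; rewrite /consrV /unconsrV mxE unlift_none/=; congr pair.
by apply/rowP => j; rewrite !mxE liftK.
Qed.

Lemma measurable_consrV n : measurable_fun setT (@consrV n).
Proof.
apply: measurable_fun_rV => i.
case: (unliftP ord0 i) => [j ->|->].
  rewrite (_ : _ \o _ = rV_coord j \o snd).
    by apply: measurableT_comp => //; exact: measurable_rV_coord.
  by apply/funext => p /=; rewrite /rV_coord mxE liftK.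
rewrite (_ : _ \o _ = fst); first exact: measurable_fst.
by apply/funext => p /=; rewrite /rV_coord mxE unlift_none.
Qed.

HB.instance Definition _ n :=
  isMeasurableFun.Build _ _ _ _ (@consrV n) (@measurable_consrV n).

Lemma measurable_unconsrV n : measurable_fun setT (@unconsrV n).
Proof.
apply: measurable_fun_pair; first exact: measurable_rV_coord.
apply: measurable_fun_rV => i.
rewrite (_ : _ \o _ = rV_coord (lift ord0 i)); first exact: measurable_rV_coord.
by apply/funext => p /=; rewrite /rV_coord mxE.
Qed.

Section cons_measure.
Variables (n : nat) (m : {sigma_finite_measure set 'rV[R]_n -> \bar R}).

Definition cons_measure : set 'rV[R]_n.+1 -> \bar R :=
  pushforward (@lebesgue_measure R \x m)%E (@consrV n).

Let cons_measure0 : cons_measure set0 = 0%E.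
Proof. exact: measure0. Qed.

Let cons_measure_ge0 A : (0 <= cons_measure A)%E.
Proof. exact: measure_ge0. Qed.

Let cons_measure_sigma_additive : semi_sigma_additive cons_measure.
Proof. exact: measure_semi_sigma_additive. Qed.

HB.instance Definition _ := isMeasure.Build _ _ _ cons_measure
  cons_measure0 cons_measure_ge0 cons_measure_sigma_additive.

Let cons_measure_sigma_finite : sigma_finite setT cons_measure.
Proof.
have /sigma_finiteP[F [TF ndF Foo]] := sigma_finiteT (@lebesgue_measure R).
have /sigma_finiteP[G [TG ndG Goo]] := sigma_finiteT m.
exists (fun k => @unconsrV n @^-1` (F k `*` G k)).
  apply/esym; rewrite -subTset => x _.
  have [[i _ Fi] [j _ Gj]] :
      (\bigcup_k F k) (unconsrV x).1 /\ (\bigcup_k G k) (unconsrV x).2.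
    by rewrite -TF -TG.
  exists (maxn i j) => //; split.
  - by move: Fi; exact/subsetPset/ndF/leq_maxl.
  - by move: Gj; exact/subsetPset/ndG/leq_maxr.
move=> k; have [mF Fk] := Foo k; have [mG Gk] := Goo k; split.
  rewrite -[X in measurable X]setTI; apply: measurable_unconsrV => //.
  exact: measurableX.
rewrite /cons_measure /pushforward -comp_preimage.
rewrite (_ : _ \o _ = id); last by apply/funext => p /=; rewrite consrVK.
rewrite preimage_id product_measure1E// lte_mul_pinfty// ge0_fin_numE.
  exact: Fk.
exact: measure_ge0.
Qed.

HB.instance Definition _ :=
  Measure_isSigmaFinite.Build _ _ _ cons_measure cons_measure_sigma_finite.

End cons_measure.

Definition lebesgue_rV0 : set 'rV[R]_0 -> \bar R := dirac (0 : 'rV[R]_0).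

HB.instance Definition _ := Measure.on lebesgue_rV0.

Let lebesgue_rV0_sigma_finite : sigma_finite setT lebesgue_rV0.
Proof.
exists (fun=> setT); first by rewrite bigcup_const.
by move=> _; split => //; rewrite /lebesgue_rV0 diracT ltry.
Qed.

HB.instance Definition _ :=
  Measure_isSigmaFinite.Build _ _ _ lebesgue_rV0 lebesgue_rV0_sigma_finite.

(* The product of n copies of the one-dimensional Lebesgue measure. *)
Fixpoint lebesgue_rV n : {sigma_finite_measure set 'rV[R]_n -> \bar R} :=
  if n is n'.+1 then cons_measure (lebesgue_rV n') else lebesgue_rV0.

End lebesgue_rV.

Section Neumann.
Context {R : realType} {n : nat}.

Local Notation Rn := 'rV[R]_n.+1.
Local Notation leb := (@lebesgue_measure R).
Local Notation lebn := (@lebesgue_rV R n.+1).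

Implicit Types (x y : Rn) (t s : R) (phi psi : Rn -> R) (u : Rn -> R -> R).

Definition enorm x : R := Num.sqrt (\sum_i x ord0 i ^+ 2).

Definition eball x (r : R) : set Rn := [set y | enorm (y - x) < r].

(* ** Tempered distributions *)

Definition partial (i : 'I_n.+1) phi : Rn -> R :=
  fun x => 'D_(delta_mx ord0 i) phi x.

Definition partials (a : seq 'I_n.+1) phi : Rn -> R := foldr partial phi a.

(* For [U := setT] this is the Schwartz space of R^n.  For an open [U] the
   conditions only concern the restriction of [phi] to [U]. *)
Definition schwartz_on (U : set Rn) phi : Prop :=
  (forall a x, U x -> differentiable (partials a phi) x) /\
  (forall a k, exists M, forall x, U x ->
    (1 + enorm x) ^+ k * `|partials a phi x| <= M).

(* A distribution is represented by a function defined on all [phi : Rn -> R];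
   its values outside of [schwartz_on U] are irrelevant. *)
Definition tempered_on (U : set Rn) (T : (Rn -> R) -> R) : Prop :=
  (forall (c : R) phi psi, schwartz_on U phi -> schwartz_on U psi ->
    T (fun x => c * phi x + psi x) = c * T phi + T psi) /\
  (exists (k : nat) (C : R), forall phi, schwartz_on U phi -> forall M,
    (forall a x, (size a <= k)%N -> U x ->
      (1 + enorm x) ^+ k * `|partials a phi x| <= M) ->
    `|T phi| <= C * M).

Lemma schwartz_onS (U V : set Rn) phi :
  U `<=` V -> schwartz_on V phi -> schwartz_on U phi.
Proof.
move=> UV [dphi bphi]; split=> [a x /UV|a k]; first exact: dphi.
by have [M bM] := bphi a k; exists M => x /UV; exact: bM.
Qed.

Definition Omega : set Rn := [set x | x ord0 ord_max != 0].

(* The kernel p_{t,Delta_N}(x, .) jumps across {y_n = 0}, so it is not a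
   Schwartz function on R^n, but it is in [schwartz_on Omega].  The pairing
   <f, p_{t,Delta_N}(x, .)> therefore needs f to act continuously on
   [schwartz_on Omega], and this is what is meant by a tempered distribution
   that can be paired with the kernel.  Such an f restricts to a tempered
   distribution in the usual sense ([tempered_on_Omega] below); conversely, by
   Hahn-Banach every tempered distribution on R^n has such an extension, which
   is unique up to layers supported on {y_n = 0}. *)
Lemma tempered_on_Omega (T : (Rn -> R) -> R) :
  tempered_on Omega T -> tempered_on setT T.
Proof.
move=> [linT [k [C cT]]]; split=> [c phi psi sphi spsi|].
  by apply: linT; [move: sphi|move: spsi]; exact: schwartz_onS.
exists k, C => phi sphi M bM; apply: cT; first exact: schwartz_onS sphi.
by move=> a x ka _; exact: bM.
Qed.

(* ** The Neumann heat semigroup *)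

Definition heaviside (tau : R) : R := if tau < 0 then 0 else 1.

Definition neumann_kernel t x y : R :=
  (4 * pi * t) `^ (- (n.+1%:R / 2))
  * expR (- (\sum_(i | i != ord_max) (x ord0 i - y ord0 i) ^+ 2) / (4 * t))
  * (expR (- (x ord0 ord_max - y ord0 ord_max) ^+ 2 / (4 * t))
     + expR (- (x ord0 ord_max + y ord0 ord_max) ^+ 2 / (4 * t)))
  * heaviside (x ord0 ord_max * y ord0 ord_max).

(* e^{t Delta_N} T *)
Definition neumann_heat t (T : (Rn -> R) -> R) x : R := T (neumann_kernel t x).

(* e^{t Delta_N} div alpha; the integrand is well defined off the null set
   {y_n = 0}. *)
Definition neumann_heat_div t (alpha : Rn -> Rn) x : R :=
  - \int[lebn]_y (\sum_i partial i (neumann_kernel t x) y * alpha y ord0 i).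

(* ** Function spaces *)

Definition bmo_norm (T : (Rn -> R) -> R) : \bar R :=
  ereal_sup [set N : \bar R | exists (xB : Rn) (rB : R), 0 < rB /\
    N = (((rB ^- n.+1)%R%:E *
      \int[leb]_(t in `]0%R, (rB ^+ 2)%R[) \int[lebn]_(x in eball xB rB)
        (neumann_heat t T x ^+ 2)%R%:E) `^ 2^-1)%E].

Definition bmo (T : (Rn -> R) -> R) : Prop :=
  tempered_on Omega T /\ (bmo_norm T < +oo)%E.

Definition tent_norm u : \bar R :=
  ereal_sup [set N : \bar R | exists (x : Rn) (t : R), 0 < t /\
    N = (((t `^ (- (n.+1%:R / 2)))%R%:E *
      \int[leb]_(s in `]0%R, t[) \int[lebn]_(y in eball x (Num.sqrt t))
        (u y s ^+ 2)%R%:E) `^ 2^-1)%E].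

Definition space_time : set (Rn * R) := [set: Rn] `*` `]0, +oo[.

Definition E_norm u : \bar R :=
  ('N[(lebn \x leb)]_+oo[
      (fun z : Rn * R => (Num.sqrt z.2 * u z.1 z.2)%:E) \_ space_time ]
   + tent_norm u)%E.

Definition E_space u : Prop :=
  measurable_fun space_time (fun z : Rn * R => u z.1 z.2) /\
  (E_norm u < +oo)%E.

(* As usual the identity is between elements of L^oo(R^n), i.e. almost
   everywhere in x, for every t > 0.  For u in [E_space] the Duhamel integral
   converges absolutely. *)
Definition mild_solution (f : R -> Rn) (u0 : (Rn -> R) -> R) u : Prop :=
  forall t, 0 < t -> {ae lebn, forall x,
    u x t = neumann_heat t u0 x +
      \int[leb]_(s in `]0, t[)
        neumann_heat_div (t - s) (fun y => f (u y s ^+ 2)) x}.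

End Neumann.

(* Main.v *)
From HB Require Import structures.
Require Import Defs.
From mathcomp Require Import all_boot all_order all_algebra.
From mathcomp Require Import all_classical all_reals all_analysis.
From mathcomp Require Import measurable_realfun.
From mathcomp Require Import ring lra.

Set Implicit Arguments.
Unset Strict Implicit.
Unset Printing Implicit Defensive.

Import Order.TTheory GRing.Theory Num.Theory.
Import numFieldNormedType.Exports.
Local Open Scope classical_set_scope.
Local Open Scope ring_scope.

(* The argument is that of Koch and Tataru.  On each half-space the Neumann
   kernel is the even reflection of the Gauss kernel of R^n, so the Duhamel
   operator splits into potentials of the form
     S g (x, t) = \int_0^t \int D_i Gamma_(t-s) (x - y) g (y, s) dy ds.
   Assume |g| <= w, where t w is essentially bounded by [a] and the integral of w
   over every Carleson cylinder is at most [b] times the size of the cylinder.  Averaging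
   over translates of balls bounds \int_0^t \int Gamma_t (x - y) w by C b; this
   gives |S g| <= C t^(-1/2) (a + b), and controls in L^2 the part of g away from the
   cylinder under consideration.  For the near part the identity
     \sum_i \int D_i Gamma_a (x - y) D_i Gamma_b (x - y') dx = - (d/dt) Gamma_t (y - y')
   at t = a + b turns \int_0^T |S g|^2 into a double integral of g (z) g (z')
   Gamma_(|s - s'|) (y - y'), which is at most (a + b) \int w.

   For the linear part, the semigroup law lets e^{t Delta_N} u_0 be averaged against
   its own past: |v (x, t)|^2 <= \int Gamma_(t-s) (x - z) |v (z, s)|^2 dz, and the
   integral over s < t/2 is controlled by the BMO^{-1} norm.  Testing the
   distribution against the Chapman-Kolmogorov integral (a Pettis integral)
   is justified by rounding z to a grid: the integrals become finite sums, which
   converge in every Schwartz seminorm on {x_n <> 0}.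

   Since |f (u^2) - f (v^2)| <= L |u - v| |u + v|, the Duhamel term is then a
   contraction on a small ball. *)

(** * Measurability and integration on R^n *)

(** Neither of the two bounds on the source suffices alone. The gradient kernel has mass of order (t
    - s)^(-1/2), so sources at times close to t must be bounded pointwise, by 2a/t; sources at times
    below t/2 see a kernel that is smooth at scale t and only their Carleson bound counts. Each
    pointwise potential estimate is this splitting at t/2. The energy identity is exact only for the
    whole gradient and only after exchanging integrals; absolute convergence is available when the
    sources stay away from time 0, and Fatou removes that cutoff. The Neumann kernel jumps across
    the hyperplane, so its derivatives off it are carried along as explicit lists and the functional
    is tested on these. The triangle inequality for the solution norm is replaced throughout by (x +
    y)^2 <= 2 x^2 + 2 y^2, which the geometric rates of the iteration easily absorb. Passing from
    the BMO^{-1} norm to the sup norm costs a factor H, and the solution norm is a sum of two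
    pieces: the size of the data and the radius of the ball are therefore tied only through the
    choice of eps. *)

Section measurability.
Context {d} {T : measurableType d} {R : realType}.
Implicit Types (D : set T) (f g : T -> R).

Lemma measfD D f g : measurable_fun D f -> measurable_fun D g ->
  measurable_fun D (fun z => f z + g z).
Proof. exact: measurable_funD. Qed.

Lemma measfB D f g : measurable_fun D f -> measurable_fun D g ->
  measurable_fun D (fun z => f z - g z).
Proof. exact: measurable_funB. Qed.

Lemma measfM D f g : measurable_fun D f -> measurable_fun D g ->
  measurable_fun D (fun z => f z * g z).
Proof. exact: measurable_funM. Qed.

Lemma measfN D f : measurable_fun D f -> measurable_fun D (fun z => - f z).
Proof. exact: measurable_funN. Qed.

Lemma measfX D f k : measurable_fun D f -> measurable_fun D (fun z => f z ^+ k).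
Proof. exact: measurable_funX. Qed.

Lemma measf_norm D f : measurable_fun D f -> measurable_fun D (fun z => `|f z|).
Proof. by move=> mf; apply: measurableT_comp. Qed.

Lemma measf_expR D f : measurable_fun D f ->
  measurable_fun D (fun z => expR (f z)).
Proof. by move=> mf; apply: measurableT_comp; [exact: measurable_expR|]. Qed.

Lemma measf_powR D f p : measurable_fun D f ->
  measurable_fun D (fun z => f z `^ p).
Proof.
by move=> mf; apply: (measurableT_comp (@measurable_powR R p) mf).
Qed.

(** Writing 1/f as f exp(- ln (f^2)) reduces inversion to maps already treated; the leading factor f
    gives 0 where f vanishes, in agreement with the convention for the inverse of 0. *)
Lemma measfV D f : measurable_fun D f -> measurable_fun D (fun z => (f z)^-1).
Proof.
move=> mf; rewrite (_ : (fun _ => _) =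
  fun z => f z * expR (- ln (f z * f z))).
  apply: measfM => //; apply: measf_expR; apply: measfN.
  by apply: (measurableT_comp (@measurable_ln R)); exact: measfM.
apply/funext => z; have [->|fz0] := eqVneq (f z) 0; first by rewrite invr0 mul0r.
rewrite expRN lnK ?posrE; last by rewrite -expr2 exprn_even_gt0.
by rewrite invfM mulrA divff// mul1r.
Qed.

Lemma measf_sum D (I : Type) (s : seq I) (P : pred I) (h : I -> T -> R) :
  (forall i, measurable_fun D (h i)) ->
  measurable_fun D (fun z => \sum_(i <- s | P i) h i z).
Proof.
move=> mh; under eq_fun do rewrite -big_filter.
exact: measurable_sum.
Qed.

Lemma measf_prod D (I : finType) (P : pred I) (h : I -> T -> R) :
  (forall i, measurable_fun D (h i)) ->
  measurable_fun D (fun z => \prod_(i | P i) h i z).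
Proof.
move=> mh; under eq_fun do rewrite -big_filter.
exact: measurable_prod.
Qed.

Lemma measf_coord D n (f : T -> 'rV[R]_n) i : measurable_fun D f ->
  measurable_fun D (fun z => f z ord0 i).
Proof. by move=> mf; apply: (measurableT_comp (measurable_rV_coord i) mf). Qed.

Lemma measf_rV n (f : T -> 'rV[R]_n) :
  (forall i, measurable_fun setT (fun z => f z ord0 i)) ->
  measurable_fun setT f.
Proof. by move=> mf; apply: measurable_fun_rV => i; exact: mf. Qed.

Lemma measf_fst D d1 d2 (T1 : measurableType d1) (T2 : measurableType d2)
    (f : T -> T1 * T2) : measurable_fun D f ->
  measurable_fun D (fun z => (f z).1).
Proof. by move=> mf; apply: (measurableT_comp measurable_fst mf). Qed.

Lemma measf_snd D d1 d2 (T1 : measurableType d1) (T2 : measurableType d2)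
    (f : T -> T1 * T2) : measurable_fun D f ->
  measurable_fun D (fun z => (f z).2).
Proof. by move=> mf; apply: (measurableT_comp measurable_snd mf). Qed.

Lemma measf_pair d1 d2 (T1 : measurableType d1) (T2 : measurableType d2)
    (f : T -> T1) (g : T -> T2) :
  measurable_fun setT f -> measurable_fun setT g ->
  measurable_fun setT (fun z => (f z, g z)).
Proof. exact: measurable_fun_pair. Qed.

Lemma measfE D f : measurable_fun D f -> measurable_fun D (fun z => (f z)%:E).
Proof. by move/measurable_EFinP. Qed.

Lemma measf_eM D (f g : T -> \bar R) : measurable_fun D f ->
  measurable_fun D g -> measurable_fun D (fun z => f z * g z)%E.
Proof. exact: emeasurable_funM. Qed.

Lemma measf_eD D (f g : T -> \bar R) : measurable_fun D f ->
  measurable_fun D g -> measurable_fun D (fun z => f z + g z)%E.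
Proof. exact: emeasurable_funD. Qed.

Lemma measf_if D (b : T -> bool) d' (T' : measurableType d') (f g : T -> T') :
  measurable D -> measurable_fun D b -> measurable_fun D f ->
  measurable_fun D g -> measurable_fun D (fun z => if b z then f z else g z).
Proof.
move=> mD mb mf mg; apply: measurable_fun_if => //.
- by apply: measurable_funS mf => //; exact: subIsetl.
- by apply: measurable_funS mg => //; exact: subIsetl.
Qed.

Lemma measf_lt D f g : measurable_fun D f -> measurable_fun D g ->
  measurable_fun D (fun z => f z < g z).
Proof. exact: measurable_fun_ltr. Qed.

Lemma measf_le D f g : measurable_fun D f -> measurable_fun D g ->
  measurable_fun D (fun z => f z <= g z).
Proof. exact: measurable_fun_ler. Qed.

Lemma measf_and D (f g : T -> bool) : measurable_fun D f -> measurable_fun D g ->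
  measurable_fun D (fun z => f z && g z).
Proof. exact: measurable_and. Qed.

Lemma measf_cst D d' (T' : measurableType d') (c : T') :
  measurable_fun D (fun _ => c).
Proof. exact: measurable_cst. Qed.

End measurability.

Ltac meas_hyp := match goal with
    H : measurable_fun setT ?F |- measurable_fun _ (fun z => ?F (@?g z)) =>
      apply: (measurableT_comp H)
  end.
(** An extension point, rebound later when [gam], [Gam], [DGam], [cyl] and the like have
    measurability lemmas of their own. *)
Ltac meas_ext := fail.
Ltac meas_any := first
  [ assumption | exact: measurableT | meas_hyp | apply: measf_if
  | exact: measf_cst | meas_ext | apply: measf_sum => ? | apply: measf_prod => ?
  | apply: measf_eM | apply: measf_eD ].
(* Syntactic dispatch: trying all the lemmas in turn is much slower. *)
Ltac meas1 := lazymatch goal with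
  | |- measurable_fun _ ?f => lazymatch f with
    | fst => exact: measurable_fst
    | snd => exact: measurable_snd
    | (fun z => z) => exact: measurable_id
    | Order.lt _ => apply: measf_lt
    | Order.le _ => apply: measf_le
    | GRing.add _ => apply: measfD
    | GRing.mul _ => apply: measfM
    | GRing.opp => apply: measfN
    | GRing.inv => apply: measfV
    | (fun z => EFin (@?g z)) => first [assumption | apply: measfE | meas_any]
    | (fun z => (@?g z).1) => first [assumption | apply: measf_fst]
    | (fun z => (@?g z).2) => first [assumption | apply: measf_snd]
    | (fun z => (@?g z, @?h z)) => first [assumption | apply: measf_pair]
    | (fun z => GRing.add (@?g z) (GRing.opp (@?h z))) =>
      first [assumption | apply: measfB | meas_any]
    | (fun z => GRing.add (@?g z) (@?h z)) => first [assumption | apply: measfD | meas_any]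
    | (fun z => GRing.mul (@?g z) (@?h z)) => first [assumption | apply: measfM | meas_any]
    | (fun z => GRing.opp (@?g z)) => first [assumption | apply: measfN | meas_any]
    | (fun z => GRing.inv (@?g z)) => first [assumption | apply: measfV | meas_any]
    | (fun z => GRing.exp (@?g z) _) => first [assumption | apply: measfX | meas_any]
    | (fun z => Num.norm (@?g z)) => first [assumption | apply: measf_norm | meas_any]
    | (fun z => expR (@?g z)) => first [assumption | apply: measf_expR | meas_any]
    | (fun z => powR (@?g z) _) => first [assumption | apply: measf_powR | meas_any]
    | (fun z => andb (@?g z) (@?h z)) => first [assumption | apply: measf_and | meas_any]
    | (fun z => Order.lt (@?g z) (@?h z)) => first [assumption | apply: measf_lt | meas_any]
    | (fun z => Order.le (@?g z) (@?h z)) => first [assumption | apply: measf_le | meas_any]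
    | (fun z => fun_of_matrix (@?g z) _ _) => first [assumption | apply: measf_coord | meas_any]
    | _ => meas_any
    end
  | |- _ -> forall Y, _ =>
    first [apply: measfD | apply: measfM | apply: measf_cst | meas_any]
  | |- _ => meas_any
  end.
Ltac meas := repeat (cbv beta; meas1).

Section rV_integration.
Context {R : realType}.
Local Notation leb := (@lebesgue_measure R).
Local Notation lebn n := (@lebesgue_rV R n).

Lemma consrV0 n a (v : 'rV[R]_n) : consrV (a, v) ord0 ord0 = a.
Proof. by rewrite mxE unlift_none. Qed.

Lemma consrVS n a (v : 'rV[R]_n) i : consrV (a, v) ord0 (lift ord0 i) = v ord0 i.
Proof. by rewrite mxE liftK. Qed.

Lemma ge0_integral_rVS n (f : 'rV[R]_n.+1 -> \bar R) :
  measurable_fun setT f -> (forall x, 0 <= f x)%E ->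
  (\int[lebn n.+1]_x f x = \int[leb]_a \int[lebn n]_v f (consrV (a, v)))%E.
Proof.
move=> mf f0.
transitivity (\int[leb \x lebn n]_z (f \o @consrV R n) z)%E.
  have := ge0_integral_pushforward (@measurable_consrV R n) (leb \x lebn n)%E
    measurableT mf.
  by rewrite preimage_setT; apply => x _.
rewrite fubini_tonelli1 => [//||z]; last exact: f0.
by apply: measurableT_comp => //; exact: measurable_consrV.
Qed.

Lemma ge0_integral_rV0 (f : 'rV[R]_0 -> \bar R) :
  measurable_fun setT f -> (\int[lebn 0]_x f x = f 0%R)%E.
Proof. by move=> mf; rewrite /= integral_dirac// diracT mul1e. Qed.

Lemma ge0_integral_oppr (f : R -> \bar R) :
  measurable_fun setT f -> (forall x, 0 <= f x)%E ->
  (\int[leb]_x f (- x)%R = \int[leb]_x f x)%E.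
Proof.
move=> mf f0.
have mN : measurable_fun setT (-%R : measurableTypeR R -> measurableTypeR R).
  exact: oppr_measurable.
have := ge0_integral_pushforward mN leb measurableT mf.
rewrite preimage_setT => <- //.
by apply: eq_measure_integral => //= A mA _; exact: lebesgue_measureN.
Qed.

Definition flip n (e : 'I_n -> bool) (x : 'rV[R]_n) : 'rV[R]_n :=
  \row_i ((-1) ^+ e i * x ord0 i).

Lemma measurable_flip n (e : 'I_n -> bool) : measurable_fun setT (flip e).
Proof.
apply: measf_rV => i; rewrite (_ : (fun _ => _) = fun x : 'rV[R]_n => (-1) ^+ e i * x ord0 i).
  by meas.
by apply/funext => x; rewrite mxE.
Qed.

Lemma ge0_integral_flip n (e : 'I_n -> bool) (f : 'rV[R]_n -> \bar R) :
  measurable_fun setT f -> (forall x, 0 <= f x)%E ->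
  (\int[lebn n]_x f (flip e x) = \int[lebn n]_x f x)%E.
Proof.
move=> mf f0; elim: n => [|n IH] in e f mf f0 *.
  rewrite !ge0_integral_rV0//; last first.
    by apply: measurableT_comp => //; exact: measurable_flip.
  by congr f; apply/rowP => -[].
have mff : measurable_fun setT (f \o flip e).
  by apply: measurableT_comp => //; exact: measurable_flip.
rewrite (@ge0_integral_rVS _ (f \o flip e) mff (fun=> f0 _)).
rewrite [RHS]ge0_integral_rVS//.
have flipc a v : flip e (consrV (a, v)) =
    consrV ((-1) ^+ e ord0 * a, flip (e \o lift ord0) v).
  apply/rowP => i; case: (unliftP ord0 i) => [j ->|->].
    by rewrite mxE !consrVS mxE.
  by rewrite mxE !consrV0.
have mfc a : measurable_fun setT (fun v => f (consrV (a, v))).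
  apply: (measurableT_comp mf); apply: (measurableT_comp (@measurable_consrV R n)).
  by meas.
under eq_integral.
  move=> a _ /=; under eq_integral do rewrite flipc.
  rewrite (IH (e \o lift ord0) (fun v => f (consrV ((-1) ^+ e ord0 * a, v)))
    (mfc _) (fun=> f0 _)).
  over.
case: (e ord0) => /=; last by under eq_integral do rewrite expr0 mul1r.
under eq_integral do rewrite expr1 mulN1r.
apply: (@ge0_integral_oppr (fun a => \int[lebn n]_v f (consrV (a, v)))%E).
  apply: (@measurable_fun_fubini_tonelli_F _ _ _ _ _ (lebn n) (f \o @consrV R n)).
    by apply: measurableT_comp => //; exact: measurable_consrV.
  by move=> z; exact: f0.
by move=> a; exact: integral_ge0.
Qed.

Lemma ge0_integral_prod_rV n (f : 'I_n -> R -> R) (c : 'I_n -> R) :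
  (forall i, measurable_fun setT (f i)) -> (forall i a, 0 <= f i a) ->
  (forall i, (\int[leb]_a (f i a)%:E = (c i)%:E)%E) ->
  (\int[lebn n]_x (\prod_i f i (x ord0 i))%:E = (\prod_i c i)%:E)%E.
Proof.
elim: n => [|n IH] in f c * => mf f0 fc.
  rewrite ge0_integral_rV0 ?big_ord0//.
  by under eq_fun do rewrite big_ord0; exact: measf_cst.
have mp m (g : 'I_m -> R -> R) : (forall i, measurable_fun setT (g i)) ->
    measurable_fun setT (fun x : 'rV[R]_m => (\prod_i g i (x ord0 i))%:E).
  move=> mg; apply: measfE; apply: measf_prod => i.
  by apply: measurableT_comp => //; meas.
rewrite ge0_integral_rVS; last 2 first.
- exact: mp.
- by move=> x; rewrite lee_fin; apply: prodr_ge0 => i _.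
under eq_integral.
  move=> a _; under eq_integral.
    move=> v _; rewrite big_ord_recl consrV0.
    under eq_bigr do rewrite consrVS.
    rewrite EFinM; over.
  rewrite /= ge0_integralZl//=; last 3 first.
  - exact: (mp n (fun i => f (lift ord0 i))).
  - by move=> x _; rewrite lee_fin; apply: prodr_ge0 => i _.
  - by rewrite lee_fin.
  rewrite (IH (fun i => f (lift ord0 i)) (c \o lift ord0))//.
  over.
rewrite /= ge0_integralZr//=; last 3 first.
- exact: (measfE (mf ord0)).
- by move=> x _; rewrite lee_fin.
- rewrite lee_fin; apply: prodr_ge0 => i _ /=.
  by rewrite -lee_fin -fc integral_ge0 // => x _; rewrite lee_fin.
by rewrite big_ord_recl EFinM -fc.
Qed.

(** The signed version is needed because derivatives of Gaussians change sign; integrability comes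
    from the nonnegative version applied to the absolute values of the factors. *)
Lemma integral_prod_rV n (f : 'I_n -> R -> R) (c : 'I_n -> R) :
  (forall i, leb.-integrable setT (EFin \o f i)) ->
  (forall i, (\int[leb]_a (f i a)%:E = (c i)%:E)%E) ->
  (lebn n).-integrable setT (fun x => (\prod_i f i (x ord0 i))%:E) /\
  (\int[lebn n]_x (\prod_i f i (x ord0 i))%:E = (\prod_i c i)%:E)%E.
Proof.
move=> intf.
have mf i : measurable_fun setT (f i).
  by have /measurable_int/measurable_EFinP := intf i.
move=> fc.
have mp : forall m (g : 'I_m -> R -> R), (forall i, measurable_fun setT (g i)) ->
    measurable_fun setT (fun x : 'rV[R]_m => (\prod_i g i (x ord0 i))%:E).
  move=> m g mg; apply: measfE; apply: measf_prod => i.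
  by apply: measurableT_comp => //; meas.
have intp : forall m (g : 'I_m -> R -> R),
   (forall i, leb.-integrable setT (EFin \o g i)) ->
   (lebn m).-integrable setT (fun x => (\prod_i g i (x ord0 i))%:E).
  move=> m g ig.
  have mg i : measurable_fun setT (g i).
    by have /measurable_int/measurable_EFinP := ig i.
  apply/integrableP; split; first exact: mp.
  under eq_integral do rewrite /= normr_prod.
  rewrite (@ge0_integral_prod_rV m (fun i a => `|g i a|)
     (fun i => fine (\int[leb]_a (`|g i a|%R)%:E)%E)) ?ltry//.
    by move=> i; apply: measf_norm.
  move=> i; rewrite fineK//.
  have /integrableP[_] := ig i.
  by rewrite ge0_fin_numE// integral_ge0.
split; first exact: intp.
elim: n => [|n IH] in f c intf mf fc *.
  rewrite ge0_integral_rV0 ?big_ord0//.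
  by under eq_fun do rewrite big_ord0; exact: measf_cst.
have intc : (leb \x lebn n)%E.-integrable setT
    ((fun x => (\prod_i f i (x ord0 i))%:E) \o @consrV R n).
  apply/integrableP; split.
    by apply: (measurableT_comp (mp _ _ mf)); exact: measurable_consrV.
  have /integrableP[_] := intp _ _ intf.
  have mabs : measurable_fun setT
      (fun x : 'rV[R]_n.+1 => `|(\prod_i f i (x ord0 i))%:E|)%E.
    by apply: measurableT_comp => //; exact: mp.
  have := ge0_integral_pushforward (@measurable_consrV R n) (leb \x lebn n)%E
    measurableT mabs.
  by rewrite preimage_setT => <-.
transitivity (\int[leb \x lebn n]_z ((fun x => (\prod_i f i (x ord0 i))%:E) \o @consrV R n) z)%E.
  have := integral_pushforward (@measurable_consrV R n) (mu := (leb \x lebn n)%E) (mp _ _ mf) (D := setT).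
  by rewrite preimage_setT => ->.
rewrite -integral12_prod_meas1//.
under eq_integral.
  move=> a _; rewrite /fubini_F /=; under eq_integral.
    move=> v _; rewrite big_ord_recl consrV0.
    under eq_bigr do rewrite consrVS.
    rewrite EFinM; over.
  rewrite /= integralZl//=; last exact: (intp n (fun i => f (lift ord0 i))).
  rewrite (IH (fun i => f (lift ord0 i)) (c \o lift ord0))//.
  over.
rewrite /= integralZr//=; last exact: (intf ord0).
by rewrite big_ord_recl EFinM -fc.
Qed.

End rV_integration.

(** * One-dimensional Gaussians *)

Section derivation.
Context {R : realType}.
Implicit Types (f g : R -> R) (x a b c : R).

(** The rules below produce the derivative in a fixed shape; this lemma leaves to [ring] or [field]
    its identification with the wanted value. *)
Lemma isd_eq f x a b : is_derive x 1 f a -> a = b -> is_derive x 1 f b.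
Proof. by move=> fa <-. Qed.

Lemma isd_cst x c : is_derive x 1 (fun _ : R => c) 0.
Proof. exact: is_derive_cst. Qed.

Lemma isd_id x : is_derive x 1 (fun z : R => z) 1.
Proof. exact: is_derive_id. Qed.

Lemma isdD f g x a b : is_derive x 1 f a -> is_derive x 1 g b ->
  is_derive x 1 (fun z => f z + g z) (a + b).
Proof. by move=> fa gb; exact: is_deriveD. Qed.

Lemma isdB f g x a b : is_derive x 1 f a -> is_derive x 1 g b ->
  is_derive x 1 (fun z => f z - g z) (a - b).
Proof. by move=> fa gb; exact: is_deriveB. Qed.

Lemma isdN f x a : is_derive x 1 f a -> is_derive x 1 (fun z => - f z) (- a).
Proof. by move=> fa; exact: is_deriveN. Qed.

Lemma isdM f g x a b : is_derive x 1 f a -> is_derive x 1 g b ->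
  is_derive x 1 (fun z => f z * g z) (a * g x + f x * b).
Proof.
move=> fa gb; have := is_deriveM fa gb; congr (is_derive _ _ _ _).
by rewrite addrC [g x *: a]mulrC.
Qed.

Lemma isdX f x a k : is_derive x 1 f a ->
  is_derive x 1 (fun z => f z ^+ k) (k%:R * f x ^+ k.-1 * a).
Proof.
move=> fa; elim: k => [|k IH].
  by apply: isd_eq (isd_cst x 1) _; rewrite !mul0r.
have := isdM fa IH; under eq_fun do rewrite -exprS.
move/isd_eq; apply; rewrite mulrSr.
by case: k IH => [|k] IH; rewrite /= ?exprS; ring.
Qed.

Lemma isd_comp f g x a b : is_derive (g x) 1 f a -> is_derive x 1 g b ->
  is_derive x 1 (fun z => f (g z)) (a * b).
Proof. exact: is_derive1_comp. Qed.

Lemma isd_expR f x a : is_derive x 1 f a ->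
  is_derive x 1 (fun z => expR (f z)) (expR (f x) * a).
Proof. by move=> fa; apply: isd_comp => //; exact: is_derive_expR. Qed.

Lemma isd_horner (p : {poly R}) x : is_derive x 1 (horner p) (p^`()).[x].
Proof.
elim/poly_ind: p => [|p c IH].
  rewrite deriv0 horner0; have -> : horner (0 : {poly R}) = fun _ => 0.
    by apply/funext => z; rewrite horner0.
  exact: isd_cst.
have -> : horner (p * 'X + c%:P) = fun z => p.[z] * z + c.
  by apply/funext => z; rewrite hornerMXaddC.
apply: (isd_eq (isdD (isdM IH (isd_id x)) (isd_cst x c))).
by rewrite derivMXaddC !hornerE; ring.
Qed.

Lemma isd_continuous f x a : is_derive x 1 f a -> {for x, continuous f}.
Proof. by move=> [df _]; exact/differentiable_continuous/derivable1_diffP. Qed.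

End derivation.

Section poly_gauss.
Context {R : realType}.

Lemma poly_growth (p : {poly R}) : exists j A, 0 <= A /\
  forall x, `|p.[x]| <= A * (1 + `|x|) ^+ j.
Proof.
elim/poly_ind: p => [|p c [j [A [A0 IH]]]].
  by exists 0%N, 0; split => // x; rewrite horner0 normr0 mul0r.
exists j.+1, (A + `|c|); split; first by rewrite addr_ge0.
move=> x; rewrite hornerMXaddC mulrDl.
apply: (le_trans (ler_normD _ _)); apply: lerD.
  rewrite normrM exprSr mulrA ler_pM//.
  by rewrite lerDr.
by rewrite ler_peMr// exprn_ege1// lerDl.
Qed.

(** Since 1 + |x| <= exp |x|, the polynomial factors are at most A exp(N |x|), and completing the
    square in N |x| - c x^2 leaves N^2 / (4 c), which is the exponent in the witness. *)
Lemma poly_gauss_bound (p : {poly R}) k c : 0 < c -> exists M : R, 0 <= M /\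
  forall x, (1 + `|x|) ^+ k * `|p.[x]| * expR (- (c * x ^+ 2)) <= M.
Proof.
move=> c0; have [j [A [A0 pA]]] := poly_growth p.
set N := (k + j)%:R : R.
exists (A * expR (N ^+ 2 / (4 * c))); split; first by rewrite mulr_ge0// expR_ge0.
move=> x.
have h1 : (1 + `|x|) ^+ k * `|p.[x]| <= A * (1 + `|x|) ^+ (k + j).
  rewrite exprD mulrCA ler_wpM2l ?exprn_ge0 ?addr_ge0//.
apply: (le_trans (ler_wpM2r (expR_ge0 _) h1)); rewrite -mulrA ler_wpM2l//.
have h2 : (1 + `|x|) ^+ (k + j) <= expR (N * `|x|).
  rewrite /N mulrC expRM_natr lerXn2r ?nnegrE ?addr_ge0 ?expR_ge0//.
  exact: expR_ge1Dx.
apply: (le_trans (ler_wpM2r (expR_ge0 _) h2)).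
rewrite -expRD ler_expR -(real_normK (num_real x)).
rewrite -subr_ge0.
rewrite (_ : _ - _ = c * (`|x| - N / (2 * c)) ^+ 2); last by field; rewrite gt_eqF.
by rewrite mulr_ge0 ?sqr_ge0// ltW.
Qed.

End poly_gauss.

Section gaussian.
Context {R : realType}.
Local Notation leb := (@lebesgue_measure R).
Implicit Types (t a b c x y z : R).

Definition gam t x : R := (4 * pi * t) `^ (- 2^-1) * expR (- x ^+ 2 / (4 * t)).

Lemma gam_gt0 t x : 0 < t -> 0 < gam t x.
Proof.
by move=> t0; rewrite mulr_gt0 ?expR_gt0// powR_gt0// !mulr_gt0// pi_gt0.
Qed.

Lemma gam_ge0 t x : 0 <= gam t x.
Proof. by rewrite mulr_ge0 ?expR_ge0// powR_ge0. Qed.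

Lemma gamN t x : gam t (- x) = gam t x.
Proof. by rewrite /gam sqrrN. Qed.

Lemma measf_gam d (T : measurableType d) (D : set T) (f g : T -> R) :
  measurable_fun D f -> measurable_fun D g ->
  measurable_fun D (fun z : T => gam (f z) (g z)).
Proof. by move=> mf mg; rewrite /gam; meas. Qed.

Lemma gam_pdf t x y : 0 < t -> gam t (x - y) = normal_pdf x (Num.sqrt (2 * t)) y.
Proof.
move=> t0; have s0 : 0 < Num.sqrt (2 * t) by rewrite sqrtr_gt0 mulr_gt0.
rewrite normal_pdfE ?gt_eqF// /gam /normal_peak /normal_fun.
rewrite powRN powR12_sqrt; last by rewrite !mulr_ge0 ?pi_ge0// ltW.
rewrite !sqr_sqrtr ?mulr_ge0 ?(ltW t0)//; congr (_ ^-1 * expR _).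
  by congr Num.sqrt; ring.
rewrite -[y - x]opprB sqrrN; congr (_ / _); ring.
Qed.

Lemma integral_gam t x : 0 < t -> (\int[leb]_y (gam t (x - y))%:E = 1)%E.
Proof.
by move=> t0; under eq_integral do rewrite gam_pdf//; exact: integral_normal_pdf.
Qed.

Lemma integral_gam' t x : 0 < t -> (\int[leb]_y (gam t (y - x))%:E = 1)%E.
Proof.
move=> t0; rewrite -(integral_gam x t0); apply: eq_integral => y _.
by rewrite -gamN opprB.
Qed.

Lemma integrable_gam t x : 0 < t ->
  leb.-integrable setT (EFin \o (fun y => gam t (x - y))).
Proof.
move=> t0; apply/integrableP; split.
  by apply: measfE; apply: measf_gam; meas.
under eq_integral do rewrite /= ger0_norm ?gam_ge0//.
by rewrite integral_gam// ltry.
Qed.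

(** Completing the square. For the pair x - z, z - y the first factor no longer depends on z and the
    second is a Gaussian in z, so the semigroup law [gam_conv] is immediate. *)
Lemma gamM a b x y : 0 < a -> 0 < b ->
  gam a x * gam b y = gam (a + b) (x + y) *
    gam (a * b / (a + b)) ((b * x - a * y) / (a + b)).
Proof.
move=> a0 b0; have ab0 : 0 < a + b by rewrite addr_gt0.
rewrite /gam mulrACA [RHS]mulrACA.
have p4 : 0 <= 4 * pi :> R by rewrite mulr_ge0 ?pi_ge0.
have ppi : pi != 0 :> R by rewrite gt_eqF ?pi_gt0.
rewrite -!powRM ?mulr_ge0 ?divr_ge0 ?invr_ge0 ?mulr_ge0// ?(ltW a0) ?(ltW b0) ?(ltW ab0)// ?pi_ge0//.
rewrite -!expRD; congr (_ `^ _ * expR _); field; rewrite ?ppi ?(gt_eqF a0) ?(gt_eqF b0) ?(gt_eqF ab0)//.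
Qed.

Lemma gam_conv a b x y : 0 < a -> 0 < b ->
  (\int[leb]_z (gam a (x - z) * gam b (z - y))%:E = (gam (a + b) (x - y))%:E)%E.
Proof.
move=> a0 b0; have ab0 : 0 < a + b by rewrite addr_gt0.
under eq_integral.
  move=> z _; rewrite gamM// addrA subrK.
  rewrite (_ : (b * (x - z) - a * (z - y)) / (a + b) =
     (b * x + a * y) / (a + b) - z); last by field; rewrite gt_eqF.
  rewrite EFinM; over.
rewrite /= ge0_integralZl//=.
- rewrite integral_gam ?mule1// divr_gt0// mulr_gt0//.
- by apply: measfE; apply: measf_gam; meas.
- by move=> z _; rewrite lee_fin gam_ge0.
- by rewrite lee_fin gam_ge0.
Qed.

(** Hermite polynomials up to scaling: the recursion is (p gam)' = (p' - x p / (2 t)) gam, so that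
    [dgam m t] is the m-th derivative of [gam t]. *)
Fixpoint hpoly t m : {poly R} :=
  if m is k.+1 then (hpoly t k)^`() - (2 * t)^-1 *: ('X * hpoly t k) else 1.

Definition dgam m t x : R := (hpoly t m).[x] * gam t x.

Lemma dgam0 t x : dgam 0 t x = gam t x.
Proof. by rewrite /dgam hornerC mul1r. Qed.

Lemma dgam1 t x : dgam 1 t x = - (x / (2 * t)) * gam t x.
Proof. by rewrite /dgam /= derivC sub0r mulr1 hornerN hornerZ hornerX [_^-1 * _]mulrC. Qed.

Lemma dgam2 t x : t != 0 -> dgam 2 t x = (x ^+ 2 / (4 * t ^+ 2) - (2 * t)^-1) * gam t x.
Proof.
move=> t0; rewrite /dgam /= derivC sub0r mulr1 derivN derivZ derivX.
rewrite !(hornerD, hornerN, hornerZ, hornerM, hornerX, hornerC).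
by congr (_ * gam _ _); field.
Qed.

Lemma isd_gam t x : t != 0 -> is_derive x 1 (gam t) (- (x / (2 * t)) * gam t x).
Proof.
move=> t0; rewrite /gam.
apply: (isd_eq (isdM (isd_cst x _) (isd_expR (isdM (isdN (isdX 2 (isd_id x)))
  (isd_cst x _))))).
by rewrite /=; field.
Qed.

Lemma isd_dgam m t x : t != 0 -> is_derive x 1 (dgam m t) (dgam m.+1 t x).
Proof.
move=> t0; rewrite /dgam.
apply: (isd_eq (isdM (isd_horner (hpoly t m) x) (isd_gam x t0))).
by rewrite /= !(hornerD, hornerN, hornerZ, hornerM, hornerX); field.
Qed.

Lemma hpolyN m t x : (hpoly t m).[- x] = (-1) ^+ m * (hpoly t m).[x].
Proof.
suff : hpoly t m \Po (- 'X) = (-1) ^+ m *: hpoly t m.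
  move/(congr1 (fun p => p.[x])); rewrite horner_comp !hornerE => ->//.
elim: m => [|m IH]; first by rewrite /= comp_polyC expr0 scale1r.
rewrite /= comp_polyB comp_polyZ comp_polyM comp_polyX IH.
have -> : (hpoly t m)^`() \Po - 'X = - ((hpoly t m \Po - 'X)^`()).
  by rewrite deriv_comp derivN derivX mulrN mulr1 opprK.
rewrite IH derivZ exprS mulN1r !scaleNr scalerBr opprB.
rewrite mulNr scalerN opprK -scalerAr !scalerA addrC.
by rewrite [in (2 * t)^-1 * _]mulrC.
Qed.

Lemma dgamN m t x : dgam m t (- x) = (-1) ^+ m * dgam m t x.
Proof. by rewrite /dgam hpolyN gamN -mulrA. Qed.

Lemma measf_dgam m t d (T : measurableType d) (f : T -> R) (D : set T) :
  measurable_fun D f -> measurable_fun D (fun z : T => dgam m t (f z)).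
Proof.
move=> mf; rewrite /dgam.
apply: measfM; last by apply: measf_gam; meas.
elim/poly_ind: (hpoly t m) => [|p c IH].
  by under eq_fun do rewrite horner0; meas.
by under eq_fun do rewrite hornerMXaddC; meas.
Qed.

(** Half of the exponent of [gam t] absorbs the polynomial and the weight; the other half is the
    exponent of [gam (2 * t)]. *)
Lemma dgam_bound m t k : 0 < t -> exists M : R, 0 <= M /\
  forall x, (1 + `|x|) ^+ k * `|dgam m t x| <= M * gam (2 * t) x.
Proof.
move=> t0.
have c0 : 0 < (8 * t)^-1 by rewrite invr_gt0 mulr_gt0.
have [M [M0 HM]] := poly_gauss_bound (hpoly t m) k c0.
(* Ratio of the normalising factors of [gam] at the times t and 2 t. *)
pose r : R := 2 `^ 2^-1.
have r0 : 0 <= r by exact: powR_ge0.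
exists (M * r); split; first by rewrite mulr_ge0.
move=> x; rewrite /dgam normrM (ger0_norm (gam_ge0 _ _)).
have -> : gam t x = r * gam (2 * t) x * expR (- ((8 * t)^-1 * x ^+ 2)).
  have p0 : 4 * pi * t != 0 by rewrite !mulf_neq0// ?gt_eqF ?pi_gt0.
  have H : (4 * pi * t) `^ (- 2^-1) = r * (4 * pi * (2 * t)) `^ (- 2^-1) :> R.
    rewrite [4 * pi * (2 * t)]mulrCA [(2 * _) `^ _]powRM//; last first.
      by rewrite !mulr_ge0 ?pi_ge0// ltW.
    by rewrite mulrA -powRD ?subrr ?powRr0 ?mul1r// pnatr_eq0 implybT.
  by rewrite /gam H -!mulrA -expRD; congr (_ * (_ * expR _)); field; rewrite gt_eqF.
rewrite (_ : _ * _ = (1 + `|x|) ^+ k * `|(hpoly t m).[x]| *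
   expR (- ((8 * t)^-1 * x ^+ 2)) * (r * gam (2 * t) x)); last by ring.
by rewrite -[leRHS]mulrA ler_wpM2r// mulr_ge0// gam_ge0.
Qed.

Lemma dgam_bounded m t k : 0 < t -> exists M : R, 0 <= M /\
  forall x, (1 + `|x|) ^+ k * `|dgam m t x| <= M.
Proof.
move=> t0; have [M [M0 HM]] := dgam_bound m k t0.
exists (M * (4 * pi * (2 * t)) `^ (- 2^-1)); split.
  by rewrite mulr_ge0 ?powR_ge0.
move=> x; apply: (le_trans (HM x)); rewrite ler_wpM2l// ler_piMr ?powR_ge0//.
rewrite -[leRHS]expR0 ler_expR mulNr oppr_le0 divr_ge0 ?sqr_ge0//.
by rewrite !mulr_ge0// ltW.
Qed.

Lemma integrable_dgamM m t x (h : R -> R) (N : R) : 0 < t ->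
  measurable_fun setT h -> (forall z, `|h z| <= N) ->
  leb.-integrable setT (EFin \o (fun z => dgam m t (x - z) * h z)).
Proof.
move=> t0 mh hN; have [M [M0 HM]] := dgam_bound m 0 t0.
have N0 : 0 <= N by rewrite (le_trans _ (hN 0)).
apply: (@le_integrable _ _ _ leb setT measurableT _
   (fun z => ((M * N)%:E * (gam (2 * t) (x - z))%:E)%E)).
- apply: measfE; apply: measfM => //.
  by apply: measf_dgam; meas.
- move=> z _; rewrite /= lee_fin normrM (ger0_norm (mulr_ge0 (mulr_ge0 M0 N0) (gam_ge0 _ _))).
  rewrite mulrAC ler_pM//; have := HM (x - z).
  by rewrite expr0 mul1r.
- by apply: integrableZl => //; apply: integrable_gam; rewrite mulr_gt0.
Qed.

Lemma integrable_dgam m t x : 0 < t ->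
  leb.-integrable setT (EFin \o (fun z => dgam m t (x - z))).
Proof.
move=> t0; rewrite (_ : (fun z => dgam m t (x - z)) =
  (fun z => dgam m t (x - z) * 1)); last first.
  by apply/funext => z; rewrite mulr1.
by apply: (@integrable_dgamM _ _ _ (fun _ => 1) 1) => // z; rewrite normr1.
Qed.

(** Differentiation under the integral: [dh] is bounded on the whole line, so M |A| dominates for
    every value of the parameter and the unit interval around [y] is an arbitrary choice. *)
Lemma isd_conv (A h dh : R -> R) (M N : R) y : leb.-integrable setT (EFin \o A) ->
  (forall z, is_derive z 1 h (dh z)) -> (forall z, `|h z| <= N) ->
  (forall z, `|dh z| <= M) ->
  is_derive y 1 (fun y => \int[leb]_z (A z * h (y - z)))
    (\int[leb]_z (A z * dh (y - z))).
Proof.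
move=> iA hdh hN dhM.
have mA : measurable_fun setT A by have /measurable_int/measurable_EFinP := iA.
have ch : measurable_fun setT h.
  apply: continuous_measurable_fun => z; exact: isd_continuous (hdh z).
have dsub (u v : R) : is_derive u 1 (fun u => h (u - v)) (dh (u - v)).
  refine (isd_eq (isd_comp (g := fun z => z - v) (hdh (u - v)) (isdB (isd_id u) (isd_cst u v))) _).
  by rewrite subr0 mulr1.
pose f (u z : R) := A z * h (u - z).
have dfz (u z : R) : is_derive u 1 (f ^~ z) (A z * dh (u - z)).
  by apply: (isd_eq (isdM (isd_cst u (A z)) (dsub u z))); rewrite mul0r add0r.
have Iy : `]y - 1, y + 1[%classic y by rewrite /= in_itv /= ltrBlDr ltrDl andbb.
have ifz (u : R) : leb.-integrable setT (EFin \o f u).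
  apply: (@le_integrable _ _ _ leb setT measurableT _ (fun z => (N%:E * `|(A z)%:E|)%E)).
  - apply: measfE; apply: measfM => //.
    by apply: (measurableT_comp ch); meas.
  - move=> z _; rewrite /= lee_fin normrM mulrC normrM normr_id ler_wpM2r//.
    by rewrite (le_trans (hN _))// ler_norm.
  - by apply: integrableZl => //; exact: integrable_abse iA.
have iG : leb.-integrable setT (EFin \o (fun z => M * `|A z|)).
  have := integrableZl measurableT M (integrable_abse iA).
  by [].
have M0 : 0 <= M by rewrite (le_trans _ (dhM 0)).
have G0 z : 0 <= M * `|A z| by rewrite mulr_ge0.
have d1f (u z : R) : partial1of2 f u z = A z * dh (u - z).
  by rewrite partial1of2E; exact: (@derive_val _ _ _ _ _ _ _ (dfz u z)).
have H1 := @derivable_under_integral R _ _ leb f setT measurableT y _ _ Iy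
  (fun u _ => ifz u) (fun u z _ _ => @ex_derive _ _ _ _ _ _ _ (dfz u z)) _ G0 iG.
have H2 := @differentiation_under_integral R _ _ leb f setT measurableT y _ _ Iy
  (fun u _ => ifz u) (fun u z _ _ => @ex_derive _ _ _ _ _ _ _ (dfz u z)) _ G0 iG.
have bd : forall u z : R, `]y - 1, y + 1[%classic u -> [set: R] z ->
    `|partial1of2 f u z| <= M * `|A z|.
  by move=> u z _ _; rewrite d1f normrM mulrC ler_wpM2r.
split; first exact: H1.
rewrite -derive1E H2//; apply: eq_Rintegral => z _; exact: d1f.
Qed.

(** The semigroup law differentiated k times in x and m times in y; each induction step
    differentiates the previous identity and compares the two derivatives. *)
Lemma dgam_conv k m a b x y : 0 < a -> 0 < b ->
  (\int[leb]_z (dgam k a (x - z) * dgam m b (z - y))%:E =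
   (dgam (k + m) (a + b) (x - y))%:E)%E.
Proof.
move=> a0 b0; have ab0 : 0 < a + b by rewrite addr_gt0.
have bd j t : 0 < t -> exists M : R, forall z, `|dgam j t z| <= M.
  move=> t0; have [M [_ HM]] := dgam_bounded j 0 t0.
  by exists M => z; have := HM z; rewrite expr0 mul1r.
have mg j t z : measurable_fun setT (fun u : R => dgam j t (u - z)).
  by apply: measf_dgam; meas.
have iint k' m' x' y' : leb.-integrable setT
    (EFin \o (fun z => dgam k' a (x' - z) * dgam m' b (z - y'))).
  have [M HM] := bd m' b b0.
  exact: (@integrable_dgamM k' a x' _ M a0 (mg m' b y') (fun z => HM (z - y'))).
suff H x' y' : \int[leb]_z (dgam k a (x' - z) * dgam m b (z - y')) =
    dgam (k + m) (a + b) (x' - y').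
  by rewrite -H /Rintegral fineK// (integrable_fin_num measurableT (iint _ _ _ _)).
elim: k m x' y' => [|k IH] m x' y'; last first.
  have [N HN] := bd k a a0; have [M HM] := bd k.+1 a a0.
  have iA : leb.-integrable setT (EFin \o (fun z => dgam m b (z - y'))).
    have := integrable_dgam m y' b0.
    have -> : EFin \o (fun z => dgam m b (z - y')) =
       fun z => (((-1) ^+ m)%:E * (dgam m b (y' - z))%:E)%E.
      by apply/funext => z /=; rewrite -opprB dgamN EFinM.
    by move=> ?; exact: integrableZl.
  have := isd_conv x' iA (fun z => isd_dgam k z (lt0r_neq0 a0)) HN HM.
  under eq_fun do under eq_Rintegral do rewrite mulrC.
  under eq_fun do rewrite IH.
  under [X in is_derive _ _ _ X]eq_Rintegral do rewrite mulrC.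
  move=> d1.
  have d2 : is_derive x' 1 (fun u => dgam (k + m) (a + b) (u - y')) (dgam (k + m).+1 (a + b) (x' - y')).
    apply: (isd_eq (isd_comp (g := fun z => z - y') (isd_dgam _ _ _) (isdB (isd_id x') (isd_cst x' y')))).
      by rewrite gt_eqF.
    by rewrite subr0 mulr1.
  by rewrite addSn -(@derive_val _ _ _ _ _ _ _ d2) (@derive_val _ _ _ _ _ _ _ d1).
(* Now the derivatives fall on y'; each brings a factor -1, which the parity [dgamN] compensates. *)
rewrite add0n; elim: m x' y' => [|m IH] x' y'.
  under eq_Rintegral do rewrite !dgam0.
  by rewrite dgam0 /Rintegral gam_conv.
have [N HN] := bd m b b0; have [M HM] := bd m.+1 b b0.
have iA := integrable_dgam 0 x' a0.
have := isd_conv y' iA (fun z => isd_dgam m z (lt0r_neq0 b0)) HN HM.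
have sg j u z t : dgam j t (u - z) = (-1) ^+ j * dgam j t (z - u).
  by rewrite -opprB dgamN.
have fl j (v : R) : \int[leb]_z (dgam 0 a (x' - z) * dgam j b (v - z)) =
    (-1) ^+ j * \int[leb]_z (dgam 0 a (x' - z) * dgam j b (z - v)).
  rewrite -(RintegralZl ((-1) ^+ j) measurableT (iint 0%N j x' v)).
  by apply: eq_Rintegral => z _; rewrite (sg j v) mulrCA.
under eq_fun do rewrite fl IH.
rewrite fl => d1.
have d2 : is_derive y' 1 (fun v => (-1) ^+ m * dgam m (a + b) (x' - v)) ((-1) ^+ m.+1 * dgam m.+1 (a + b) (x' - y')).
  apply: (isd_eq (isdM (isd_cst y' ((-1) ^+ m)) (isd_comp (g := fun z => x' - z) (isd_dgam m _ _)
     (isdB (isd_cst y' x') (isd_id y'))))); first by rewrite gt_eqF.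
  by rewrite exprS; ring.
have := @derive_val _ _ _ _ _ _ _ d1; rewrite (@derive_val _ _ _ _ _ _ _ d2).
have sg0 : (-1) ^+ m.+1 != 0 :> R by rewrite signr_eq0.
by move/(mulfI sg0) => ->.
Qed.

End gaussian.

(** * The heat kernel of R^n *)

Section heat_kernel.
Context {R : realType} {n : nat}.
Local Notation leb := (@lebesgue_measure R).
Local Notation lebn := (@lebesgue_rV R n).
Implicit Types (x y z : 'rV[R]_n) (s t T : R) (j : 'I_n).

Definition sqn x : R := \sum_i x ord0 i ^+ 2.

Definition Gam t x : R := \prod_i gam t (x ord0 i).

Definition DGam j t x : R := - (x ord0 j / (2 * t)) * Gam t x.

Definition Gnorm t : R := (4 * pi * t) `^ (- (n%:R / 2)).

Lemma sqn_ge0 x : 0 <= sqn x.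
Proof. by apply: sumr_ge0 => i _; rewrite sqr_ge0. Qed.

Lemma sqn_coord x j : x ord0 j ^+ 2 <= sqn x.
Proof.
by rewrite /sqn (bigD1 j)//= lerDl sumr_ge0// => i _; rewrite sqr_ge0.
Qed.

Lemma sqnN x : sqn (- x) = sqn x.
Proof. by apply: eq_bigr => i _; rewrite mxE sqrrN. Qed.

Lemma sqnB x y : sqn (x - y) = sqn (y - x).
Proof. by rewrite -sqnN opprB. Qed.

Lemma sqnD x y : sqn (x + y) <= 2 * sqn x + 2 * sqn y.
Proof.
rewrite /sqn !mulr_sumr -big_split/=; apply: ler_sum => i _; rewrite mxE.
rewrite -subr_ge0 (_ : _ - _ = (x ord0 i - y ord0 i) ^+ 2) ?sqr_ge0//; ring.
Qed.

Lemma GamE t x : Gam t x = Gnorm t * expR (- (sqn x / (4 * t))).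
Proof.
rewrite /Gam /gam big_split/= prodr_const card_ord -expR_sum.
congr (_ * expR _).
  by rewrite -powR_mulrn ?powR_ge0// -powRrM /Gnorm; congr powR; ring.
by rewrite /sqn mulr_suml -sumrN; apply: eq_bigr => i _; rewrite mulNr.
Qed.

Lemma Gnorm_ge0 t : 0 <= Gnorm t.
Proof. exact: powR_ge0. Qed.

Lemma GnormZ a t : 0 < a -> 0 < t -> Gnorm (a * t) = a `^ (- (n%:R / 2)) * Gnorm t.
Proof.
move=> a0 t0; rewrite /Gnorm mulrCA [(a * _) `^ _]powRM ?(ltW a0)//.
by rewrite !mulr_ge0 ?pi_ge0 ?ltW.
Qed.

Lemma Gnorm2 t : 0 < t -> Gnorm t = 2 `^ (n%:R / 2) * Gnorm (2 * t).
Proof.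
move=> t0; rewrite GnormZ// mulrA -powRD; first by rewrite subrr powRr0 mul1r.
by rewrite pnatr_eq0 implybT.
Qed.

Lemma Gam_ge0 t x : 0 <= Gam t x.
Proof. by apply: prodr_ge0 => i _; exact: gam_ge0. Qed.

Lemma GamN t x : Gam t (- x) = Gam t x.
Proof. by apply: eq_bigr => i _; rewrite mxE gamN. Qed.

Lemma DGam_prod j t x :
  DGam j t x = \prod_i dgam (i == j) t (x ord0 i).
Proof.
rewrite /DGam /Gam (bigD1 j)//= [RHS](bigD1 j)//= eqxx dgam1 mulrA; congr (_ * _).
by apply: eq_bigr => i /negPf ->; rewrite dgam0.
Qed.

Lemma measf_sqn d (S : measurableType d) (g : S -> 'rV[R]_n) :
  measurable_fun setT g -> measurable_fun setT (fun u => sqn (g u)).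
Proof. by move=> mg; rewrite /sqn; meas. Qed.

Lemma measf_rVB d (S : measurableType d) (f g : S -> 'rV[R]_n) :
  measurable_fun setT f -> measurable_fun setT g ->
  measurable_fun setT (fun u => f u - g u).
Proof.
move=> mf mg; apply: measf_rV => i.
have -> : (fun u => (f u - g u) ord0 i) = (fun u => f u ord0 i - g u ord0 i).
  by apply/funext => u; rewrite !mxE.
by meas.
Qed.

Lemma measf_Gam d (S : measurableType d) (f : S -> R) (g : S -> 'rV[R]_n) :
  measurable_fun setT f -> measurable_fun setT g ->
  measurable_fun setT (fun u => Gam (f u) (g u)).
Proof.
move=> mf mg; rewrite /Gam; apply: measf_prod => i.
by apply: measf_gam; meas.
Qed.

Lemma measf_DGam j d (S : measurableType d) (f : S -> R) (g : S -> 'rV[R]_n) :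
  measurable_fun setT f -> measurable_fun setT g ->
  measurable_fun setT (fun u => DGam j (f u) (g u)).
Proof.
by move=> mf mg; rewrite /DGam; apply: measfM; [meas|exact: measf_Gam].
Qed.

Lemma integral_Gam t x : 0 < t -> (\int[lebn]_y (Gam t (x - y))%:E = 1)%E.
Proof.
move=> t0; have := @ge0_integral_prod_rV R n
  (fun i a => gam t (x ord0 i - a)) (fun _ => 1).
rewrite big1// => <- //.
- apply: eq_integral => y _; congr _%:E; apply: eq_bigr => i _.
  by rewrite !mxE.
- by move=> i; apply: measf_gam; meas.
- by move=> i a; exact: gam_ge0.
- by move=> i; exact: integral_gam.
Qed.

Lemma integral_Gam' t x : 0 < t -> (\int[lebn]_y (Gam t (y - x))%:E = 1)%E.
Proof.
move=> t0; rewrite -(integral_Gam x t0); apply: eq_integral => y _.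
by rewrite -GamN opprB.
Qed.

(** The quotient of the normalisations at the times t and 2 t: the price of replacing t by a time at
    most twice as large in the Gauss kernel. *)
Definition c2 : R := 2 `^ (n%:R / 2).

Lemma c2_ge0 : 0 <= c2. Proof. exact: powR_ge0. Qed.

Lemma Gam_le2 t T x : 0 < t -> t <= T -> T <= 2 * t -> Gam t x <= c2 * Gam T x.
Proof.
move=> t0 tT Tt; have T0 : 0 < T by exact: lt_le_trans tT.
rewrite !GamE mulrA ler_pM ?Gnorm_ge0 ?expR_ge0//; last first.
  rewrite ler_expR lerN2 ler_wpM2l ?sqn_ge0// lef_pV2 ?posrE ?mulr_gt0//.
  by rewrite ler_wpM2l.
rewrite Gnorm2// ler_wpM2l ?powR_ge0// /Gnorm !powRN.
have h : 0 <= 4 * pi :> R by rewrite mulr_ge0 ?pi_ge0.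
rewrite lef_pV2 ?posrE ?powR_gt0 ?mulr_gt0 ?pi_gt0//.
by rewrite ge0_ler_powR ?nnegrE ?mulr_ge0 ?(ltW T0) ?(ltW t0) ?pi_ge0// ler_wpM2l.
Qed.

Lemma powRVh t : 0 < t -> (t `^ (- 2^-1)) ^+ 2 = t^-1.
Proof.
move=> t0; rewrite powRN powR12_sqrt ?(ltW t0)// exprVn sqr_sqrtr// ltW//.
Qed.

(** With w = |x_j| / sqrt t, half of the exponent absorbs the linear factor because w / 2 <= 1 + w^2
    / 8 <= exp (w^2 / 8); the other half is the exponent at time 2 t. *)
Lemma DGam_le j t x : 0 < t ->
  `|DGam j t x| <= c2 * t `^ (- 2^-1) * Gam (2 * t) x.
Proof.
move=> t0; rewrite /DGam normrM (ger0_norm (Gam_ge0 _ _)) normrN.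
rewrite !GamE Gnorm2// -/c2.
set r := t `^ (- 2^-1).
have r0 : 0 < r by rewrite powR_gt0.
have r2 : r ^+ 2 = t^-1 by exact: powRVh.
have key : `|x ord0 j / (2 * t)| * expR (- (sqn x / (8 * t))) <= r.
  rewrite expRN -[leRHS]mulr1 -(@ler_pM2r _ (expR (sqn x / (8 * t)))) ?expR_gt0//.
  rewrite -mulrA mulVf ?gt_eqF ?expR_gt0// mulr1.
  set w := `|x ord0 j| * r.
  have -> : `|x ord0 j / (2 * t)| = w / 2 * r.
    have h2t : 0 <= (2 * t)^-1 by rewrite invr_ge0 mulr_ge0// ltW.
    by rewrite normrM (ger0_norm h2t) /w invfM -r2; field.
  rewrite mulr1 mulrC ler_wpM2l ?(ltW r0)//.
  apply: (le_trans _ (expR_ge1Dx _)).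
  have : w ^+ 2 / 8 <= sqn x / (8 * t).
    rewrite /w exprMn r2 real_normK ?num_real// invfM [8^-1 / t]mulrC mulrA.
    by rewrite ler_wpM2r// ler_wpM2r ?sqn_coord// invr_ge0 ltW.
  by move=> h; apply: (le_trans _ (lerD (lexx 1) h)); nra.
have -> : expR (- (sqn x / (4 * t))) =
    expR (- (sqn x / (8 * t))) * expR (- (sqn x / (4 * (2 * t)))).
  by rewrite -expRD; congr expR; field; rewrite gt_eqF.
rewrite [leLHS](_ : _ = c2 * (`|x ord0 j / (2 * t)| * expR (- (sqn x / (8 * t)))) *
  (Gnorm (2 * t) * expR (- (sqn x / (4 * (2 * t)))))); last by ring.
by rewrite ler_wpM2r ?mulr_ge0 ?Gnorm_ge0 ?expR_ge0// ler_wpM2l// c2_ge0.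
Qed.

Lemma pow_exp_bound k (y : R) : 0 <= y -> y ^+ k <= k`!%:R * expR y.
Proof.
move=> y0; case: k => [|k].
  by rewrite expr0 fact0 mul1r -[leLHS]expR0 ler_expR.
have := expR_ge1Dxn k y0.
have f0 : 0 < (k.+1)`!%:R :> R by rewrite ltr0n fact_gt0.
rewrite -(ler_pM2l f0); apply: le_trans.
by rewrite mulrDr mulr1 mulrCA divff ?gt_eqF// mulr1 lerDr ltW.
Qed.

(* Away from the diagonal the singularity at [t = 0] is absorbed by the
   exponential. *)
Lemma DGam_far : exists C : R, 0 <= C /\ forall j t T x, 0 < t -> t <= T ->
  T <= sqn x -> `|DGam j t x| <= C * T `^ (- 2^-1) * Gam (4 * T) x.
Proof.
(* With y = T / t >= 1 the singular powers amount to y^((n+1)/2) <= y^(n+1). Half of the exponent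
   |x|^2 / (8 t) is at least y / 16, as T <= |x|^2, and [pow_exp_bound] at y / 16 gives this
   constant; the other half yields the Gaussian at time 4 T. *)
pose K : R := (n.+1)`!%:R * 16 ^+ n.+1.
exists (c2 * 2 `^ (n%:R / 2) * K); split.
  by rewrite !mulr_ge0 ?powR_ge0 ?exprn_ge0.
move=> j t T x t0 tT Tx; have T0 : 0 < T by exact: lt_le_trans tT.
apply: (le_trans (DGam_le j x t0)).
rewrite !GamE.
pose y := T / t.
have y1 : 1 <= y by rewrite /y ler_pdivlMr// mul1r.
have y0 : 0 < y by exact: lt_le_trans y1.
have e1 : t `^ (- 2^-1) = y `^ 2^-1 * T `^ (- 2^-1).
  rewrite !powRN /y powRM ?invr_ge0 ?(ltW T0) ?(ltW t0)//.
  rewrite mulrC mulrA mulVf ?mul1r; last by rewrite gt_eqF// powR_gt0.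
  by rewrite -[t^-1]powR_inv1 ?(ltW t0)// -powRrM mulrC powRrM powR_inv1 ?powR_ge0.
have e2 : Gnorm (2 * t) = y `^ (n%:R / 2) * 2 `^ (n%:R / 2) * Gnorm (4 * T).
  have -> : 4 * T = 2 * y * (2 * t) by rewrite /y; field; rewrite gt_eqF.
  have y20 : 0 < 2 * y by rewrite mulr_gt0.
  have t20 : 0 < 2 * t by rewrite mulr_gt0.
  rewrite (GnormZ y20 t20) mulrA -powRM ?(ltW y0)//.
  rewrite [y * 2]mulrC -powRD ?subrr ?powRr0 ?mul1r//.
  by rewrite mulf_neq0 ?implybT// gt_eqF.
have e3 : expR (- (sqn x / (4 * (2 * t)))) <=
    expR (- (y / 16)) * expR (- (sqn x / (4 * (4 * T)))).
  rewrite -expRD ler_expR -opprD lerN2 /y.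
  have h1 : T / t / 16 <= sqn x / t / 16 by rewrite !ler_wpM2r// invr_ge0 ltW.
  have h2 : sqn x / T / 16 <= sqn x / t / 16.
    by rewrite ler_wpM2r// ler_wpM2l ?sqn_ge0// lef_pV2.
  have -> : sqn x / (4 * (4 * T)) = sqn x / T / 16 by field; rewrite gt_eqF.
  have -> : sqn x / (4 * (2 * t)) = sqn x / t / 16 + sqn x / t / 16.
    by field; rewrite gt_eqF.
  exact: lerD.
have e4 : y `^ 2^-1 * y `^ (n%:R / 2) * expR (- (y / 16)) <= K.
  rewrite -powRD; last by rewrite (gt_eqF y0) implybT.
  have -> : 2^-1 + n%:R / 2 = n.+1%:R / 2 :> R by rewrite -natr1; field.
  have h : y `^ (n.+1%:R / 2) <= y ^+ n.+1.
    rewrite -powR_mulrn ?(ltW y0)// ler_powR// ler_pdivrMr// ler_peMr//.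
    by rewrite ler1n.
  apply: (le_trans (ler_wpM2r (expR_ge0 _) h)).
  have y16 : 0 <= y / 16 by rewrite divr_ge0// ltW.
  have := pow_exp_bound n.+1 y16.
  rewrite exprMn exprVn ler_pdivrMr ?exprn_gt0// => h2.
  by rewrite expRN ler_pdivrMr ?expR_gt0// (le_trans h2)// /K mulrAC.
rewrite e1 e2.
rewrite [leLHS](_ : _ = y `^ 2^-1 * y `^ (n%:R / 2) * expR (- (sqn x / (4 * (2 * t))))
  * (c2 * 2 `^ (n%:R / 2) * T `^ (- 2^-1) * Gnorm (4 * T))); last by ring.
rewrite [leRHS](_ : _ = K * expR (- (sqn x / (4 * (4 * T)))) *
  (c2 * 2 `^ (n%:R / 2) * T `^ (- 2^-1) * Gnorm (4 * T))); last by ring.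
rewrite ler_wpM2r ?mulr_ge0 ?powR_ge0 ?Gnorm_ge0//.
have h0 : 0 <= y `^ 2^-1 * y `^ (n%:R / 2) by rewrite mulr_ge0 ?powR_ge0.
apply: (le_trans (ler_wpM2l h0 e3)); rewrite [leLHS]mulrA.
by rewrite ler_wpM2r ?expR_ge0.
Qed.

(** From |x - z|^2 <= 2 |x - y|^2 + 2 t: doubling the time compensates the factor 2, and the
    remaining 2 t contributes 2 t / (8 k t) = 1 / (4 k) to the exponent. *)
Lemma Gam_shift k t x y z : 0 < k -> 0 < t -> sqn (z - y) < t ->
  Gam (k * t) (x - y) <= c2 * expR ((4 * k)^-1) * Gam (2 * (k * t)) (x - z).
Proof.
move=> k0 t0 zy; have kt0 : 0 < k * t by rewrite mulr_gt0.
rewrite !GamE Gnorm2// -/c2 -!mulrA ler_wpM2l ?c2_ge0//.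
rewrite [leRHS]mulrCA ler_wpM2l ?Gnorm_ge0// -expRD ler_expR.
have h : sqn (x - z) <= 2 * sqn (x - y) + 2 * t.
  rewrite (_ : x - z = (x - y) + (y - z)); last by rewrite addrA subrK.
  apply: (le_trans (sqnD _ _)); rewrite lerD2l ler_wpM2l//.
  by rewrite sqnB ltW.
have := ler_wpM2r (_ : 0 <= (8 * (k * t))^-1) h; rewrite invr_ge0 mulr_ge0// ?(ltW kt0)//.
move=> /(_ isT).
rewrite (_ : (2 * sqn (x - y) + 2 * t) / (8 * (k * t)) =
   sqn (x - y) / (4 * (k * t)) + (4 * k)^-1); last first.
  by field; rewrite !gt_eqF.
rewrite (_ : sqn (x - z) / (8 * (k * t)) = sqn (x - z) / (4 * (2 * (k * t)))); last first.
  by field; rewrite !gt_eqF.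
lra.
Qed.

(* Chapman-Kolmogorov for the gradients: the trace of the mixed second
   derivatives is a time derivative. *)
Lemma integral_DGam (a b : R) y y' j : 0 < a -> 0 < b ->
  lebn.-integrable setT (fun x => (DGam j a (x - y) * DGam j b (x - y'))%:E) /\
  (\int[lebn]_x (DGam j a (x - y) * DGam j b (x - y'))%:E =
   (((2 * (a + b))^-1 - (y - y') ord0 j ^+ 2 / (4 * (a + b) ^+ 2)) *
      Gam (a + b) (y - y'))%:E)%E.
Proof.
move=> a0 b0; have ab0 : 0 < a + b by rewrite addr_gt0.
have I0 (u v : R) m k : leb.-integrable setT
    (EFin \o (fun z : R => dgam m a (u - z) * dgam k b (z - v))).
  have [M [M0 HM]] := dgam_bounded k 0 b0.
  have mg : measurable_fun setT (fun z : R => dgam k b (z - v)).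
    by apply: measf_dgam; meas.
  apply: (integrable_dgamM m u a0 mg (N := M)).
  by move=> z; have := HM (z - v); rewrite expr0 mul1r.
have E (u v : R) m k : (\int[leb]_z (dgam m a (z - u) * dgam k b (z - v))%:E =
   ((-1) ^+ m * dgam (m + k) (a + b) (u - v))%:E)%E.
  under eq_integral do rewrite -opprB dgamN -mulrA EFinM.
  by rewrite integralZl//; [rewrite dgam_conv// EFinM|exact: I0].
have I (u v : R) m k : leb.-integrable setT
    (EFin \o (fun z : R => dgam m a (z - u) * dgam k b (z - v))).
  rewrite (_ : EFin \o _ = fun z : R => (((-1) ^+ m)%:E *
    (dgam m a (u - z) * dgam k b (z - v))%:E)%E); last first.
    by apply/funext => z /=; rewrite -opprB dgamN -mulrA EFinM.
  by apply: integrableZl => //; exact: I0.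
have [i1 i2] := @integral_prod_rV R n
  (fun i (z : R) => dgam (i == j) a (z - y ord0 i) * dgam (i == j) b (z - y' ord0 i))
  (fun i => (-1) ^+ (i == j) * dgam ((i == j) + (i == j)) (a + b) (y ord0 i - y' ord0 i))
  (fun i => I _ _ _ _) (fun i => E _ _ _ _).
have pE : (fun x => (DGam j a (x - y) * DGam j b (x - y'))%:E) =
  (fun x => (\prod_i (dgam (i == j) a (x ord0 i - y ord0 i) *
       dgam (i == j) b (x ord0 i - y' ord0 i)))%:E).
  apply/funext => x; rewrite !DGam_prod -big_split/=; congr _%:E.
  by apply: eq_bigr => i _; rewrite !mxE.
rewrite pE; split => //; rewrite i2; congr _%:E.
rewrite /Gam (bigD1 j)//= [in RHS](bigD1 j)//= eqxx [RHS]mulrA; congr (_ * _).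
  by rewrite -[(true + true)%N]/2%N dgam2 ?gt_eqF// expr1 !mxE; ring.
by apply: eq_bigr => i /negPf ->; rewrite expr0 mul1r dgam0 !mxE.
Qed.

Lemma integral_sum_DGam (a b : R) y y' : 0 < a -> 0 < b ->
  (\int[lebn]_x (\sum_j DGam j a (x - y) * DGam j b (x - y'))%:E =
   ((n%:R / (2 * (a + b)) - sqn (y - y') / (4 * (a + b) ^+ 2)) *
      Gam (a + b) (y - y'))%:E)%E.
Proof.
move=> a0 b0; under eq_integral do rewrite -sumEFin.
rewrite integral_sum//=; last by move=> j; have [] := integral_DGam y y' j a0 b0.
under eq_bigr do rewrite (integral_DGam y y' _ a0 b0).2.
rewrite sumEFin -mulr_suml; congr (_ * _)%:E.
rewrite big_split/= sumr_const card_ord sumrN -mulr_suml -/(sqn _).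
by rewrite -[_^-1 *+ n]mulr_natl.
Qed.

(** The kernel as a single exponential, for positive t: in this form its time derivative needs only
    those of [ln] and of the inverse. *)
Let Gexp x t : R := expR (- (n%:R / 2) * ln (4 * pi * t) - sqn x / 4 * t^-1).

Let Gam_exp t x : 0 < t -> Gam t x = Gexp x t.
Proof.
move=> t0; rewrite GamE /Gexp /Gnorm /powR.
have p1 : 0 < 4 * pi * t by rewrite !mulr_gt0// pi_gt0.
rewrite (gt_eqF p1) -expRD; congr expR.
by rewrite -mulNr invfM; ring.
Qed.

Let isd_Gexp x t : 0 < t -> is_derive t 1 (Gexp x)
   (- ((n%:R / (2 * t) - sqn x / (4 * t ^+ 2)) * Gexp x t)).
Proof.
move=> t0.
have p0 : 0 < pi :> R by exact: pi_gt0.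
have h1 : is_derive t 1 (fun t : R => 4 * pi * t) (4 * pi).
  by apply: (isd_eq (isdM (isd_cst t (4 * pi)) (isd_id t))); ring.
have h2 : is_derive t 1 (fun t : R => ln (4 * pi * t)) t^-1.
  have p1 : 0 < 4 * pi * t by rewrite !mulr_gt0.
  apply: (isd_eq (isd_comp (g := fun t => 4 * pi * t) (is_derive1_ln p1) h1)).
  by rewrite invfM mulrAC mulVf ?mul1r// mulf_neq0// gt_eqF.
have h3 : is_derive t 1 (fun t : R => t^-1) (- t ^- 2).
  have := @is_deriveV R id t 1 1 (lt0r_neq0 t0) (isd_id t).
  by move/isd_eq; apply; rewrite /= /GRing.scale/= mulr1.
apply: (isd_eq (isd_expR (isdB (isdM (isd_cst t (- (n%:R / 2))) h2)
  (isdM (isd_cst t (sqn x / 4)) h3)))).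
by rewrite /Gexp; field; rewrite gt_eqF.
Qed.

(** Two sources at times s and s' give a + b = 2 t - c with c = s + s'. The integrand is then minus
    the time derivative of the kernel at 2 t - c, and the factor 1/2 comes from the chain rule. *)
Lemma integral_dGam x (m T c : R) : m < T -> 0 < 2 * m - c ->
  (\int[leb]_(t in `]m, T[)
     ((n%:R / (2 * (2 * t - c)) - sqn x / (4 * (2 * t - c) ^+ 2)) *
       Gam (2 * t - c) x)%:E =
   (2^-1 * (Gam (2 * m - c) x - Gam (2 * T - c) x))%:E)%E.
Proof.
move=> mT mc.
pose f t := (n%:R / (2 * (2 * t - c)) - sqn x / (4 * (2 * t - c) ^+ 2)) *
       Gexp x (2 * t - c).
pose F (t : R) : R := - 2^-1 * Gexp x (2 * t - c).
have pos t : m <= t -> 0 < 2 * t - c by move=> mt; lra.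
have dF t : m <= t -> is_derive t 1 F (f t).
  move=> mt.
  have h1 : is_derive t 1 (fun t : R => 2 * t - c) 2.
    by apply: (isd_eq (isdB (isdM (isd_cst t 2) (isd_id t)) (isd_cst t c))); ring.
  apply: (isd_eq (isdM (isd_cst t (- 2^-1)) (isd_comp (g := fun t => 2 * t - c) (isd_Gexp x (pos _ mt)) h1))).
  by rewrite /f; field; rewrite gt_eqF ?pos.
have cf t : m <= t -> {for t, continuous f}.
  move=> mt.
  have h1 : is_derive t 1 (fun t : R => 2 * t - c) 2.
    by apply: (isd_eq (isdB (isdM (isd_cst t 2) (isd_id t)) (isd_cst t c))); ring.
  have h2 : is_derive t 1 (fun t : R => (2 * t - c)^-1) (- (2 * t - c) ^- 2 * 2).
    exact: (@is_deriveV R _ t _ 1 (lt0r_neq0 (pos _ mt)) h1).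
  have -> : f = fun t => (n%:R / 2 * (2 * t - c)^-1 - sqn x / 4 * (2 * t - c)^-1 ^+ 2) *
       Gexp x (2 * t - c).
    by apply/funext => u; rewrite /f (invfM 2) (invfM 4) -exprVn; move: (_^-1) (Gexp _ _) => V G; ring.
  exact: (isd_continuous (isdM (isdB (isdM (isd_cst t _) h2) (isdM (isd_cst t _)
    (isdX 2 h2))) (isd_comp (g := fun t => 2 * t - c) (isd_Gexp x (pos _ mt)) h1))).
transitivity (\int[leb]_(t in `[m, T]) (f t)%:E)%E.
  rewrite -(@integral_itv_bndoo R m T _ true false) ?measurable_itv//.
  - apply: eq_integral => t; rewrite inE/= in_itv/= => /andP[mt _].
    by rewrite /f Gam_exp ?pos// ltW.
  - apply: measfE; apply: (measurable_funS (E := setT)) => //.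
    under eq_fun do rewrite mulrC; apply: measfM; last by meas.
    by apply: measf_Gam; meas.
rewrite (@continuous_FTC2 R f F)//.
- rewrite -EFinB /F !Gam_exp ?pos ?(ltW mT)//; congr _%:E; ring.
- apply: continuous_in_subspaceT => t; rewrite inE/= in_itv/= => /andP[mt _].
  exact: cf.
- split.
  + by move=> t; rewrite in_itv/= => /andP[/ltW mt _]; have [] := dF _ mt.
  + apply: cvg_at_right_filter; exact: isd_continuous (dF _ (lexx m)).
  + apply: cvg_at_left_filter; exact: isd_continuous (dF _ (ltW mT)).
- move=> t; rewrite in_itv/= => /andP[/ltW mt _].
  by rewrite derive1E; exact: (@derive_val _ _ _ _ _ _ _ (dF _ mt)).
Qed.

End heat_kernel.

Ltac meas_ext ::= first
  [ apply: measf_gam | apply: measf_sqn | apply: measf_DGam | apply: measf_Gam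
  | apply: measf_rVB ].

(** * Carleson cylinders *)

Section real_integrals.
Context {R : realType}.
Local Notation leb := (@lebesgue_measure R).

Lemma integral_if d (T : measurableType d) (m : {measure set T -> \bar R})
    (D : set T) (p : T -> bool) (f : T -> R) :
  (forall z, D z <-> p z) ->
  (\int[m]_(z in D) (f z)%:E = \int[m]_z (if p z then f z else 0)%:E)%E.
Proof.
move=> Dp; rewrite integral_mkcond; apply: eq_integral => z _.
rewrite patchE; case: ifPn; rewrite ?(inE, notin_setE) => h.
  by have /Dp -> := h.
by case: ifPn => // /Dp.
Qed.

Lemma ge0_le_integralT d (T : measurableType d) (m : {measure set T -> \bar R})
    (f g : T -> R) :
  measurable_fun setT f -> measurable_fun setT g -> (forall z, 0 <= f z) ->
  (forall z, f z <= g z) ->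
  (\int[m]_z (f z)%:E <= \int[m]_z (g z)%:E)%E.
Proof.
move=> mf mg f0 fg; apply: ge0_le_integral => //.
- by move=> z _; rewrite lee_fin.
- exact: measfE.
- exact: measfE.
- by move=> z _; rewrite lee_fin.
Qed.

Lemma ge0_integralZlT d (T : measurableType d) (m : {measure set T -> \bar R})
    (c : R) (f : T -> R) :
  measurable_fun setT f -> (forall z, 0 <= f z) -> 0 <= c ->
  (\int[m]_z (c * f z)%:E = c%:E * \int[m]_z (f z)%:E)%E.
Proof.
move=> mf f0 c0; under eq_integral do rewrite EFinM.
rewrite ge0_integralZl//; first exact: measfE.
by move=> z _; rewrite lee_fin.
Qed.

Lemma ge0_integralDT d (T : measurableType d) (m : {measure set T -> \bar R})
    (f g : T -> R) :
  measurable_fun setT f -> measurable_fun setT g -> (forall z, 0 <= f z) ->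
  (forall z, 0 <= g z) ->
  (\int[m]_z (f z + g z)%:E = \int[m]_z (f z)%:E + \int[m]_z (g z)%:E)%E.
Proof.
move=> mf mg f0 g0; under eq_integral do rewrite EFinD.
rewrite ge0_integralD//.
- by move=> z _; rewrite lee_fin.
- exact: measfE.
- by move=> z _; rewrite lee_fin.
- exact: measfE.
Qed.

Lemma aeS d (T : measurableType d) (m : {measure set T -> \bar R}) (P Q : T -> Prop) :
  (forall z, P z -> Q z) -> {ae m, forall z, P z} -> {ae m, forall z, Q z}.
Proof. by move=> PQ; apply: filterS. Qed.

Lemma aeS2 d (T : measurableType d) (m : {measure set T -> \bar R})
    (P Q S : T -> Prop) : (forall z, P z -> Q z -> S z) ->
  {ae m, forall z, P z} -> {ae m, forall z, Q z} -> {ae m, forall z, S z}.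
Proof. by move=> PQ; apply: filterS2. Qed.

Lemma aeW d (T : measurableType d) (m : {measure set T -> \bar R})
    (P : T -> Prop) : (forall z, P z) -> {ae m, forall z, P z}.
Proof. by move=> h; apply: nearW. Qed.

Lemma powRh_sqrt (t : R) : 0 <= t -> t `^ (- 2^-1) = (Num.sqrt t)^-1.
Proof. by move=> t0; rewrite powRN powR12_sqrt. Qed.

Lemma ge0_fubini d1 d2 (T1 : measurableType d1) (T2 : measurableType d2)
    (m1 : {sigma_finite_measure set T1 -> \bar R})
    (m2 : {sigma_finite_measure set T2 -> \bar R}) (f : T1 * T2 -> R) :
  measurable_fun setT f -> (forall z, 0 <= f z) ->
  (\int[m1]_x \int[m2]_y (f (x, y))%:E = \int[m2]_y \int[m1]_x (f (x, y))%:E)%E.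
Proof.
move=> mf f0; apply: (fubini_tonelli (EFin \o f)); first exact: measfE.
by move=> z; rewrite /= lee_fin.
Qed.

Lemma ge0_fubini1 d1 d2 (T1 : measurableType d1) (T2 : measurableType d2)
    (m1 : {sigma_finite_measure set T1 -> \bar R})
    (m2 : {sigma_finite_measure set T2 -> \bar R}) (f : T1 * T2 -> R) :
  measurable_fun setT f -> (forall z, 0 <= f z) ->
  (\int[m1 \x m2]_z (f z)%:E = \int[m1]_x \int[m2]_y (f (x, y))%:E)%E.
Proof.
move=> mf f0; apply: (fubini_tonelli1 (EFin \o f)); first exact: measfE.
by move=> z; rewrite /= lee_fin.
Qed.

Lemma ge0_fubini2 d1 d2 (T1 : measurableType d1) (T2 : measurableType d2)
    (m1 : {sigma_finite_measure set T1 -> \bar R})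
    (m2 : {sigma_finite_measure set T2 -> \bar R}) (f : T1 * T2 -> R) :
  measurable_fun setT f -> (forall z, 0 <= f z) ->
  (\int[m1 \x m2]_z (f z)%:E = \int[m2]_y \int[m1]_x (f (x, y))%:E)%E.
Proof.
move=> mf f0; apply: (fubini_tonelli2 (EFin \o f)); first exact: measfE.
by move=> z; rewrite /= lee_fin.
Qed.

Lemma measf_int1 d1 d2 (T1 : measurableType d1) (T2 : measurableType d2)
    (m2 : {sigma_finite_measure set T2 -> \bar R}) (f : T1 * T2 -> R) :
  measurable_fun setT f -> (forall z, 0 <= f z) ->
  measurable_fun setT (fun x => \int[m2]_y (f (x, y))%:E)%E.
Proof.
move=> mf f0; apply: (measurable_fun_fubini_tonelli_F (EFin \o f)).
  exact: measfE.
by move=> z; rewrite /= lee_fin.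
Qed.

Lemma measf_int2 d1 d2 (T1 : measurableType d1) (T2 : measurableType d2)
    (m1 : {sigma_finite_measure set T1 -> \bar R}) (f : T1 * T2 -> R) :
  measurable_fun setT f -> (forall z, 0 <= f z) ->
  measurable_fun setT (fun y => \int[m1]_x (f (x, y))%:E)%E.
Proof.
move=> mf f0; apply: (measurable_fun_fubini_tonelli_G (EFin \o f)).
  exact: measfE.
by move=> z; rewrite /= lee_fin.
Qed.

Lemma measf_sqrt d (T : measurableType d) (f : T -> R) :
  measurable_fun setT f -> measurable_fun setT (fun z => Num.sqrt (f z)).
Proof.
move=> mf; apply: (measurableT_comp _ mf).
by apply: continuous_measurable_fun => x; exact: sqrt_continuous.
Qed.

Lemma fatou_le d (T : measurableType d) (m : {measure set T -> \bar R})
    (fk : nat -> T -> R) (f : T -> R) (M : \bar R) :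
  (forall k, measurable_fun setT (fk k)) -> (forall k z, 0 <= fk k z) ->
  (forall z, (fun k => fk k z) @ \oo --> f z) ->
  (forall k, \int[m]_z (fk k z)%:E <= M)%E -> (\int[m]_z (f z)%:E <= M)%E.
Proof.
move=> mfk fk0 fkf fkM.
have -> : (fun z => (f z)%:E) = (fun z => limn_einf (fun k => (fk k z)%:E)).
  apply/funext => z; apply/esym.
  have h : (fun k => (fk k z)%:E) @ \oo --> (f z)%:E by apply: cvg_EFin; [exact: nearW|exact: fkf].
  by have [] := cvg_limn_einf_sup h.
apply: (le_trans (@fatou _ _ _ m setT measurableT (fun k z => (fk k z)%:E)
   (fun k => measfE (mfk k)) _)).
  by move=> k z _; rewrite lee_fin.
rewrite limn_einf_lim; apply: lime_le; first exact: is_cvg_einfs.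
apply: nearW => k; apply: (le_trans _ (fkM k)).
by apply: ereal_inf_lbound; exists k => /=.
Qed.

(** The integrand blows up at t, so the fundamental theorem is used up to t - (t - c) / (k + 2) and
    Fatou passes to the limit; with k + 2 instead of k + 1 the truncated interval is nonempty
    already for k = 0. *)
Lemma integral_invsqrt_itv (c t : R) : c < t ->
  (\int[leb]_s (if ((c < s) && (s < t))%R then (Num.sqrt (t - s))^-1 else 0)%:E
    <= (2 * Num.sqrt (t - c))%:E)%E.
Proof.
move=> ct; have t0 : 0 < t - c by rewrite subr_gt0.
pose f (s : R) : R := if (c < s) && (s < t) then (Num.sqrt (t - s))^-1 else 0.
pose fk (k : nat) (s : R) : R :=
  if (c < s) && (s < t - (t - c) / k.+2%:R) then (Num.sqrt (t - s))^-1 else 0.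
have ms : measurable_fun setT (fun s : R => (Num.sqrt (t - s))^-1).
  by apply: measfV; apply: measf_sqrt; meas.
have mf k : measurable_fun setT (fk k) by rewrite /fk; meas.
have kt (k : nat) : 0 < (t - c) / k.+2%:R by rewrite divr_gt0.
have cv s : (fun k => fk k s) @ \oo --> f s.
  apply: cvg_near_cst.
  rewrite /f /fk; case: (ltP c s) => s0 /=; last exact: nearW.
  case: (ltP s t) => st /=; last first.
    apply: nearW => k; rewrite ifF//; apply/negbTE; rewrite -leNgt.
    by rewrite (le_trans _ st)// lerBlDr lerDl ltW.
  have ts0 : 0 < (t - s) / (t - c) by rewrite divr_gt0// subr_gt0.
  have [K _ HK] := near_infty_natSinv_lt (PosNum ts0).
  exists K => // k /= Kk; have {}HK := HK k Kk; rewrite ifT//.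
  rewrite ltrBrDr -ltrBrDl.
  have : k.+2%:R^-1 < (t - s) / (t - c).
    by apply: le_lt_trans HK; rewrite lef_pV2 ?posrE// ler_nat.
  by rewrite ltr_pdivlMr// mulrC.
apply: (@fatou_le _ _ leb fk f _ mf _ cv).
  by move=> k s; rewrite /fk; case: ifP => // _; rewrite invr_ge0 sqrtr_ge0.
move=> k.
set e := t - (t - c) / k.+2%:R.
have e0 : c < e.
  by rewrite /e ltrBrDl -ltrBrDr ltr_pdivrMr// ltr_pMr// ltr1n.
have et : e < t by rewrite /e ltrBlDr ltrDl.
pose F (s : R) : R := - (2 * Num.sqrt (t - s)).
have ds (s : R) : s <= e -> is_derive s 1 (fun s => Num.sqrt (t - s)) (- (2 * Num.sqrt (t - s))^-1).
  move=> se; have ts0 : 0 < t - s by rewrite subr_gt0 (le_lt_trans se).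
  apply: (isd_eq (isd_comp (g := fun s => t - s)
       (is_derive1_sqrt ts0) (isdB (isd_cst s t) (isd_id s)))).
  by rewrite sub0r mulrN1.
have sp (s : R) : s <= e -> Num.sqrt (t - s) != 0.
  by move=> se; rewrite gt_eqF// sqrtr_gt0 subr_gt0 (le_lt_trans se).
have dF (s : R) : s <= e -> is_derive s 1 F (Num.sqrt (t - s))^-1.
  move=> se; apply: (isd_eq (isdN (isdM (isd_cst s 2) (ds s se)))).
  by field; rewrite sp.
have cf (s : R) : s <= e -> {for s, continuous (fun s => (Num.sqrt (t - s))^-1)}.
  by move=> se; exact: (isd_continuous (@is_deriveV R _ s _ 1 (sp s se) (ds s se))).
rewrite -(@integral_if _ _ leb `]c, e[%classic); last by move=> s; rewrite /= in_itv.
rewrite -(@integral_itv_bndoo R c e _ true false); last first.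
  by apply: measfE; exact: measurable_funTS.
rewrite (@continuous_FTC2 R _ F)//.
- rewrite -EFinB lee_fin /F opprK addrC lerBlDr lerDl.
  by rewrite mulr_ge0// sqrtr_ge0.
- apply: continuous_in_subspaceT => s; rewrite inE/= in_itv/= => /andP[_ se].
  exact: cf.
- split.
  + by move=> s; rewrite in_itv/= => /andP[_ /ltW se]; have [] := dF _ se.
  + apply: cvg_at_right_filter; exact: isd_continuous (dF _ (ltW e0)).
  + apply: cvg_at_left_filter; exact: isd_continuous (dF _ (lexx _)).
- move=> s; rewrite in_itv/= => /andP[_ /ltW se].
  by rewrite derive1E; exact: (@derive_val _ _ _ _ _ _ _ (dF _ se)).
Qed.

Lemma integral_invsqrt (t : R) : 0 < t ->
  (\int[leb]_s (if ((0 < s) && (s < t))%R then (Num.sqrt (t - s))^-1 else 0)%:E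
    <= (2 * Num.sqrt t)%:E)%E.
Proof. by move=> /integral_invsqrt_itv; rewrite subr0. Qed.

Lemma integral_invsqrt' (s t : R) : s < t ->
  (\int[leb]_r (if ((s < r) && (r < t))%R then (Num.sqrt (r - s))^-1 else 0)%:E
    <= (2 * Num.sqrt (t - s))%:E)%E.
Proof.
move=> st; rewrite -ge0_integral_oppr; last 2 first.
- by apply: measfE; apply: measf_if; [|meas|apply: measfV; apply: measf_sqrt; meas|meas].
- by move=> r; rewrite lee_fin; case: ifP => // _; rewrite invr_ge0 sqrtr_ge0.
rewrite (_ : t - s = - s - - t); last by rewrite opprK addrC.
apply: le_trans (integral_invsqrt_itv _); last by rewrite ltrN2.
rewrite le_eqVlt; apply/orP; left; apply/eqP; apply: eq_integral => r _.
by rewrite ltrNr ltrNl andbC addrC.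
Qed.

End real_integrals.

(** * Sigma-finite products and Fubini on them *)

Section product_measure.
Context {R : realType} d1 d2 (X : measurableType d1) (Z : measurableType d2).
Variables (mX : {sigma_finite_measure set X -> \bar R})
  (mZ : {sigma_finite_measure set Z -> \bar R}).

(** Through [pm_set] the product receives a sigma-finite structure and can itself be a factor: the
    energy estimate integrates over pairs of space-time points. *)
Definition pm0 : {measure set (X * Z)%type -> \bar R} :=
  lebesgue_integral_fubini_product_measure1__canonical__measure_function_Measure mX mZ.

Lemma pm_sigma_finite : sigma_finite setT pm0.
Proof.
have /sigma_finiteP[F [TF ndF Foo]] := sigma_finiteT mX.
have /sigma_finiteP[G [TG ndG Goo]] := sigma_finiteT mZ.
exists (fun k => F k `*` G k).
  apply/esym; rewrite -subTset => -[x s] _.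
  have [[i _ Fi] [j _ Gj]] : (\bigcup_k F k) x /\ (\bigcup_k G k) s by rewrite -TF -TG.
  exists (maxn i j) => //; split.
  - by move: Fi; exact/subsetPset/ndF/leq_maxl.
  - by move: Gj; exact/subsetPset/ndG/leq_maxr.
move=> k; have [mF Fk] := Foo k; have [mG Gk] := Goo k; split.
  exact: measurableX.
rewrite [pm0 _]product_measure1E// lte_mul_pinfty// ge0_fin_numE.
  exact: Fk.
exact: measure_ge0.
Qed.

Definition pm_set : set (X * Z) -> \bar R := pm0.
HB.instance Definition _ := Measure.on pm_set.
HB.instance Definition _ :=
  Measure_isSigmaFinite.Build _ (X * Z)%type R pm_set pm_sigma_finite.

Definition pm : {sigma_finite_measure set (X * Z)%type -> \bar R} := pm_set.

Lemma pm_fubini1 (f : X * Z -> R) :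
  measurable_fun setT f -> (forall z, 0 <= f z) ->
  (\int[pm]_z (f z)%:E = \int[mX]_x \int[mZ]_s (f (x, s))%:E)%E.
Proof. exact: ge0_fubini1. Qed.

Lemma pm_fubini2 (f : X * Z -> R) :
  measurable_fun setT f -> (forall z, 0 <= f z) ->
  (\int[pm]_z (f z)%:E = \int[mZ]_s \int[mX]_x (f (x, s))%:E)%E.
Proof. exact: ge0_fubini2. Qed.

Lemma pm_normP (f : X * Z -> R) :
  measurable_fun setT f ->(\int[pm]_z `|f z|%:E < +oo)%E ->
  pm.-integrable setT (fun z => (f z)%:E).
Proof. move=> mf foo; apply/integrableP; split => //; exact: measfE. Qed.

Lemma pm_int12  (f : X * Z -> R) : 
  pm.-integrable setT (fun z => (f z)%:E) ->
  (\int[mX]_x \int[mZ]_s (f (x, s))%:E = \int[pm]_z (f z)%:E)%E.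
Proof. exact: integral12_prod_meas1. Qed.

Lemma pm_int21  (f : X * Z -> R) : 
  pm.-integrable setT (fun z => (f z)%:E) ->
  (\int[mZ]_s \int[mX]_x (f (x, s))%:E = \int[pm]_z (f z)%:E)%E.
Proof. exact: integral21_prod_meas1. Qed.
Lemma pm_aeint2  (f : X * Z -> R) : 
  pm.-integrable setT (fun z => (f z)%:E) ->
  {ae mZ, forall s, mX.-integrable setT (fun x => (f (x, s))%:E)}.
Proof. exact: ae_integrable2. Qed.
Lemma pm_integralM (f : X -> R) (g : Z -> R) :
  measurable_fun setT f -> measurable_fun setT g ->
  (forall x, 0 <= f x) -> (forall z, 0 <= g z) ->
  (\int[pm]_p (f p.1 * g p.2)%:E = \int[mX]_x (f x)%:E * \int[mZ]_z (g z)%:E)%E.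
Proof.
move=> mf mg f0 g0; rewrite (@pm_fubini1 (fun p => f p.1 * g p.2)); last 2 first.
- by meas.
- by move=> p; rewrite mulr_ge0.
transitivity (\int[mX]_x ((f x)%:E * \int[mZ]_z (g z)%:E))%E.
  by apply: eq_integral => x _; rewrite /= ge0_integralZlT.
rewrite ge0_integralZr//.
- exact: measfE.
- by move=> x _; rewrite lee_fin.
- by apply: integral_ge0 => z _; rewrite lee_fin.
Qed.

End product_measure.

Section space_time_measure.
Context {R : realType} (n : nat).

Definition stm : {sigma_finite_measure set ('rV[R]_n * measurableTypeR R)%type -> \bar R} :=
  pm (@lebesgue_rV R n) (@lebesgue_measure R).

Lemma stm_fubini1 (f : 'rV[R]_n * R -> R) :
  measurable_fun setT f -> (forall z, 0 <= f z) ->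
  (\int[stm]_z (f z)%:E =
   \int[@lebesgue_rV R n]_x \int[@lebesgue_measure R]_s (f (x, s))%:E)%E.
Proof. by move=> mf f0; exact: (pm_fubini1 (lebesgue_rV n) lebesgue_measure mf f0). Qed.

Lemma stm_fubini2 (f : 'rV[R]_n * R -> R) :
  measurable_fun setT f -> (forall z, 0 <= f z) ->
  (\int[stm]_z (f z)%:E =
   \int[@lebesgue_measure R]_s \int[@lebesgue_rV R n]_x (f (x, s))%:E)%E.
Proof. by move=> mf f0; exact: (pm_fubini2 (lebesgue_rV n) lebesgue_measure mf f0). Qed.

End space_time_measure.
Arguments stm {R} n.

(** * The Carleson condition and Gaussian averages *)

Section tent.
Context {R : realType} {n : nat}.
Local Notation Rn := 'rV[R]_n.+1.
Local Notation leb := (@lebesgue_measure R).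
Local Notation lebn := (@lebesgue_rV R n.+1).
Local Notation mu := (@stm R n.+1).
Implicit Types (x y : Rn) (z : Rn * R) (s t a b : R) (w : Rn * R -> R).

Definition cyl x t z : bool := (0 < z.2) && (z.2 < t) && (sqn (z.1 - x) < t).

Definition slab t z : bool := (0 < z.2) && (z.2 < t).

(** Up to a constant, the volume of a ball of radius sqrt t, by which Carleson bounds are
    normalised. *)
Definition tpow t : R := t `^ (n.+1%:R / 2).

(** For w = u^2 and b = e^2 this bounds the tent norm of u by e, and [supb] with a = e^2 bounds sqrt
    t |u| by e. Both are stated for a density w because the nonlinear sources are quadratic in u. *)
Definition tent w b := forall x t, 0 < t ->
  (\int[mu]_z (if cyl x t z then w z else 0)%:E <= (b * tpow t)%:E)%E.

Definition supb w a := {ae mu, forall z, 0 < z.2 -> z.2 * w z <= a}.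

Lemma tpow_gt0 t : 0 < t -> 0 < tpow t.
Proof. exact: powR_gt0. Qed.

Lemma tpow_sqrt t : 0 <= t -> tpow t = Num.sqrt t ^+ n.+1.
Proof.
by move=> t0; rewrite /tpow mulrC powRrM powR12_sqrt// powR_mulrn// sqrtr_ge0.
Qed.

Lemma measf_slab d (S : measurableType d) (f : S -> R) (g : S -> Rn * R) :
  measurable_fun setT f -> measurable_fun setT g ->
  measurable_fun setT (fun v => slab (f v) (g v)).
Proof. by move=> mf mg; rewrite /slab; meas. Qed.

Lemma measf_cyl d (S : measurableType d) (h : S -> Rn) (f : S -> R)
    (g : S -> Rn * R) : measurable_fun setT h ->
  measurable_fun setT f -> measurable_fun setT g ->
  measurable_fun setT (fun v => cyl (h v) (f v) (g v)).
Proof.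
move=> mh mf mg; rewrite /cyl; meas.
Qed.

Lemma integral_oo_itv (a b : R) : a < b ->
  (\int[leb]_z (if ((a < z) && (z < b))%R then 1 else 0)%:E = (b - a)%:E)%E.
Proof.
move=> ab; rewrite -(@integral_if _ _ _ leb `]a, b[%classic _ (fun=> 1)).
  by rewrite integral_cst//= lebesgue_measure_itv/= lte_fin ab mul1e EFinB.
by move=> z; rewrite /= in_itv.
Qed.

(** Comparison with two cubes, since only the order of magnitude matters: the ball contains the cube
    of half-side sqrt t / (n+1), whose points satisfy |z - y|^2 < t / (n+1), and lies in the cube of
    half-side sqrt t. *)
Lemma ball_vol y t : 0 < t ->
  ((((2 / n.+1%:R) ^+ n.+1 * tpow t)%:E <=
     \int[lebn]_z (if (sqn (z - y) < t)%R then 1 else 0)%:E) /\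
  (\int[lebn]_z (if (sqn (z - y) < t)%R then 1 else 0)%:E
     <= (2 ^+ n.+1 * tpow t)%:E))%E.
Proof.
move=> t0; have st0 : 0 < Num.sqrt t by rewrite sqrtr_gt0.
pose q (r : R) (z : Rn) : R := \prod_i
  (if (y ord0 i - r < z ord0 i) && (z ord0 i < y ord0 i + r) then 1 else 0).
have mq r : measurable_fun setT (q r).
  by rewrite /q; apply: measf_prod => i; meas.
have mb : measurable_fun setT (fun z : Rn => if sqn (z - y) < t then 1 else 0 : R).
  by meas.
have q01 r (z : Rn) : 0 <= q r z <= 1.
  apply/andP; split; first by apply: prodr_ge0 => i _; case: ifP.
  by apply: prodr_ile1 => i _; case: ifP => //; rewrite ler01 lexx.
have Iq r : 0 < r -> (\int[lebn]_z (q r z)%:E = ((2 * r) ^+ n.+1)%:E)%E.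
  move=> r0; rewrite (@ge0_integral_prod_rV R n.+1
     (fun i a => if (y ord0 i - r < a) && (a < y ord0 i + r) then 1 else 0)
     (fun=> 2 * r)).
  - by rewrite prodr_const card_ord.
  - by move=> i; meas.
  - by move=> i a; case: ifP.
  - move=> i; rewrite integral_oo_itv; first by congr _%:E; ring.
    by rewrite ltrD2l gtrN.
have dist (r a c : R) : (a - r < c) && (c < a + r) = (`|c - a| < r).
  by rewrite ltr_norml; apply/idP/idP => /andP[h1 h2]; apply/andP; split; lra.
split.
- pose r := Num.sqrt t / n.+1%:R.
  have r0 : 0 < r by rewrite divr_gt0.
  apply: (@le_trans _ _ (\int[lebn]_z (q r z)%:E)%E).
    rewrite Iq// (_ : (2 * r) ^+ n.+1 = (2 / n.+1%:R) ^+ n.+1 * tpow t)//.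
    by rewrite tpow_sqrt ?ltW// -exprMn; congr (_ ^+ _); rewrite /r; ring.
  apply: ge0_le_integralT => // z; first by case/andP: (q01 r z).
  case: ifPn => [_|]; first by case/andP: (q01 r z).
  apply: contraNT; rewrite -ltNge => qz0.
  have allin i : `|z ord0 i - y ord0 i| < r.
    move: qz0; rewrite /q (bigD1 i)//= dist; case: ifP => //.
    by rewrite mul0r ltxx.
  have : sqn (z - y) < \sum_(i < n.+1) r ^+ 2.
    rewrite /sqn; apply: ltr_sum; first by apply/hasP; exists ord0; rewrite // mem_index_enum.
    move=> i _; rewrite !mxE -(real_normK (num_real (_ - _))).
    by rewrite ltr_pXn2r// ?nnegrE// ltW.
  move=> /lt_le_trans; apply; rewrite sumr_const card_ord -[_ *+ n.+1]mulr_natl.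
  rewrite (_ : _ * _ = t / n.+1%:R); last first.
    rewrite /r exprMn sqr_sqrtr ?ltW//.
    have : n.+1%:R != 0 :> R by rewrite pnatr_eq0.
    by move: (n.+1%:R : R) => N N0; field.
  by rewrite ler_pdivrMr// ler_peMr ?ler1n// ltW.
- apply: (@le_trans _ _ (\int[lebn]_z (q (Num.sqrt t) z)%:E)%E); last first.
    by rewrite Iq// tpow_sqrt ?(ltW t0)// -exprMn.
  apply: ge0_le_integralT => // z; first by case: ifP.
  case: ifPn => [zt|_]; last by case/andP: (q01 (Num.sqrt t) z).
  rewrite /q big1// => i _; rewrite dist ifT//.
  rewrite -(ltr_pXn2r (n := 2))// ?nnegrE ?(ltW st0)//.
  rewrite real_normK ?num_real// sqr_sqrtr ?ltW//.
  by apply: le_lt_trans zt; have := sqn_coord (z - y) i; rewrite !mxE.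
Qed.

(** The integrand at z is multiplied by the volume of the ball of radius sqrt t around z, written as
    an integral over its points y. [Gam_shift] moves the Gaussian from z to y; after Tonelli the
    z-integral is over a Carleson cylinder at y, and the Gaussian left over has mass 1. *)
Lemma gauss_tent k : 0 < k -> exists C : R, 0 <= C /\
  forall w b, measurable_fun setT w -> (forall z, 0 <= w z) -> tent w b ->
  forall x t, 0 < t ->
  (\int[mu]_z (if slab t z then Gam (k * t) (x - z.1) * w z else 0)%:E
    <= (C * b)%:E)%E.
Proof.
move=> k0; pose v : R := (2 / n.+1%:R) ^+ n.+1.
have v0 : 0 < v by rewrite exprn_gt0// divr_gt0.
pose c1 : R := @c2 R n.+1 * expR ((4 * k)^-1).
have c10 : 0 <= c1 by rewrite mulr_ge0 ?c2_ge0 ?expR_ge0.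
exists (c1 / v); split; first by rewrite divr_ge0// ltW.
move=> w b mw w0 tw x t t0.
have kt0 : 0 < k * t by rewrite mulr_gt0.
have P0 : 0 < v * tpow t by rewrite mulr_gt0// tpow_gt0.
have mslab : measurable_fun setT (fun z : Rn * R => slab t z) by apply: measf_slab; meas.
have mG c : measurable_fun setT (fun y : Rn => Gam c (x - y)).
  by meas.
have m0 : measurable_fun setT (fun z : Rn * R => if slab t z then Gam (k * t) (x - z.1) * w z else 0).
  by meas.
have p0 z : 0 <= (if slab t z then Gam (k * t) (x - z.1) * w z else 0).
  by case: ifP => // _; rewrite mulr_ge0// Gam_ge0.
(* The Tonelli integrand, with p.1 the source and p.2 the centre over which the average is taken. *)
pose h (p : (Rn * R) * Rn) : R := c1 * (Gam (2 * (k * t)) (x - p.2) *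
  (if cyl p.2 t p.1 then w p.1 else 0)).
have mh : measurable_fun setT h.
  rewrite /h; meas; apply: measf_cyl; meas.
have h0 p : 0 <= h p.
  by rewrite /h mulr_ge0// mulr_ge0 ?Gam_ge0//; case: ifP.
have key z : (((v * tpow t)%:E * (if slab t z then Gam (k * t) (x - z.1) * w z else 0)%:E <=
   \int[lebn]_y (h (z, y))%:E))%E.
  have mhz : measurable_fun setT (fun y => h (z, y)) by apply: (measurableT_comp mh); meas.
  case: ifPn => [sz|_]; last first.
    by rewrite mule0; apply: integral_ge0 => y _; rewrite lee_fin.
  have [bv _] := ball_vol z.1 t0.
  have wG : 0 <= Gam (k * t) (x - z.1) * w z by rewrite mulr_ge0// Gam_ge0.
  apply: (@le_trans _ _ (\int[lebn]_y ((Gam (k * t) (x - z.1) * w z) *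
     (if (sqn (y - z.1) < t) then 1 else 0))%:E)%E).
    rewrite ge0_integralZlT//; last 2 first.
    - by meas.
    - by move=> y; case: ifP.
    rewrite muleC; apply: lee_wpmul2l => //.
  apply: ge0_le_integralT => //.
  - by meas.
  - by move=> y; rewrite mulr_ge0//; case: ifP.
  - move=> y; rewrite /h /cyl /= -/(slab t z) sz /= sqnB.
    case: ifPn => [yz|_]; last by rewrite !mulr0.
    rewrite mulr1 mulrA ler_wpM2r//.
    by apply: Gam_shift => //; rewrite sqnB.
have : ((v * tpow t)%:E * \int[mu]_z (if slab t z then Gam (k * t) (x - z.1) * w z else 0)%:E <=
   (c1 * (b * tpow t))%:E)%E.
  rewrite -ge0_integralZlT//; last exact: ltW.
  apply: (@le_trans _ _ (\int[mu]_z \int[lebn]_y (h (z, y))%:E)%E).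
    apply: ge0_le_integral => //.
    - by move=> z _; rewrite lee_fin mulr_ge0// ltW.
    - by apply: measfE; meas.
    - exact: measf_int1.
    - by move=> z _; rewrite EFinM; exact: key.
  rewrite (@ge0_fubini R _ _ _ _ mu lebn h mh h0).
  have mc y : measurable_fun setT (fun z => if cyl y t z then w z else 0).
    by meas; apply: measf_cyl; meas.
  apply: (@le_trans _ _ (\int[lebn]_y ((c1 * b * tpow t) * Gam (2 * (k * t)) (x - y))%:E)%E); last first.
    have b0 : 0 <= b * tpow t.
      rewrite -lee_fin; apply: le_trans (tw x t t0).
      by apply: integral_ge0 => z _; rewrite lee_fin; case: ifP.
    rewrite ge0_integralZlT//; last 2 first.
    - by move=> y; exact: Gam_ge0.
    - by rewrite -mulrA mulr_ge0.
    by rewrite integral_Gam ?mule1 ?lee_fin ?mulr_gt0// mulrA.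
  apply: ge0_le_integral => //.
  - by move=> y _; apply: integral_ge0 => z _; rewrite lee_fin.
  - exact: measf_int2.
  - by apply: measfE; meas.
  move=> y _; rewrite /h /=.
  under eq_integral do rewrite mulrA.
  rewrite ge0_integralZlT//; last 2 first.
  - by move=> z; case: ifP.
  - by rewrite mulr_ge0// Gam_ge0.
  have cG : 0 <= c1 * Gam (2 * (k * t)) (x - y) by rewrite mulr_ge0// Gam_ge0.
  apply: (le_trans (lee_wpmul2l _ (tw y t t0))); rewrite ?lee_fin//.
    by rewrite le_eqVlt; apply/orP; left; apply/eqP; ring.
  exact: mc.
rewrite -lee_pdivlMl// -EFinM => /le_trans; apply.
rewrite lee_fin le_eqVlt; apply/orP; left; apply/eqP; field.
by rewrite !gt_eqF// tpow_gt0.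
Qed.

End tent.

(** * Heat potentials *)

Ltac meas_ext ::= first
  [ apply: measf_gam | apply: measf_sqn | apply: measf_DGam | apply: measf_Gam
  | apply: measf_slab | apply: measf_cyl | apply: measf_sqrt | apply: measf_rVB ].

Section potentials.
Context {R : realType} {n : nat}.
Local Notation Rn := 'rV[R]_n.+1.
Local Notation leb := (@lebesgue_measure R).
Local Notation lebn := (@lebesgue_rV R n.+1).
Local Notation mu := (@stm R n.+1).

Lemma slabP (t : R) (z : Rn * R) : slab t z -> 0 < z.2 /\ z.2 < t.
Proof. by move=> /andP[]. Qed.

(** Common scheme for the kernels below. Up to time t/2 the kernel is dominated by a Gaussian and
    [gauss_tent] applies; after t/2 the density is at most 2 a / t and only the total mass M of the
    kernel counts. The scale t1 may exceed t, which [potG2] exploits. *)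
Lemma potential (k : R) : 0 < k -> exists C : R, 0 <= C /\
  forall (w : Rn * R -> R) (a b : R), measurable_fun setT w ->
  (forall z, 0 <= w z) -> 0 <= a -> supb w a -> tent w b ->
  forall (K : Rn * R -> R) (x : Rn) (t t1 A M : R),
  measurable_fun setT K -> (forall z, 0 <= K z) -> 0 < t -> t <= t1 -> 0 <= A ->
  (forall z, slab t z -> z.2 <= t / 2 -> K z <= A * Gam (k * t1) (x - z.1)) ->
  (\int[mu]_z (if slab t z then K z else 0)%:E <= M%:E)%E ->
  (\int[mu]_z (if slab t z then K z * w z else 0)%:E
     <= (C * A * b + 2 * a / t * M)%:E)%E.
Proof.
move=> k0; have [C [C0 HC]] := @gauss_tent R n k k0.
exists C; split => // w a b mw w0 a0 wa wb K x t t1 A M mK K0 t0 tt1 A0 KA KM.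
have t10 : 0 < t1 by exact: lt_le_trans tt1.
pose f1 (z : Rn * R) : R := if slab t1 z then Gam (k * t1) (x - z.1) * w z else 0.
pose f2 (z : Rn * R) : R := if slab t z then K z else 0.
have mf1 : measurable_fun setT f1 by rewrite /f1; meas.
have mf2 : measurable_fun setT f2 by rewrite /f2; meas.
have f10 z : 0 <= f1 z by rewrite /f1; case: ifP => // _; rewrite mulr_ge0 ?Gam_ge0.
have f20 z : 0 <= f2 z by rewrite /f2; case: ifP.
have at0 : 0 <= 2 * a / t by rewrite divr_ge0 ?mulr_ge0// ltW.
have I1 : (\int[mu]_z (A * f1 z)%:E <= (C * A * b)%:E)%E.
  rewrite ge0_integralZlT//.
  have := HC w b mw w0 wb x t1 t10.
  move=> /(lee_wpmul2l (x := A%:E)) H; apply: (le_trans (H _)); first by rewrite lee_fin.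
  by rewrite -EFinM lee_fin mulrCA mulrA.
have I2 : (\int[mu]_z (2 * a / t * f2 z)%:E <= (2 * a / t * M)%:E)%E.
  by rewrite ge0_integralZlT// [X in (_ <= X)%E]EFinM; apply: lee_wpmul2l.
rewrite EFinD; apply: le_trans (leeD I1 I2).
have mAf1 : measurable_fun setT (fun z => A * f1 z) by meas.
have mBf2 : measurable_fun setT (fun z => 2 * a / t * f2 z) by meas.
have Af10 z : 0 <= A * f1 z by rewrite mulr_ge0.
have Bf20 z : 0 <= 2 * a / t * f2 z by rewrite mulr_ge0.
rewrite -ge0_integralDT//.
have mL : measurable_fun setT (fun z => if slab t z then K z * w z else 0) by meas.
apply: ae_ge0_le_integral => //.
- by move=> z _; rewrite lee_fin; case: ifP => // _; rewrite mulr_ge0.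
- exact: measfE.
- by move=> z _; rewrite lee_fin addr_ge0.
- by apply: measfE; exact: measfD.
apply: aeS wa => z wz _; rewrite lee_fin /f1 /f2.
case: ifPn => [sz|_]; last by rewrite mulr0 addr0 mulr_ge0// f10.
have [z0 zt] := slabP sz.
have sz1 : slab t1 z by rewrite /slab z0 (lt_le_trans zt).
rewrite sz1; have [zt2|zt2] := leP z.2 (t / 2).
  apply: (@le_trans _ _ (A * (Gam (k * t1) (x - z.1) * w z))).
    by rewrite mulrA ler_wpM2r// KA.
  by rewrite lerDl mulr_ge0.
apply: (@le_trans _ _ (2 * a / t * K z)); last by rewrite lerDr mulr_ge0// mulr_ge0// Gam_ge0.
rewrite mulrC ler_wpM2r// ler_pdivlMr// mulrC.
have {}wz := wz z0.
apply: (@le_trans _ _ (2 * (z.2 * w z))); last by rewrite ler_wpM2l.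
by rewrite mulrA ler_wpM2r// mulrC; lra.
Qed.

Lemma slab_mass (x : Rn) (t : R) (c m : R -> R) :
  measurable_fun setT c -> measurable_fun setT m -> (forall s, 0 <= m s) ->
  (forall s, 0 < s -> s < t -> 0 < c s) ->
  (\int[mu]_z (if slab t z then m z.2 * Gam (c z.2) (x - z.1) else 0)%:E =
   \int[leb]_s (if ((0 < s) && (s < t))%R then m s else 0)%:E)%E.
Proof.
move=> mc mm m0 c0.
rewrite stm_fubini2; last 2 first.
- by meas.
- by move=> z; case: ifP => // _; rewrite mulr_ge0// Gam_ge0.
apply: eq_integral => s _; rewrite /slab /=.
case: ifPn => [/andP[s0 st]|_]; last by rewrite integral0.
rewrite ge0_integralZlT//.
- by rewrite integral_Gam ?mule1// c0.
- by meas.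
- by move=> y; exact: Gam_ge0.
Qed.

Lemma potD : exists C : R, 0 <= C /\
  forall (w : Rn * R -> R) (a b : R), measurable_fun setT w ->
  (forall z, 0 <= w z) -> 0 <= a -> 0 <= b -> supb w a -> tent w b ->
  forall j (x : Rn) (t : R), 0 < t ->
  (\int[mu]_z (if slab t z then `|DGam j (t - z.2) (x - z.1)| * w z else 0)%:E
     <= (C * (Num.sqrt t)^-1 * (a + b))%:E)%E.
Proof.
have [C [C0 HC]] := @potential 2 ltac:(lra).
pose q : R := @c2 R n.+1.
have q0 : 0 <= q by exact: c2_ge0.
exists (2 * C * q ^+ 2 + 4 * q); split.
  by rewrite addr_ge0 ?mulr_ge0// exprn_ge0.
move=> w a b mw w0 a0 b0 wa wb j x t t0.
have st0 : 0 < Num.sqrt t by rewrite sqrtr_gt0.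
have sq : Num.sqrt t ^+ 2 = t by rewrite sqr_sqrtr// ltW.
(* For s <= t/2: one factor q from [DGam_le], one from moving the time 2 (t - s) to 2 t, and (t -
   s)^(-1/2) <= 2 t^(-1/2). The mass q (2 sqrt t) used with it is the integral of the inverse square
   root. *)
pose A := q ^+ 2 * (2 * (Num.sqrt t)^-1).
have := HC w a b mw w0 a0 wa wb (fun z => `|DGam j (t - z.2) (x - z.1)|) x t t A
  (q * (2 * Num.sqrt t)).
have -> : C * A * b + 2 * a / t * (q * (2 * Num.sqrt t)) =
    (2 * C * q ^+ 2 * b + 4 * q * a) * (Num.sqrt t)^-1.
  have e : Num.sqrt t / t = (Num.sqrt t)^-1.
    by rewrite -{2}sq expr2 invfM mulrA divff ?mul1r ?gt_eqF.
  rewrite [RHS]mulrDl -[in RHS]e (_ : 4 * q * a * (Num.sqrt t / t) =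
    2 * a / t * (q * (2 * Num.sqrt t))); last by ring.
  by rewrite e /A; ring.
move=> H; apply: (le_trans (H _ _ _ _ _ _ _)) => //.
- by meas.
- by rewrite /A !mulr_ge0 ?exprn_ge0// invr_ge0 ltW.
- move=> z /slabP[z0 zt] zt2.
  have ts : 0 < t - z.2 by rewrite subr_gt0.
  apply: (le_trans (DGam_le j _ ts)).
  rewrite /A -/q powRh_sqrt ?(ltW ts)//.
  have h1 : (Num.sqrt (t - z.2))^-1 <= 2 * (Num.sqrt t)^-1.
    rewrite -[2]invrK -invfM lef_pV2 ?posrE ?mulr_gt0 ?invr_gt0 ?sqrtr_gt0//.
    rewrite -(@ler_pXn2r _ 2)// ?nnegrE ?sqrtr_ge0 ?mulr_ge0 ?invr_ge0 ?sqrtr_ge0//.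
    rewrite exprMn sq sqr_sqrtr ?(ltW ts)// exprVn; lra.
  have h2 : Gam (2 * (t - z.2)) (x - z.1) <= q * Gam (2 * t) (x - z.1).
    by apply: Gam_le2; clear -t0 z0 zt zt2 ts; lra.
  rewrite [leRHS](_ : _ = q * (2 * (Num.sqrt t)^-1) * (q * Gam (2 * t) (x - z.1))); last by ring.
  by rewrite ler_pM ?Gam_ge0 ?mulr_ge0 ?invr_ge0 ?sqrtr_ge0// ler_wpM2l.
- apply: (@le_trans _ _ (\int[mu]_z (q * (if slab t z then
     (Num.sqrt (t - z.2))^-1 * Gam (2 * (t - z.2)) (x - z.1) else 0))%:E)%E).
    apply: ge0_le_integralT; [by meas|by meas|..] => z; first by case: ifP.
    case: ifPn => [/slabP[z0 zt]|_]; last by rewrite mulr0.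
    have ts : 0 < t - z.2 by rewrite subr_gt0.
    by apply: (le_trans (DGam_le j _ ts)); rewrite -/q powRh_sqrt ?(ltW ts)// mulrA.
  rewrite ge0_integralZlT//; last 2 first.
  - by meas.
  - by move=> z; case: ifP => // _; rewrite mulr_ge0 ?Gam_ge0// invr_ge0 sqrtr_ge0.
  rewrite EFinM; apply: lee_wpmul2l; first by rewrite lee_fin.
  rewrite (@slab_mass x t (fun s => 2 * (t - s)) (fun s => (Num.sqrt (t - s))^-1)).
  + exact: integral_invsqrt.
  + by meas.
  + by meas.
  + by move=> s; rewrite invr_ge0 sqrtr_ge0.
  + by move=> s _ st; rewrite mulr_gt0// subr_gt0.
- rewrite lee_fin [leRHS]mulrAC ler_wpM2r ?invr_ge0 ?sqrtr_ge0//.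
  rewrite mulrDr !mulrDl.
  have h1 : 0 <= 2 * C * q ^+ 2 * a by rewrite !mulr_ge0 ?exprn_ge0.
  have h2 : 0 <= 4 * q * b by rewrite !mulr_ge0.
  by lra.
Qed.

Lemma slab_mass1 (t : R) : 0 < t ->
  (\int[leb]_s (if ((0 < s) && (s < t))%R then 1 else 0)%:E <= t%:E)%E.
Proof. by move=> t0; rewrite integral_oo_itv// subr0. Qed.

Lemma potG : exists C : R, 0 <= C /\
  forall (w : Rn * R -> R) (a b : R), measurable_fun setT w ->
  (forall z, 0 <= w z) -> 0 <= a -> 0 <= b -> supb w a -> tent w b ->
  forall (x : Rn) (t : R), 0 < t ->
  (\int[mu]_z (if slab t z then Gam (t - z.2) (x - z.1) * w z else 0)%:E
     <= (C * (a + b))%:E)%E.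
Proof.
have [C [C0 HC]] := @potential 1 ltac:(lra).
pose q : R := @c2 R n.+1.
have q0 : 0 <= q by exact: c2_ge0.
exists (C * q + 2); split; first by rewrite addr_ge0 ?mulr_ge0.
move=> w a b mw w0 a0 b0 wa wb x t t0.
have := HC w a b mw w0 a0 wa wb (fun z => Gam (t - z.2) (x - z.1)) x t t q t.
have -> : C * q * b + 2 * a / t * t = C * q * b + 2 * a.
  by field; rewrite gt_eqF.
move=> H; apply: (le_trans (H _ _ _ _ _ _ _)) => //.
- by meas.
- by move=> z; exact: Gam_ge0.
- by move=> z /slabP[z0 zt] zt2; apply: Gam_le2; clear -t0 z0 zt zt2; lra.
- rewrite (_ : (fun z => _) = (fun z : Rn * R =>
    (if slab t z then 1 * Gam (t - z.2) (x - z.1) else 0)%:E)); last first.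
    by apply/funext => z; rewrite mul1r.
  rewrite (@slab_mass x t (fun s => t - s) (fun s => 1)).
  + exact: slab_mass1.
  + by meas.
  + by meas.
  + by [].
  + by move=> s _ st; rewrite subr_gt0.
- rewrite lee_fin mulrDr !mulrDl.
  have h1 : 0 <= C * q * a by rewrite !mulr_ge0.
  by lra.
Qed.

(** The kernel is the boundary term at the final time T of the energy identity. For s <= t/2 and t
    <= T its time lies between T/2 and 2 T, so two doublings, hence q^2, bring it to 2 T. *)
Lemma potG2 : exists C : R, 0 <= C /\
  forall (w : Rn * R -> R) (a b : R), measurable_fun setT w ->
  (forall z, 0 <= w z) -> 0 <= a -> 0 <= b -> supb w a -> tent w b ->
  forall (x : Rn) (t T : R), 0 < t -> t <= T ->
  (\int[mu]_z (if slab t z then Gam (2 * T - z.2 - t) (x - z.1) * w z else 0)%:E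
     <= (C * (a + b))%:E)%E.
Proof.
have [C [C0 HC]] := @potential 2 ltac:(lra).
pose q : R := @c2 R n.+1.
have q0 : 0 <= q by exact: c2_ge0.
have q1 : 1 <= q by rewrite /q /c2 -[leLHS](powRr0 2) ler_powR// ?ler1n// divr_ge0.
exists (C * q ^+ 2 + 2); split; first by rewrite addr_ge0 ?mulr_ge0 ?exprn_ge0.
move=> w a b mw w0 a0 b0 wa wb x t T t0 tT.
have := HC w a b mw w0 a0 wa wb (fun z => Gam (2 * T - z.2 - t) (x - z.1)) x t T (q ^+ 2) t.
have -> : C * q ^+ 2 * b + 2 * a / t * t = C * q ^+ 2 * b + 2 * a.
  by field; rewrite gt_eqF.
move=> H; apply: (le_trans (H _ _ _ _ _ _ _)) => //.
- by meas.
- by move=> z; exact: Gam_ge0.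
- by rewrite exprn_ge0.
- move=> z /slabP[z0 zt] zt2; set r := 2 * T - z.2 - t.
  have rE : r = 2 * T - z.2 - t by [].
  have [rT|rT] := leP T r.
    apply: (@le_trans _ _ (q * Gam (2 * T) (x - z.1))); first by apply: Gam_le2; clear -t0 tT z0 zt zt2 rT rE; lra.
    by rewrite ler_wpM2r ?Gam_ge0// expr2 ler_peMl.
  apply: (@le_trans _ _ (q * Gam T (x - z.1))); first by apply: Gam_le2; clear -t0 tT z0 zt zt2 rT rE; lra.
  rewrite expr2 -mulrA ler_wpM2l//; apply: Gam_le2; clear -t0 tT z0 zt zt2 rT rE; lra.
- rewrite (_ : (fun z => _) = (fun z : Rn * R =>
    (if slab t z then 1 * Gam (2 * T - z.2 - t) (x - z.1) else 0)%:E)); last first.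
    by apply/funext => z; rewrite mul1r.
  rewrite (@slab_mass x t (fun s => 2 * T - s - t) (fun s => 1)).
  + exact: slab_mass1.
  + by meas.
  + by meas.
  + by [].
  + by move=> s _ st; lra.
- rewrite lee_fin mulrDr !mulrDl.
  have h1 : 0 <= C * q ^+ 2 * a by rewrite !mulr_ge0 ?exprn_ge0.
  by lra.
Qed.

End potentials.

(** * The energy estimate *)

Section energy.
Context {R : realType} d1 d2 (X : measurableType d1) (Z : measurableType d2).
Variables (mX : {sigma_finite_measure set X -> \bar R})
  (mZ : {sigma_finite_measure set Z -> \bar R}).
Local Notation mZZ := (pm mZ mZ).

Lemma integrable_normP d (T : measurableType d) (m : {measure set T -> \bar R})
    (f : T -> R) : measurable_fun setT f ->
  m.-integrable setT (EFin \o f) <-> (\int[m]_z `|f z|%:E < +oo)%E.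
Proof.
move=> mf; split=> [/integrableP[_ //]|foo].
by apply/integrableP; split => //; exact: measfE.
Qed.

Lemma normP_integrable d (T : measurableType d) (m : {measure set T -> \bar R})
    (f : T -> R) : measurable_fun setT f -> (\int[m]_z `|f z|%:E < +oo)%E ->
  m.-integrable setT (fun z => (f z)%:E).
Proof. by move=> mf /(integrable_normP m mf). Qed.

Lemma Rintegral_EFin d (T : measurableType d) (m : {measure set T -> \bar R})
    (f : T -> R) : m.-integrable setT (EFin \o f) ->
  ((\int[m]_z f z)%:E = \int[m]_z (f z)%:E)%E.
Proof. by move=> If; rewrite /Rintegral fineK// integrable_fin_num. Qed.

Lemma Rintegral_sqr (f : Z -> R) : mZ.-integrable setT (EFin \o f) ->
  mZZ.-integrable setT (fun p => (f p.1 * f p.2)%:E) /\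
  (((\int[mZ]_z f z) ^+ 2)%:E = \int[mZZ]_p (f p.1 * f p.2)%:E)%E.
Proof.
move=> If; have mf : measurable_fun setT f by have /measurable_int/measurable_EFinP := If.
have mff : measurable_fun setT (fun p : Z * Z => f p.1 * f p.2) by meas.
have Ifn := (integrable_normP mZ mf).1 If.
have Iff : mZZ.-integrable setT (fun p => (f p.1 * f p.2)%:E).
  apply: (pm_normP mff).
  under eq_integral do rewrite normrM.
  rewrite (@pm_integralM R _ _ _ _ mZ mZ (fun z => `|f z|) (fun z => `|f z|))//.
  - by apply: lte_mul_pinfty => //; rewrite ?integral_ge0// ge0_fin_numE// integral_ge0.
  - exact: measf_norm.
  - exact: measf_norm.
split => //; rewrite -(pm_int12 Iff) /=.
under eq_integral.
  move=> z _; under eq_integral do rewrite EFinM.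
  rewrite integralZl//.
  over.
by rewrite /= -(Rintegral_EFin If) integralZr//= -(Rintegral_EFin If) expr2.
Qed.

(** Each square is a double integral over pairs of sources; Fubini brings the integral over targets
    inside, where k bounds it. The bound by k is required only almost everywhere, where both sources
    are active, and may assume the integrability that Fubini supplies. *)
Lemma energy_expansion (J : finType) (K : J -> X * Z -> R) (g : Z -> R)
    (k : Z * Z -> R) :
  (forall j, measurable_fun setT (K j)) -> measurable_fun setT g ->
  measurable_fun setT k -> (forall p, 0 <= k p) ->
  (forall j x, mZ.-integrable setT (fun z => (K j (x, z) * g z)%:E)) ->
  (forall j, (\int[mX]_x (\int[mZ]_z `|K j (x, z) * g z|%:E *
      \int[mZ]_z `|K j (x, z) * g z|%:E) < +oo)%E) ->
  {ae mZZ, forall p, g p.1 * g p.2 != 0 ->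
    mX.-integrable setT
      (fun x => (\sum_j K j (x, p.1) * K j (x, p.2))%:E) ->
    (`|\int[mX]_x (\sum_j K j (x, p.1) * K j (x, p.2))%:E| <= (k p)%:E)%E} ->
  (\int[mX]_x (\sum_j (\int[mZ]_z (K j (x, z) * g z)) ^+ 2)%:E <=
   \int[mZZ]_p (`|g p.1| * `|g p.2| * k p)%:E)%E.
Proof.
move=> mK mg mk k0 IK IKK Hk.
pose F j (q : X * (Z * Z)) : R := K j (q.1, q.2.1) * g q.2.1 * (K j (q.1, q.2.2) * g q.2.2).
have mF j : measurable_fun setT (F j).
  by have mKj := mK j; rewrite /F; meas.
have IF j : (pm mX mZZ).-integrable setT (EFin \o F j).
  apply: (pm_normP (mF j)).
  rewrite (@pm_fubini1 R _ _ _ _ mX mZZ (fun q => `|F j q|))//; last exact: measf_norm.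
  apply: le_lt_trans (IKK j); apply: ge0_le_integral => //.
  - by move=> x _; apply: integral_ge0.
  - apply: (@measf_int1 R _ _ _ _ mZZ (fun q => `|F j q|)) => //.
    exact: measf_norm.
  - have mKj := mK j.
    have mh : measurable_fun setT (fun x => \int[mZ]_z `|K j (x, z) * g z|%:E)%E.
      apply: (@measf_int1 R _ _ _ _ mZ (fun q : X * Z => `|K j (q.1, q.2) * g q.2|)) => //.
      by meas.
    exact: measf_eM.
  - move=> x _; rewrite /F /=.
    under eq_integral do rewrite normrM.
    have mKx : measurable_fun setT (fun z => `|K j (x, z) * g z|).
      by have mKj := mK j; meas.
    by rewrite (@pm_integralM R _ _ _ _ mZ mZ (fun z => `|K j (x, z) * g z|) (fun z => `|K j (x, z) * g z|)).
pose S (q : X * (Z * Z)) : R := \sum_j F j q.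
have mS : measurable_fun setT S by apply: measf_sum => j; exact: mF.
have IS : (pm mX mZZ).-integrable setT (EFin \o S).
  rewrite /S (_ : EFin \o _ = fun q => (\sum_(j <- index_enum J) (EFin \o F j) q)%E); last first.
    by apply/funext => q; rewrite /= sumEFin.
  by apply: integrable_sum => // j _; exact: IF.
have SE x : ((\sum_j (\int[mZ]_z (K j (x, z) * g z)) ^+ 2)%:E =
    \int[mZZ]_p (S (x, p))%:E)%E.
  rewrite -sumEFin /S; under [in RHS]eq_integral do rewrite -sumEFin.
  rewrite integral_sum//=; last first.
    by move=> j; have [] := Rintegral_sqr (IK j x).
  by apply: eq_bigr => j _; have [_ ->] := Rintegral_sqr (IK j x).
under eq_integral do rewrite SE.
rewrite (pm_int12 IS) -(pm_int21 IS).
apply: (le_trans (lee_abs _)).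
have mG : measurable_fun setT (fun p => \int[mX]_x (S (x, p))%:E)%E := measurable_fubini_G IS.
apply: (le_trans (le_abse_integral _ _ _)) => //.
have Sp (p : Z * Z) : (fun x => (S (x, p))%:E) =
    (fun x => ((g p.1 * g p.2)%:E * (\sum_j K j (x, p.1) * K j (x, p.2))%:E))%E.
  apply/funext => x; rewrite -EFinM /S /F mulr_sumr /=; congr _%:E.
  by apply: eq_bigr => j _; ring.
apply: ae_ge0_le_integral => //.
- exact: measurableT_comp.
- by move=> p _; rewrite lee_fin mulr_ge0// mulr_ge0.
- by meas.
have := pm_aeint2 IS; move: Hk; apply: aeS2 => p Hk ISp _.
rewrite /= Sp.
have [gg0|gg0] := eqVneq (g p.1 * g p.2) 0.
  rewrite gg0; under eq_integral do rewrite mul0e.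
  by rewrite integral0 abse0 lee_fin mulr_ge0// mulr_ge0.
(* Fubini yields integrability of the product that includes the sources; dividing by the nonzero
   constant g(z) g(z') isolates the kernels. *)
have IKp : mX.-integrable setT (fun x => (\sum_j K j (x, p.1) * K j (x, p.2))%:E).
  have -> : (fun x => (\sum_j K j (x, p.1) * K j (x, p.2))%:E) =
    (fun x => ((g p.1 * g p.2)^-1%:E * (S (x, p))%:E))%E.
    apply/funext => x; have := congr1 (fun h => h x) (Sp p) => /= ->.
    by rewrite -!EFinM mulrA mulVf// mul1r.
  exact: integrableZl.
rewrite integralZl// abseM -[`|g p.1| * _]normrM abse_EFin [X in (_ <= X)%E]EFinM.
apply: lee_wpmul2l; first by rewrite lee_fin.
exact: Hk.
Qed.

End energy.

Lemma measf_fine {R : realType} d (T : measurableType d) (f : T -> \bar R) :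
  measurable_fun setT f -> measurable_fun setT (fun x => fine (f x)).
Proof. by move=> mf; exact: measurableT_comp. Qed.

Lemma measf_Rint1 {R : realType} d1 d2 (T1 : measurableType d1) (T2 : measurableType d2)
    (m2 : {sigma_finite_measure set T2 -> \bar R}) (f : T1 * T2 -> R) :
  measurable_fun setT f -> measurable_fun setT (fun x => \int[m2]_y f (x, y)).
Proof.
move=> mf; apply: measf_fine.
rewrite (_ : (fun x => _) = (fun x => \int[m2]_y (Num.max (f (x, y)) 0)%:E -
    \int[m2]_y (Num.max (- f (x, y)) 0)%:E)%E); last first.
  apply/funext => x; rewrite integralE.
  by congr (_ - _)%E; apply: eq_integral => y _; rewrite ?funeposE ?funenegE EFin_max ?EFinN.
apply: emeasurable_funB.
  apply: (@measf_int1 R _ _ _ _ m2 (fun p => Num.max (f p) 0)).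
    exact: measurable_funrpos.
  by move=> z; rewrite le_max lexx orbT.
apply: (@measf_int1 R _ _ _ _ m2 (fun p => Num.max (- f p) 0)).
  exact: measurable_funrneg.
by move=> z; rewrite le_max lexx orbT.
Qed.


Lemma Rintegral_bound {R : realType} d (T : measurableType d)
    (m : {measure set T -> \bar R}) (f : T -> R) (M : R) :
  measurable_fun setT f -> (\int[m]_z `|f z|%:E <= M%:E)%E ->
  m.-integrable setT (EFin \o f) /\ `|\int[m]_z f z| <= M.
Proof.
move=> mf fM.
have If : m.-integrable setT (EFin \o f).
  by apply: normP_integrable => //; exact: le_lt_trans fM (ltry _).
split => //; apply: (le_trans (le_normr_Rintegral measurableT If)).
rewrite -lee_fin Rintegral_EFin//.
exact: (integrable_norm If).
Qed.

Section near_energy.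
Context {R : realType} {n : nat}.
Local Notation Rn := 'rV[R]_n.+1.
Local Notation leb := (@lebesgue_measure R).
Local Notation lebn := (@lebesgue_rV R n.+1).
Local Notation mu := (@stm R n.+1).

(** p.1 is the target and p.2 the source. The horizon T is built into the kernel so that the energy
    can be integrated over all of space-time. *)
Definition KD (T : R) (j : 'I_n.+1) (p : (Rn * R) * (Rn * R)) : R :=
  if slab p.1.2 p.2 && (p.1.2 < T)
  then DGam j (p.1.2 - p.2.2) (p.1.1 - p.2.1) else 0.

(** Here p.1 is the later of two sources. The time integral in the energy identity is half the
    difference of these two Gaussians; their sum is a nonnegative majorant of its absolute value. *)
Definition kpot (T : R) (p : (Rn * R) * (Rn * R)) : R :=
  if slab p.1.2 p.2 then Gam (p.1.2 - p.2.2) (p.1.1 - p.2.1) +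
    Gam (2 * T - p.2.2 - p.1.2) (p.1.1 - p.2.1) else 0.

Lemma measf_KD T j : measurable_fun setT (KD T j).
Proof. by rewrite /KD; meas. Qed.

Lemma measf_kpot T : measurable_fun setT (kpot T).
Proof. by rewrite /kpot; meas. Qed.

Lemma kpot_ge0 T p : 0 <= kpot T p.
Proof. by rewrite /kpot; case: ifP => // _; rewrite addr_ge0 ?Gam_ge0. Qed.

(** The source is fixed and the target integrated. This crude bound grows with T but enters only the
    justification of Fubini, not the final constant. *)
Lemma KD_mass T j z :
  (\int[mu]_q `|KD T j (q, z)|%:E <= (@c2 R n.+1 * (2 * Num.sqrt T))%:E)%E.
Proof.
have mK := measf_KD T j.
have c0 : 0 <= @c2 R n.+1 by exact: c2_ge0.
have rhs0 : 0 <= @c2 R n.+1 * (2 * Num.sqrt T) by rewrite !mulr_ge0 ?sqrtr_ge0.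
have [/andP[s0 sT]|nsT] := boolP (slab T z); last first.
  rewrite integral0_eq ?lee_fin// => q _; rewrite /KD /slab /=.
  case: ifPn; rewrite ?normr0// => /andP[/andP[a b] c].
  by move: nsT; rewrite /slab a (lt_trans b).
pose f (q : Rn * R) : R := if (z.2 < q.2) && (q.2 < T) then
  @c2 R n.+1 * (Num.sqrt (q.2 - z.2))^-1 * Gam (2 * (q.2 - z.2)) (q.1 - z.1) else 0.
have mf : measurable_fun setT f by rewrite /f; meas.
have f0 q : 0 <= f q.
  rewrite /f; case: ifP => // _.
  by rewrite !mulr_ge0 ?invr_ge0 ?sqrtr_ge0 ?Gam_ge0.
apply: (@le_trans _ _ (\int[mu]_q (f q)%:E)%E).
  apply: ge0_le_integralT => //.
  - by apply: measf_norm; apply: (measurableT_comp mK); meas.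
  - move=> q; rewrite /KD /f /slab /= s0 /=; case: ifP => [/andP[st _]|_]; last by rewrite normr0.
    have st0 : 0 < q.2 - z.2 by rewrite subr_gt0.
    by rewrite -powRh_sqrt ?(ltW st0)//; exact: DGam_le.
rewrite stm_fubini2//.
pose h (t : R) : R := if (z.2 < t) && (t < T) then (Num.sqrt (t - z.2))^-1 else 0.
have mh : measurable_fun setT h by rewrite /h; meas.
have h0 t : 0 <= h t by rewrite /h; case: ifP => // _; rewrite invr_ge0 sqrtr_ge0.
apply: (@le_trans _ _ (\int[leb]_t (@c2 R n.+1 * h t)%:E)%E).
  rewrite le_eqVlt; apply/orP; left; apply/eqP; apply: eq_integral => t _.
  rewrite /f /h /=; case: ifPn => [/andP[st _]|_]; last by rewrite integral0 mulr0.
  have st0 : 0 < t - z.2 by rewrite subr_gt0.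
  rewrite ge0_integralZlT.
  - by rewrite integral_Gam' ?mule1// mulr_gt0.
  - by meas.
  - by move=> y; exact: Gam_ge0.
  - by rewrite mulr_ge0// invr_ge0 sqrtr_ge0.
rewrite ge0_integralZlT// EFinM; apply: lee_wpmul2l; first by rewrite lee_fin.
apply: (le_trans (integral_invsqrt' sT)).
rewrite lee_fin ler_wpM2l// ler_sqrt; last by rewrite (le_trans (ltW s0))// ltW.
by rewrite lerBlDr lerDl ltW.
Qed.

(** At target time t the space integral is the trace identity with a = t - z.2 and b = t - z'.2. It
    is nonzero only after both sources have acted, so the time integral starts at the later time
    z.2. *)
Lemma KD_cross T (z z' : Rn * R) : slab T z -> slab T z' -> z'.2 < z.2 ->
  mu.-integrable setT (fun q => (\sum_j KD T j (q, z) * KD T j (q, z'))%:E) ->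
  (`|\int[mu]_q (\sum_j KD T j (q, z) * KD T j (q, z'))%:E| <= (kpot T (z, z'))%:E)%E.
Proof.
move=> /andP[s0 sT] /andP[s0' sT'] ss Iq.
rewrite -[X in `|X|%E](@pm_int21 _ _ _ _ _ lebn leb (fun q => \sum_j KD T j (q, z) * KD T j (q, z')) Iq).
pose c := z.2 + z'.2.
have mc : 0 < 2 * z.2 - c by rewrite /c; lra.
rewrite (_ : (\int[leb]_t _)%E = (2^-1 * (Gam (2 * z.2 - c) (z.1 - z'.1) -
  Gam (2 * T - c) (z.1 - z'.1)))%:E); last first.
  etransitivity; last exact: (integral_dGam (z.1 - z'.1) sT mc).
  rewrite [RHS]integral_mkcond; congr integral; apply/funext => t.
  rewrite patchE; case: ifPn; rewrite ?inE ?notin_setE /= in_itv /=.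
    move=> /andP[st tT].
    have st' : z'.2 < t by exact: lt_trans st.
    rewrite -(_ : (t - z.2) + (t - z'.2) = 2 * t - c); last by rewrite /c; ring.
    rewrite -integral_sum_DGam ?subr_gt0//; apply: eq_integral => y _.
    congr _%:E; apply: eq_bigr => j _.
    by rewrite /KD /slab /= s0 s0' st st' tT.
  move=> /negP h; rewrite integral0_eq// => y _; rewrite big1// => j _.
  by rewrite /KD /slab /= s0 /= (negPf h) mul0r.
rewrite abse_EFin lee_fin /kpot /slab /= s0' ss /=.
rewrite (_ : 2 * z.2 - c = z.2 - z'.2); last by rewrite /c; ring.
rewrite (_ : 2 * T - c = 2 * T - z'.2 - z.2); last by rewrite /c; ring.
set G1 := Gam _ _; set G2 := Gam _ _.
have G10 : 0 <= G1 by exact: Gam_ge0.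
have G20 : 0 <= G2 by exact: Gam_ge0.
by rewrite ler_norml; clear -G10 G20; apply/andP; split; lra.
Qed.

(** Simultaneous sources would lead to the Gauss kernel at time 0; they form a null set because for
    a fixed first point the admissible times reduce to a singleton. *)
Lemma same_time_null : {ae pm mu mu, forall p, p.1.2 != p.2.2}.
Proof.
pose f (p : (Rn * R) * (Rn * R)) : R := if p.1.2 <= p.2.2 then if p.2.2 <= p.1.2 then 1 else 0 else 0.
have mf : measurable_fun setT f by rewrite /f; meas.
have f0 p : 0 <= f p by rewrite /f; case: ifP => // _; case: ifP.
have : (\int[pm mu mu]_p `|(f p)%:E| = 0)%E.
  rewrite (_ : (fun p => `|(f p)%:E|%E) = (fun p => (f p)%:E)); last first.
    by apply/funext => p; rewrite abse_EFin ger0_norm.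
  rewrite pm_fubini1//; apply: integral0_eq => z _.
  have mfz : measurable_fun setT (fun z' => f (z, z')) by apply: (measurableT_comp mf); meas.
  rewrite stm_fubini1//; apply: integral0_eq => y _.
  rewrite (_ : (fun s => (f (z, (y, s)))%:E) = (fun s => (\1_[set z.2] s)%:E)).
    rewrite (@integral_indic _ _ R leb setT measurableT [set z.2] (measurable_set1 _)).
    by rewrite setIT; exact: lebesgue_measure_set1.
  apply/funext => s; rewrite indicE /f /=; congr _%:E.
  have [->|ns] := eqVneq s z.2.
    by rewrite lexx mem_set.
  rewrite memNset; last by move=> /= h; move: ns; rewrite h eqxx.
  by case: ifPn => // zs; case: ifPn => // sz; move: ns; rewrite eq_le sz zs.
move=> /(ae_eq_integral_abs (pm mu mu) measurableT (measfE mf)).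
apply: aeS => p /(_ I) /= [] fp; apply/negP => /eqP e.
by move: fp; rewrite /f e lexx => /eqP; rewrite oner_eq0.
Qed.


Lemma cvg_sumr (I : finType) (u : I -> nat -> R) (l : I -> R) :
  (forall i, u i @ \oo --> l i) ->
  (fun k => \sum_i u i k) @ \oo --> \sum_i l i.
Proof.
move=> ul; rewrite (_ : (fun k => _) = \sum_i u i); last first.
  by apply/funext => k; rewrite fct_sumE.
elim/big_ind2 : _ => //; [exact: cvg_cst|by move=> *; exact: cvgD].
Qed.

Lemma Rdominated d (S : measurableType d) (m : {measure set S -> \bar R})
    (fk : nat -> S -> R) (f h : S -> R) :
  (forall k, measurable_fun setT (fk k)) -> (forall z, fk ^~ z @ \oo --> f z) ->
  m.-integrable setT (EFin \o h) -> (forall k z, `|fk k z| <= h z) ->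
  m.-integrable setT (EFin \o f) /\ (fun k => \int[m]_z (fk k z)) @ \oo --> \int[m]_z f z.
Proof.
move=> mfk fkf Ih fkh.
have mf : measurable_fun setT f.
  by apply: (measurable_fun_cvg mfk) => z _; exact: fkf.
have fkfE z : (fun k => (fk k z)%:E) @ \oo --> (f z)%:E.
  by apply: cvg_EFin; [exact: nearW|exact: fkf].
have [If _ cv] := @dominated_convergence _ _ R m setT measurableT
  (fun k z => (fk k z)%:E) (EFin \o f) (EFin \o h)
  (fun k => measfE (mfk k)) (measfE mf) (aeW m (fun z _ => fkfE z))
  Ih (aeW m (fun z k _ => fkh k z)).
split => //; move: cv; rewrite /Rintegral => cv.
apply: fine_cvg; rewrite fineK//; exact: integrable_fin_num.
Qed.

(** The double integral of |g| |g'| against [kpot] is estimated one variable at a time: the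
    potential bounds [potG] and [potG2] give (C1 + C2) (a + b) for one source, and G is the mass of
    the other. *)
Lemma near_energy : exists C : R, 0 <= C /\
  forall (w : Rn * R -> R) (a b : R), measurable_fun setT w ->
  (forall z, 0 <= w z) -> 0 <= a -> 0 <= b -> supb w a -> tent w b ->
  forall (T : R) (g : Rn * R -> R) (G : R), 0 < T -> measurable_fun setT g ->
  (forall z, `|g z| <= w z) ->
  (\int[mu]_z (if slab T z then `|g z| else 0)%:E <= G%:E)%E ->
  (\int[mu]_q (\sum_j (\int[mu]_z (KD T j (q, z) * g z)) ^+ 2)%:E
     <= (C * (a + b) * G)%:E)%E.
Proof.
have [CD [CD0 HD]] := @potD R n.
have [C1 [C10 H1]] := @potG R n.
have [C2 [C20 H2]] := @potG2 R n.
exists (2 * (C1 + C2)); split; first by rewrite mulr_ge0// addr_ge0.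
move=> w a b mw w0 a0 b0 wa wb T g G T0 mg gw gG.
have ab0 : 0 <= a + b by rewrite addr_ge0.
have mK j : measurable_fun setT (KD T j) := measf_KD T j.
have mk := measf_kpot T.
have Kw j (q : Rn * R) (h : Rn * R -> R) : measurable_fun setT h ->
    (forall z, `|h z| <= w z) -> 0 < q.2 ->
    (\int[mu]_z `|KD T j (q, z) * h z|%:E <= (CD * (Num.sqrt q.2)^-1 * (a + b))%:E)%E.
  move=> mh hw q0; apply: le_trans (HD w a b mw w0 a0 b0 wa wb j q.1 q.2 q0).
  apply: ge0_le_integralT => //; [by meas|by meas|].
  move=> z; rewrite /KD /=; case: (slab q.2 z) => /=; last by rewrite mul0r normr0.
  rewrite normrM; case: ifP => _; first by rewrite ler_wpM2l.
  by rewrite normr0 mul0r mulr_ge0.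
have K0 j (q : Rn * R) z : q.2 <= 0 -> KD T j (q, z) = 0.
  move=> q0; rewrite /KD /slab /= ; case: ifP => // /andP[/andP[h1 h2] _].
  by have := lt_trans h1 h2; rewrite ltNge q0.
have IK j (q : Rn * R) (h : Rn * R -> R) : measurable_fun setT h ->
    (forall z, `|h z| <= w z) ->
    mu.-integrable setT (fun z => (KD T j (q, z) * h z)%:E).
  move=> mh hw; apply: normP_integrable; first by meas.
  have [q0|q0] := ltP 0 q.2; first exact: le_lt_trans (Kw j q h mh hw q0) (ltry _).
  by rewrite integral0_eq// => z _; rewrite K0// mul0r normr0.
(* Sources before time dl are removed to make the double integral absolutely convergent; the final
   bound does not depend on dl. *)
pose gd (dl : R) (z : Rn * R) : R := if (dl < z.2) && (z.2 < T) then g z else 0.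
have mgd dl : measurable_fun setT (gd dl) by rewrite /gd; meas.
have gdw dl z : `|gd dl z| <= w z by rewrite /gd; case: ifP => // _; rewrite normr0.
have gdG dl : 0 < dl -> (\int[mu]_z `|gd dl z|%:E <= G%:E)%E.
  move=> dl0; apply: le_trans gG; apply: ge0_le_integralT; [by meas|by meas|by []|].
  move=> z; rewrite /gd /slab; case: ifPn => [/andP[h1 ->]|_]; last by rewrite normr0; case: ifP.
  by rewrite (lt_trans dl0 h1).
have gdS dl z : 0 < dl -> gd dl z != 0 -> slab T z.
  rewrite /gd /slab => dl0; case: ifP; last by rewrite eqxx.
  by move=> /andP[h1 ->] _; rewrite (lt_trans dl0 h1).
(* [kpot] vanishes unless its first point is the later one; the symmetric sum covers both orders and
   accounts for the factor 2 in the constant. *)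
pose kk p := kpot T p + kpot T (p.2, p.1).
have mkk : measurable_fun setT kk by rewrite /kk; meas.
have kk0 p : 0 <= kk p by rewrite addr_ge0// kpot_ge0.
have kint z (h : Rn * R -> R) : measurable_fun setT h ->
    (forall z, `|h z| <= w z) -> slab T z ->
    (\int[mu]_z' (`|h z'| * kpot T (z, z'))%:E <= ((C1 + C2) * (a + b))%:E)%E.
  move=> mh hw /andP[z0 zT].
  have k1 := H1 w a b mw w0 a0 b0 wa wb z.1 z.2 z0.
  have k2 := H2 w a b mw w0 a0 b0 wa wb z.1 z.2 T z0 (ltW zT).
  rewrite mulrDl EFinD; apply: le_trans (leeD k1 k2).
  rewrite -ge0_integralDT.
  - apply: ge0_le_integralT; [by meas|by meas| |].
    + by move=> z'; rewrite mulr_ge0// kpot_ge0.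
    + move=> z'; rewrite /kpot /=; case: ifP => _; last by rewrite mulr0 addr0.
      by rewrite -mulrDl mulrC ler_wpM2l// addr_ge0 ?Gam_ge0.
  - by meas.
  - by meas.
  - by move=> z'; case: ifP => // _; rewrite mulr_ge0 ?Gam_ge0.
  - by move=> z'; case: ifP => // _; rewrite mulr_ge0 ?Gam_ge0.
have main dl : 0 < dl ->
    (\int[mu]_q (\sum_j (\int[mu]_z (KD T j (q, z) * gd dl z)) ^+ 2)%:E
     <= (2 * (C1 + C2) * (a + b) * G)%:E)%E.
  move=> dl0.
  have G0 : 0 <= G.
    by rewrite -lee_fin; apply: le_trans (gdG _ dl0); apply: integral_ge0.
  apply: (le_trans (@energy_expansion R _ _ _ _ mu mu _ (KD T) (gd dl) kk mK (mgd dl) mkk kk0 _ _ _)).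
  - by move=> j q; apply: IK => //.
  - move=> j; pose M := CD * (Num.sqrt dl)^-1 * (a + b).
    have M0 : 0 <= M by rewrite !mulr_ge0// invr_ge0 sqrtr_ge0.
    pose H q := (\int[mu]_z `|KD T j (q, z) * gd dl z|%:E)%E.
    have H0 q : (0 <= H q)%E by apply: integral_ge0.
    (* The cutoff pays here: targets before dl see no source, and later ones have (Num.sqrt q.2)^-1
       at most the value at dl. *)
    have HM q : (H q <= M%:E)%E.
      have [qd|dq] := leP q.2 dl.
        rewrite /H integral0_eq ?lee_fin// => z _.
        rewrite /KD /gd /slab /=; case: ifP => [/andP[/andP[_ h] _]|_]; last by rewrite mul0r normr0.
        by rewrite ltNge (le_trans (ltW h) qd) mulr0 normr0.
      have q0 : 0 < q.2 by exact: lt_trans dq.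
      apply: (le_trans (Kw j q _ (mgd dl) (gdw dl) q0)).
      rewrite lee_fin /M ler_wpM2r// ler_wpM2l// lef_pV2 ?posrE ?sqrtr_gt0//.
      by rewrite ler_sqrt ltW.
    have mq : measurable_fun setT (fun p : (Rn * R) * (Rn * R) => `|KD T j p * gd dl p.2|).
      by meas.
    have mH : measurable_fun setT H.
      rewrite /H.
      apply: (@measf_int1 R _ _ _ _ mu (fun p : (Rn * R) * (Rn * R) => `|KD T j p * gd dl p.2|) mq) => //.
    apply: (@le_lt_trans _ _ (\int[mu]_q (M%:E * H q))%E).
      apply: ge0_le_integral => //.
      - by move=> q _; exact: mule_ge0 (H0 q) (H0 q).
      - exact: measf_eM.
      - by apply: measf_eM => //; exact: measf_cst.
      - by move=> q _; exact: (lee_wpmul2r (H0 q) (HM q)).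
    rewrite ge0_integralZl//.
    apply: lte_mul_pinfty => //; rewrite ?lee_fin//.
    rewrite /H (@ge0_fubini R _ _ _ _ mu mu (fun p => `|KD T j p * gd dl p.2|) mq)//.
    pose c := @c2 R n.+1 * (2 * Num.sqrt T).
    apply: (@le_lt_trans _ _ (c%:E * G%:E)%E); last by rewrite -EFinM ltry.
    apply: (@le_trans _ _ (\int[mu]_z (c * `|gd dl z|)%:E)%E); last first.
      rewrite ge0_integralZlT//; last 2 first.
      - by meas.
      - by rewrite /c !mulr_ge0 ?c2_ge0 ?sqrtr_ge0.
      apply: lee_wpmul2l; last exact: gdG.
      by rewrite lee_fin /c !mulr_ge0 ?c2_ge0 ?sqrtr_ge0.
    apply: ge0_le_integral => //.
    + by move=> z _; apply: integral_ge0.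
    + by apply: (@measf_int2 R _ _ _ _ mu (fun p : (Rn * R) * (Rn * R) => `|KD T j p * gd dl p.2|) mq).
    + by meas.
    + move=> z _ /=; under eq_integral do rewrite normrM mulrC.
      rewrite ge0_integralZlT//; last by meas.
      by rewrite muleC EFinM; apply: lee_wpmul2r => //; exact: KD_mass.
  - apply: aeS same_time_null => -[z z'] /= zz'; rewrite mulf_eq0 negb_or => /andP[gz gz'] Iq.
    have Sz := gdS _ _ dl0 gz; have Sz' := gdS _ _ dl0 gz'.
    rewrite /kk /=; case/orP: (lt_total zz') => lzz.
    + rewrite (_ : (fun q => _) = (fun q => (\sum_j KD T j (q, z') * KD T j (q, z))%:E)) in Iq *; last first.
        by apply/funext => q; congr _%:E; apply: eq_bigr => j _; rewrite mulrC.
      apply: (le_trans (KD_cross Sz' Sz lzz Iq)).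
      by rewrite lee_fin lerDr kpot_ge0.
    + apply: (le_trans (KD_cross Sz Sz' lzz Iq)).
      by rewrite lee_fin lerDl kpot_ge0.
  pose f1 (p : (Rn * R) * (Rn * R)) := `|gd dl p.1| * `|gd dl p.2| * kpot T p.
  pose f2 (p : (Rn * R) * (Rn * R)) := `|gd dl p.1| * `|gd dl p.2| * kpot T (p.2, p.1).
  have mf1 : measurable_fun setT f1 by rewrite /f1; meas.
  have mf2 : measurable_fun setT f2 by rewrite /f2; meas.
  have f10 p : 0 <= f1 p by rewrite /f1 mulr_ge0 ?kpot_ge0// mulr_ge0.
  have f20 p : 0 <= f2 p by rewrite /f2 mulr_ge0 ?kpot_ge0// mulr_ge0.
  rewrite (_ : (fun p => _) = (fun p => (f1 p + f2 p)%:E)); last first.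
    by apply/funext => p; rewrite /f1 /f2 /kk mulrDr.
  rewrite ge0_integralDT//.
  have Cab0 : 0 <= (C1 + C2) * (a + b) by rewrite mulr_ge0// addr_ge0.
  have half z : (\int[mu]_z' (`|gd dl z| * (`|gd dl z'| * kpot T (z, z')))%:E <=
      ((C1 + C2) * (a + b) * `|gd dl z|)%:E)%E.
    have [->|gz] := eqVneq (gd dl z) 0.
      by rewrite normr0 mulr0 integral0_eq// => z' _; rewrite mul0r.
    rewrite ge0_integralZlT//; last 2 first.
    - by meas.
    - by move=> z'; rewrite mulr_ge0// kpot_ge0.
    rewrite mulrC EFinM; apply: lee_wpmul2l => //.
    by apply: kint => //; exact: gdS gz.
  have mhalf : measurable_fun setT (fun z => ((C1 + C2) * (a + b) * `|gd dl z|)%:E) by meas.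
  have ifin : (\int[mu]_z ((C1 + C2) * (a + b) * `|gd dl z|)%:E <= ((C1 + C2) * (a + b) * G)%:E)%E.
    rewrite ge0_integralZlT//; last by meas.
    rewrite [X in (_ <= X)%E]EFinM; apply: lee_wpmul2l => //; exact: gdG.
  rewrite (_ : 2 * (C1 + C2) * (a + b) * G = (C1 + C2) * (a + b) * G + (C1 + C2) * (a + b) * G); last by ring.
  rewrite EFinD; apply: leeD; apply: le_trans ifin.
  - rewrite pm_fubini1//; apply: ge0_le_integral => //.
    + by move=> z _; apply: integral_ge0 => z' _; rewrite lee_fin.
    + exact: measf_int1.
    + by move=> z _; rewrite /f1 /=; under eq_integral do rewrite -mulrA; exact: half.
  - rewrite pm_fubini2//; apply: ge0_le_integral => //.
    + by move=> z _; apply: integral_ge0 => z' _; rewrite lee_fin.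
    + exact: measf_int2.
    + by move=> z _; rewrite /f2 /=; under eq_integral do rewrite [`|_| * `|_|]mulrC -mulrA; exact: half.
have mKgd j dl : measurable_fun setT (fun p : (Rn * R) * (Rn * R) => KD T j p * gd dl p.2).
  by meas.
have mint j dl : measurable_fun setT (fun q => \int[mu]_z (KD T j (q, z) * gd dl z)).
  exact: (@measf_Rint1 R _ _ _ _ mu _ (mKgd j dl)).
pose fk k q : R := \sum_j (\int[mu]_z (KD T j (q, z) * gd (k.+1%:R^-1) z)) ^+ 2.
have mfk k : measurable_fun setT (fk k).
  rewrite /fk; apply: measf_sum => j; apply: measfX; exact: mint.
apply: (@fatou_le R _ _ mu fk).
- exact: mfk.
- by move=> k q; rewrite /fk sumr_ge0// => j _; rewrite sqr_ge0.
(* For a fixed target the cutoff is removed by dominated convergence, since the integrand is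
   eventually constant in k at each source; Fatou then serves for the integral over targets. *)
- move=> q; rewrite /fk; apply: cvg_sumr => j.
  suff h : (fun k => \int[mu]_z (KD T j (q, z) * gd (k.+1%:R^-1) z)) @ \oo -->
      \int[mu]_z (KD T j (q, z) * g z) by exact: (cvgM h h).
  have mg' : measurable_fun setT (fun z => `|KD T j (q, z) * g z|) by meas.
  apply: (@Rdominated _ _ mu _ _ (fun z => `|KD T j (q, z) * g z|) _ _ _ _).2.
  + by move=> k; meas.
  + move=> z; apply: cvg_near_cst.
    have [z0|z0] := ltP 0 z.2; last first.
      apply: nearW => k; rewrite /KD /slab /= ifF ?mul0r//.
      by apply/negbTE; rewrite -!andbA; apply/negP => /andP[]; rewrite ltNge z0.
    have [zT|zT] := ltP z.2 T; last first.
      apply: nearW => k; rewrite /KD /slab /= ifF ?mul0r//.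
      apply/negbTE/negP => /andP[/andP[_ h1] h2].
      by have := lt_trans h1 h2; rewrite ltNge zT.
    have [K _ HK] := near_infty_natSinv_lt (PosNum z0).
    by exists K => // k /= Kk; rewrite /gd (HK k Kk) zT.
  + apply: normP_integrable => //; under eq_integral do rewrite normr_id.
    by apply/(integrable_normP mu); [by meas|apply: IK].
  + move=> k z; rewrite /gd; case: ifP => // _.
    by rewrite mulr0 normr0.
- by move=> k; apply: main; rewrite invr_gt0.
Qed.

End near_energy.

(** * Gradient potentials *)

Lemma sqr_sum_le {R : realType} (I : finType) (v : I -> R) :
  (\sum_i v i) ^+ 2 <= #|I|%:R * \sum_i v i ^+ 2.
Proof.
have cst (c : R) : \sum_(i : I) c = #|I|%:R * c by rewrite sumr_const mulr_natl.
have : 0 <= \sum_i \sum_j (v i - v j) ^+ 2.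
  by apply: sumr_ge0 => i _; apply: sumr_ge0 => j _; rewrite sqr_ge0.
rewrite (_ : \sum_i _ = 2 * (#|I|%:R * \sum_i v i ^+ 2) - 2 * (\sum_i v i) ^+ 2).
  by move=> h; lra.
rewrite (eq_bigr (fun i => #|I|%:R * v i ^+ 2 + \sum_j v j ^+ 2 - 2 * (\sum_j v j) * v i)); last first.
  move=> i _; rewrite (eq_bigr (fun j => v i ^+ 2 + v j ^+ 2 - 2 * v i * v j)); last first.
    by move=> j _; ring.
  by rewrite sumrB big_split/= cst -mulr_sumr; ring.
by rewrite sumrB big_split/= cst -!mulr_sumr; ring.
Qed.

Section duhamel_bounds.
Context {R : realType} {n : nat}.
Local Notation Rn := 'rV[R]_n.+1.
Local Notation leb := (@lebesgue_measure R).
Local Notation lebn := (@lebesgue_rV R n.+1).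
Local Notation mu := (@stm R n.+1).

Definition DK (j : 'I_n.+1) (q z : Rn * R) : R :=
  if slab q.2 z then DGam j (q.2 - z.2) (q.1 - z.1) else 0.

Definition Sop (g : 'I_n.+1 -> Rn * R -> R) (q : Rn * R) : R :=
  \sum_i \int[mu]_z (DK i q z * g i z).

Lemma measf_DK d (S : measurableType d) j (f h : S -> Rn * R) :
  measurable_fun setT f -> measurable_fun setT h ->
  measurable_fun setT (fun v => DK j (f v) (h v)).
Proof. by move=> mf mh; rewrite /DK; meas. Qed.

Lemma DK_int : exists C : R, 0 <= C /\
  forall (w : Rn * R -> R) (a b : R), measurable_fun setT w ->
  (forall z, 0 <= w z) -> 0 <= a -> 0 <= b -> supb w a -> tent w b ->
  forall j (q : Rn * R) (h : Rn * R -> R), measurable_fun setT h ->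
  (forall z, `|h z| <= w z) ->
  [/\ mu.-integrable setT (fun z => (DK j q z * h z)%:E) &
  `|\int[mu]_z (DK j q z * h z)| <= C * (Num.sqrt q.2)^-1 * (a + b)].
Proof.
have [C [C0 HC]] := @potD R n; exists C; split => //.
move=> w a b mw w0 a0 b0 wa wb j q h mh hw.
have mK : measurable_fun setT (fun z => DK j q z) by apply: measf_DK; meas.
have mKh : measurable_fun setT (fun z => DK j q z * h z) by meas.
have bnd : (\int[mu]_z `|DK j q z * h z|%:E <= (C * (Num.sqrt q.2)^-1 * (a + b))%:E)%E.
  have [q0|q0] := ltP 0 q.2; last first.
    rewrite integral0_eq.
      by rewrite lee_fin !mulr_ge0 ?addr_ge0 ?invr_ge0 ?sqrtr_ge0.
    move=> z _; rewrite /DK /slab; case: ifP => [/andP[h1 h2]|]; last by rewrite mul0r normr0.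
    by have := lt_trans h1 h2; rewrite ltNge q0.
  apply: le_trans (HC w a b mw w0 a0 b0 wa wb j q.1 q.2 q0).
  apply: ge0_le_integralT => //; [by meas|by meas|].
  move=> z; rewrite /DK; case: ifP => _; last by rewrite mul0r normr0.
  by rewrite normrM ler_wpM2l.
by have [Ih hb] := @Rintegral_bound R _ _ mu _ _ mKh bnd; split.
Qed.

(** On a cylinder of height T the source is split at distance 2 sqrt T from the centre. The near
    part is handled by [near_energy] with the mass of the four times taller cylinder; the far part
    is bounded pointwise by T^(-1/2) b, whose square is integrated over the cylinder. *)
Lemma Sop_bounds : exists C : R, 0 <= C /\
  forall (w : Rn * R -> R) (a b : R), measurable_fun setT w ->
  (forall z, 0 <= w z) -> 0 <= a -> 0 <= b -> supb w a -> tent w b ->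
  forall g : 'I_n.+1 -> Rn * R -> R, (forall i, measurable_fun setT (g i)) ->
  (forall i z, `|g i z| <= w z) ->
  [/\ measurable_fun setT (Sop g),
   (forall q, `|Sop g q| <= C * (Num.sqrt q.2)^-1 * (a + b)) &
   tent (fun q => Sop g q ^+ 2) (C * (a + b) ^+ 2)].
Proof.
have [CK [CK0 HK]] := DK_int.
have [CE [CE0 HE]] := @near_energy R n.
have [CF [CF0 HF]] := @DGam_far R n.+1.
have [CG [CG0 HG]] := @gauss_tent R n 4 ltac:(lra).
pose N : R := n.+1%:R.
have N0 : 0 <= N by rewrite /N.
have N1 : 1 <= N by rewrite /N ler1n.
(* The leading factors 2 come from (A + B)^2, the two N in the near term from Cauchy-Schwarz and
   from summing the energies, and the powers of 2 from [tpow] at 4 T and from the volume of the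
   ball. *)
pose C2 : R := 2 * (N * (N * (CE * 2 ^+ n.+1))) + 2 * (N * CF * CG) ^+ 2 * 2 ^+ n.+1.
have C20 : 0 <= C2 by rewrite addr_ge0 ?mulr_ge0 ?sqr_ge0// exprn_ge0.
exists (N * CK + C2); split; first by rewrite addr_ge0// mulr_ge0.
move=> w a b mw w0 a0 b0 wa wb g mg gw.
have ab0 : 0 <= a + b by rewrite addr_ge0.
have mDK i : measurable_fun setT (fun p : (Rn * R) * (Rn * R) => DK i p.1 p.2).
  by apply: measf_DK; meas.
have mDKg i (h : Rn * R -> R) : measurable_fun setT h ->
    measurable_fun setT (fun q => \int[mu]_z (DK i q z * h z)).
  move=> mh; apply: (@measf_Rint1 R _ _ _ _ mu (fun p => DK i p.1 p.2 * h p.2)).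
  by have mi := mDK i; meas.
have mS : measurable_fun setT (Sop g) by apply: measf_sum => i; exact: mDKg.
split => //.
  move=> q; rewrite /Sop; apply: (le_trans (ler_norm_sum _ _ _)).
  apply: (@le_trans _ _ (\sum_(i < n.+1) CK * (Num.sqrt q.2)^-1 * (a + b))).
    apply: ler_sum => i _.
    by have [_] := HK w a b mw w0 a0 b0 wa wb i q (g i) (mg i) (gw i).
  rewrite sumr_const card_ord -[_ *+ n.+1]mulr_natl -/N !mulrA ler_wpM2r//.
  by rewrite ler_wpM2r ?invr_ge0 ?sqrtr_ge0// lerDl.
move=> x0 T T0.
have sT0 : 0 < Num.sqrt T by rewrite sqrtr_gt0.
have T40 : 0 < 4 * T by rewrite mulr_gt0.
(* For q in the cylinder a far z satisfies 4 T <= 2 |z - q|^2 + 2 T, that is |z - q|^2 >= T, which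
   is what [DGam_far] requires. *)
pose nr (z : Rn * R) : bool := sqn (z.1 - x0) < 4 * T.
pose gn i z := if nr z then g i z else 0.
pose gf i z := if nr z then 0 else g i z.
have mnr : measurable_fun setT (nr : Rn * R -> bool) by rewrite /nr; meas.
have mgn i : measurable_fun setT (gn i) by have := mg i; rewrite /gn => h; meas.
have mgf i : measurable_fun setT (gf i) by have := mg i; rewrite /gf => h; meas.
have gnw i z : `|gn i z| <= w z by rewrite /gn; case: ifP => // _; rewrite normr0.
have gfw i z : `|gf i z| <= w z by rewrite /gf; case: ifP => // _; rewrite normr0.
have tp4 : @tpow R n (4 * T) = 2 ^+ n.+1 * @tpow R n T.
  rewrite !tpow_sqrt ?(ltW T0) ?(ltW T40)// -exprMn; congr (_ ^+ _).
  by rewrite sqrtrM// (_ : 4 = 2 ^+ 2) ?sqrtr_sqr ?ger0_norm// expr2 -natrM.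
pose G := b * @tpow R n (4 * T).
have gnG i : (\int[mu]_z (if slab T z then `|gn i z| else 0)%:E <= G%:E)%E.
  have := mgn i => mgni; apply: le_trans (wb x0 (4 * T) T40).
  apply: ge0_le_integralT; [by meas|by meas|by move=> z; case: ifP|].
  move=> z; rewrite /slab /cyl /gn /nr; case: ifP => [/andP[z0 zT]|_].
    rewrite z0 (lt_le_trans zT) ?ler_peMl ?ler1n ?(ltW T0)//=.
    by case: ifP => // _; rewrite normr0.
  by case: ifP.
have near i := HE w a b mw w0 a0 b0 wa wb T (gn i) G T0 (mgn i) (gnw i) (gnG i).
(* The energy identity holds for the trace, so each component of the source is estimated under the
   full gradient although only its own derivative occurs in [Sop]. *)
pose En i (q : Rn * R) : R := \sum_j (\int[mu]_z (KD T j (q, z) * gn i z)) ^+ 2.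
have mEn i : measurable_fun setT (En i).
  rewrite /En; apply: measf_sum => j; apply: measfX.
  have mq : measurable_fun setT (fun p : (Rn * R) * (Rn * R) => KD T j p * gn i p.2).
    by have mK := measf_KD T j; have mi := mgn i; meas.
  exact: (@measf_Rint1 R _ _ _ _ mu _ mq).
have En0 i q : 0 <= En i q by rewrite /En sumr_ge0// => j _; rewrite sqr_ge0.
pose F := N * CF * CG * (Num.sqrt T)^-1 * b.
have sumsq (I : finType) (v : I -> R) : (\sum_i v i) ^+ 2 <= #|I|%:R * \sum_i v i ^+ 2.
  exact: sqr_sum_le.
have ptw q : cyl x0 T q -> Sop g q ^+ 2 <= 2 * N * (\sum_i En i q) + 2 * F ^+ 2.
  move=> /andP[/andP[q0 qT] qx].
  have SE : Sop g q = \sum_i \int[mu]_z (DK i q z * gn i z) + \sum_i \int[mu]_z (DK i q z * gf i z).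
    rewrite /Sop -big_split; apply: eq_bigr => i _ /=.
    have [In _] := HK w a b mw w0 a0 b0 wa wb i q (gn i) (mgn i) (gnw i).
    have [If _] := HK w a b mw w0 a0 b0 wa wb i q (gf i) (mgf i) (gfw i).
    rewrite -RintegralD//; apply: eq_Rintegral => z _.
    by rewrite /gn /gf; case: ifP; rewrite mulr0 ?addr0 ?add0r.
  have far i : `|\int[mu]_z (DK i q z * gf i z)| <= CF * (Num.sqrt T)^-1 * (CG * b).
    have mDKi := mDK i; have mgi := mgf i.
    have mf : measurable_fun setT (fun z => DK i q z * gf i z).
      by apply: measfM => //; apply: measf_DK; meas.
    apply: (@Rintegral_bound R _ _ mu _ _ mf _).2.
    have cT : 0 <= CF * (Num.sqrt T)^-1 by rewrite mulr_ge0// invr_ge0 ltW.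
    have HGx := HG w b mw w0 wb q.1 T T0.
    rewrite EFinM; apply: le_trans (lee_wpmul2l _ HGx); last by rewrite lee_fin.
    rewrite -ge0_integralZlT//; last 2 first.
    - by meas.
    - by move=> z; case: ifP => // _; rewrite mulr_ge0 ?Gam_ge0.
    apply: ge0_le_integralT; [exact: measf_norm|by meas|by []|].
    move=> z; rewrite /DK; case: ifP => [/andP[z0 zq]|_]; last first.
      by rewrite mul0r normr0 mulr_ge0//; case: ifP => // _; rewrite mulr_ge0 ?Gam_ge0.
    rewrite /slab z0 (lt_trans zq qT) /= normrM mulrA.
    rewrite {1}/gf; case: ifP => [_|/negbT]; first by rewrite normr0 mulr0 mulr_ge0// mulr_ge0 ?Gam_ge0.
    rewrite /nr -leNgt => far.
    rewrite ler_pM// -powRh_sqrt ?(ltW T0)//; apply: HF.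
    + by rewrite subr_gt0.
    + by clear -z0 qT; lra.
    + have := sqnD (z.1 - q.1) (q.1 - x0).
      rewrite addrA subrK [sqn (q.1 - z.1)]sqnB => h; clear -h far qx.
      move: h far qx; set A := sqn _; set B := sqn _; set D := sqn _.
      by lra.
  have nearq : (\sum_i \int[mu]_z (DK i q z * gn i z)) ^+ 2 <= N * \sum_i En i q.
    apply: (le_trans (sumsq _ _)); rewrite card_ord ler_wpM2l//.
    apply: ler_sum => i _; rewrite /En (bigD1 i)//=.
    rewrite (_ : \int[mu]_z (DK i q z * gn i z) = \int[mu]_z (KD T i (q, z) * gn i z)).
      by rewrite lerDl sumr_ge0// => j _; rewrite sqr_ge0.
    by apply: eq_Rintegral => z _; rewrite /KD /DK /= qT andbT.
  have farq : (\sum_i \int[mu]_z (DK i q z * gf i z)) ^+ 2 <= F ^+ 2.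
    rewrite -[leLHS](real_normK (num_real _)) ler_pXn2r ?nnegrE//; last first.
      by rewrite /F !mulr_ge0// invr_ge0 ltW.
    apply: (le_trans (ler_norm_sum _ _ _)); apply: (le_trans (ler_sum _ (fun i _ => far i))).
    by rewrite sumr_const card_ord -[_ *+ n.+1]mulr_natl -/N /F le_eqVlt; apply/orP; left; apply/eqP; ring.
  rewrite SE; set A := \sum_i _ in nearq *; set B := \sum_i _ in farq *.
  apply: (@le_trans _ _ (2 * A ^+ 2 + 2 * B ^+ 2)).
    by have := sqr_ge0 (A - B); clear; nra.
  by clear -nearq farq; lra.
have F20 : 0 <= 2 * F ^+ 2 by rewrite mulr_ge0// sqr_ge0.
have TP0 : 0 <= @tpow R n T by apply: powR_ge0.
pose c1 (q : Rn * R) : R := if cyl x0 T q then 1 else 0.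
have mc1 : measurable_fun setT c1 by rewrite /c1; meas.
have vol : (\int[mu]_q (c1 q)%:E <= (T * (2 ^+ n.+1 * @tpow R n T))%:E)%E.
  rewrite stm_fubini2//; last by move=> z; rewrite /c1; case: ifP.
  have [_ bv] := @ball_vol R n x0 T T0.
  have sm := @slab_mass1 R T T0.
  pose h (s : R) : R := if (0 < s) && (s < T) then 1 else 0.
  have mh : measurable_fun setT h by rewrite /h; meas.
  apply: (@le_trans _ _ (\int[leb]_s (2 ^+ n.+1 * @tpow R n T * h s)%:E)%E); last first.
    rewrite ge0_integralZlT//.
    - rewrite [X in (_ <= X%:E)%E]mulrC [X in (_ <= X)%E]EFinM; apply: lee_wpmul2l => //.
      by rewrite lee_fin mulr_ge0// exprn_ge0.
    - by move=> s; rewrite /h; case: ifP.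
    - by rewrite mulr_ge0// exprn_ge0.
  apply: ge0_le_integral => //.
  - by move=> s _; apply: integral_ge0 => z _; rewrite lee_fin /c1; case: ifP.
  - by apply: (@measf_int2 R _ _ _ _ lebn c1) => // z; rewrite /c1; case: ifP.
  - by apply: measfE; meas.
  - move=> s _; rewrite /c1 /cyl /h /=; case: ((0 < s) && (s < T)) => /=.
      by rewrite mulr1.
    by rewrite mulr0 integral0.
apply: (@le_trans _ _ (\int[mu]_q (2 * N * (\sum_i En i q) + 2 * F ^+ 2 * c1 q)%:E)%E).
  have mSn : measurable_fun setT (fun q => \sum_i En i q) by apply: measf_sum.
  apply: ge0_le_integralT; [by meas|by meas| |].
  - by move=> z; case: ifP => // _; rewrite sqr_ge0.
  - move=> q; rewrite /c1; case: ifP => [qc|_]; first by rewrite mulr1 ptw.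
    by rewrite mulr0 addr0 mulr_ge0 ?mulr_ge0// sumr_ge0.
have mSn : measurable_fun setT (fun q => \sum_i En i q) by apply: measf_sum.
have Sn0 q : 0 <= \sum_i En i q by rewrite sumr_ge0.
rewrite ge0_integralDT; last 4 first.
- by meas.
- by meas.
- by move=> q; rewrite mulr_ge0// mulr_ge0.
- by move=> q; rewrite mulr_ge0// /c1; case: ifP.
rewrite (@ge0_integralZlT R _ _ mu (2 * N) _ mSn Sn0); last by rewrite mulr_ge0.
have c10 q : 0 <= c1 q by rewrite /c1; case: ifP.
rewrite (@ge0_integralZlT R _ _ mu (2 * F ^+ 2) _ mc1 c10)//.
have SnI : (\int[mu]_q (\sum_i En i q)%:E <= (N * (CE * (a + b) * G))%:E)%E.
  under eq_integral do rewrite -sumEFin.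
  rewrite ge0_integral_sum//; last 2 first.
  - by move=> i; apply: measfE; exact: mEn.
  - by move=> i q _; rewrite lee_fin.
  apply: (@le_trans _ _ (\sum_(i < n.+1) (CE * (a + b) * G)%:E)%E).
    by apply: lee_sum => i _; exact: near.
  by rewrite sumEFin lee_fin sumr_const card_ord -[_ *+ n.+1]mulr_natl.
apply: (le_trans (leeD (lee_wpmul2l _ SnI) (lee_wpmul2l _ vol))).
- by rewrite lee_fin mulr_ge0.
- by rewrite lee_fin.
rewrite -!EFinM -EFinD lee_fin /G tp4.
have TF : F ^+ 2 * T = (N * CF * CG) ^+ 2 * b ^+ 2.
  have e : (Num.sqrt T)^-1 ^+ 2 * T = 1 by rewrite exprVn sqr_sqrtr ?ltW// mulVf ?gt_eqF.
  by rewrite /F -[RHS]mulr1 -e; ring.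
rewrite [leLHS](_ : _ = (2 * (N * (N * (CE * 2 ^+ n.+1))) * ((a + b) * b) +
  2 * (F ^+ 2 * T) * 2 ^+ n.+1) * @tpow R n T); last by ring.
rewrite ler_wpM2r// TF.
have ab1 : (a + b) * b <= (a + b) ^+ 2 by rewrite expr2 ler_wpM2l// lerDr.
have ab2 : b ^+ 2 <= (a + b) ^+ 2 by rewrite ler_pXn2r ?nnegrE// lerDr.
rewrite [leRHS]mulrDl; apply: ler_wpDl.
  by rewrite mulr_ge0 ?mulr_ge0// exprn_ge0.
rewrite /C2 [leRHS]mulrDl lerD//.
  by rewrite ler_wpM2l// !mulr_ge0// exprn_ge0.
rewrite (_ : 2 * (_ * b ^+ 2) * _ = 2 * (N * CF * CG) ^+ 2 * 2 ^+ n.+1 * b ^+ 2); last by ring.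
by rewrite ler_wpM2l// !mulr_ge0 ?sqr_ge0// exprn_ge0.
Qed.

End duhamel_bounds.

(** * The Neumann kernel *)

Section null_sets.
Context {R : realType} d (T : measurableType d) (m : {measure set T -> \bar R}).
Import HBNNSimple.

(** The integral is a supremum over simple functions below f; multiplying one by the indicator of
    the complement of the null set keeps its integral and puts it below g. No measurability enters,
    which suits expressions built from an arbitrary functional or from formal derivatives. *)
Lemma ge0_integral_ae_le (f g : T -> \bar R) :
  (forall x, 0 <= f x)%E -> (forall x, 0 <= g x)%E ->
  {ae m, forall x, f x = g x} -> (\int[m]_x f x <= \int[m]_x g x)%E.
Proof.
move=> f0 g0 [N [mN N0 Nfg]].
rewrite !ge0_integralTE//; apply: ge_ereal_sup => _ [h hf <-].
pose h' : {nnsfun T >-> R} := proj_nnsfun h (measurableC mN).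
have h'E x : h' x = if x \in N then 0 else h x.
  rewrite /h' /= mindicE in_setC; case: (x \in N); first by rewrite mulr0.
  by rewrite mulr1.
have -> : sintegral m h = sintegral m h'.
  rewrite -!integralT_nnsfun; apply: ae_eq_integral => //.
  - exact: measfE.
  - exact: measfE.
  - exists N; split => // x /= /not_implyP[_ hh]; apply: contrapT => xN; apply: hh.
    by rewrite -[(h' x)%:E]/((h' x)%:E) (_ : h' x = h x)// h'E memNset.
apply: ereal_sup_ubound; exists h' => // x; rewrite h'E; case: ifPn => // xN.
rewrite (_ : g x = f x)//; apply/esym; apply: contrapT => fg.
by move: xN; rewrite notin_setE; apply; exact: Nfg.
Qed.

Lemma integral_ae (f g : T -> \bar R) :
  {ae m, forall x, f x = g x} -> (\int[m]_x f x = \int[m]_x g x)%E.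
Proof.
move=> fg; rewrite integralE [RHS]integralE.
have pe (h : T -> \bar R) : (forall x, 0 <= h^\+ x)%E by [].
have ne (h : T -> \bar R) : (forall x, 0 <= h^\- x)%E by [].
congr (_ - _)%E; apply/eqP; rewrite eq_le; apply/andP; split;
  apply: ge0_integral_ae_le => //; apply: aeS fg => x e;
  by rewrite ?funeposE ?funenegE e.
Qed.

Lemma Rintegral_ae (f g : T -> R) :
  {ae m, forall x, f x = g x} -> \int[m]_x f x = \int[m]_x g x.
Proof.
by move=> fg; congr fine; apply: integral_ae; apply: aeS fg => x ->.
Qed.

(** True even for divergent integrals: exchanging the positive and negative parts leaves an infinite
    value infinite, and [fine] sends it to 0. *)
Lemma RintegralNT (f : T -> R) : \int[m]_x (- f x) = - \int[m]_x f x.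
Proof.
rewrite /Rintegral (_ : (fun x => (- f x)%:E) = (\- (fun x => (f x)%:E))%E)//.
rewrite integralE funeposN funenegN [in RHS]integralE.
by case: (\int[m]_x _)%E => [r| |]; case: (\int[m]_x _)%E => [q| |] //=;
  rewrite ?oppr0// opprB.
Qed.

End null_sets.

Lemma pm_Rint21 {R : realType} d1 d2 (X : measurableType d1) (Z : measurableType d2)
    (mX : {sigma_finite_measure set X -> \bar R})
    (mZ : {sigma_finite_measure set Z -> \bar R}) (f : X * Z -> R) :
  (pm mX mZ).-integrable setT (EFin \o f) ->
  \int[mZ]_s (\int[mX]_x f (x, s)) = \int[pm mX mZ]_p f p.
Proof.
move=> If; rewrite {3}/Rintegral -(pm_int21 If); congr fine; apply: integral_ae.
apply: aeS (pm_aeint2 If) => s Is.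
exact: Rintegral_EFin.
Qed.

Section neumann_derivative.
Context {R : realType} {n : nat}.
Local Notation Rn := 'rV[R]_n.+1.
Local Notation leb := (@lebesgue_measure R).
Local Notation lebn := (@lebesgue_rV R n.+1).
Local Notation mu := (@stm R n.+1).
Implicit Types (x y : Rn).

Definition xn x : R := x ord0 ord_max.

Definition refl x : Rn := flip (fun i => i == ord_max) x.

Lemma refl_max x : xn (refl x) = - xn x.
Proof. by rewrite /xn /refl mxE eqxx expr1 mulN1r. Qed.

Lemma refl_other x i : i != ord_max -> refl x ord0 i = x ord0 i.
Proof. by move=> /negPf im; rewrite /refl mxE im expr0 mul1r. Qed.

(** A product function detects the hyperplane: the indicator of 0 in the last coordinate and
    Gaussians in the others, so that every factor has a finite integral, one of them is 0, and the
    product is positive on the hyperplane. *)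
Lemma hyper_ae : {ae lebn, forall x, xn x != 0}.
Proof.
pose f (i : 'I_n.+1) (a : R) : R :=
  if i == ord_max then (if a <= 0 then if 0 <= a then 1 else 0 else 0) else gam 1 a.
pose F x := \prod_i f i (x ord0 i).
have mf i : measurable_fun setT (f i).
  by rewrite /f; case: (i == ord_max); meas; apply: measf_gam; meas.
have f0 i a : 0 <= f i a.
  by rewrite /f; case: ifP => _; [do 2! case: ifP => //|exact: gam_ge0].
have mF : measurable_fun setT F by apply: measf_prod => i; exact: (measurableT_comp (mf i) (measurable_rV_coord i)).
have F0 x : 0 <= F x by rewrite /F prodr_ge0.
have IF : (\int[lebn]_x `|(F x)%:E| = 0)%E.
  transitivity (\int[lebn]_x (F x)%:E)%E.
    by apply: eq_integral => x _; rewrite abse_EFin ger0_norm.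
  rewrite (@ge0_integral_prod_rV R n.+1 f (fun i => if i == ord_max then 0 else 1))//.
    by rewrite (bigD1 ord_max)//= eqxx mul0r.
  move=> i; rewrite /f; case: ifP => _; last first.
    by rewrite -(integral_gam' 0 (@ltr01 R)); apply: eq_integral => a _; rewrite subr0.
  rewrite (_ : (fun a => _) = (fun a => (\1_[set (0:R)] a)%:E)).
    rewrite (@integral_indic _ _ R leb setT measurableT [set (0:R)] (measurable_set1 _)).
    by rewrite setIT; exact: lebesgue_measure_set1.
  apply/funext => a; rewrite indicE; congr _%:E.
  have [->|a0] := eqVneq a 0; first by rewrite lexx mem_set.
  rewrite memNset; last by move=> /= h; move: a0; rewrite h eqxx.
  by case: ifPn => // h1; case: ifPn => // h2; move: a0; rewrite eq_le h1 h2.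
move: IF => /(ae_eq_integral_abs lebn measurableT (measfE mF)).
apply: aeS => x /(_ I) /= [] Fx; apply/negP => /eqP x0.
have : 0 < F x.
  apply: prodr_gt0 => i _; rewrite /f; case: ifP => [/eqP ->|_]; last exact: gam_gt0.
  by rewrite [x _ _]x0 lexx.
by rewrite Fx ltxx.
Qed.

Lemma partial_is i (phi : Rn -> R) x (c : R) :
  is_derive (0 : R) 1 (fun h : R => phi (h *: delta_mx ord0 i + x)) c ->
  derivable phi x (delta_mx ord0 i) /\ partial i phi x = c.
Proof.
move=> [dphi cphi].
have e : (fun h : R => h^-1 *: (phi (h *: delta_mx ord0 i + x) - phi x)) =
   (fun h : R => h^-1 *: ((fun h => phi (h *: delta_mx ord0 i + x)) (h *: 1 + 0)
       - (fun h => phi (h *: delta_mx ord0 i + x)) 0)).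
  by apply/funext => h; rewrite /= addr0 scale0r add0r [h *: 1]mulr1.
split; first by move: dphi; rewrite /derivable /= -e.
rewrite -cphi /partial.
transitivity (lim ((fun h : R => h^-1 *: (phi (h *: delta_mx ord0 i + x) - phi x)) @ 0^')).
  by [].
by rewrite e.
Qed.

Lemma partial_prod (A : 'I_n.+1 -> R -> R) i x (c : R) :
  is_derive (x ord0 i) 1 (A i) c ->
  partial i (fun y => \prod_j A j (y ord0 j)) x =
    \prod_j (if j == i then c else A j (x ord0 j)).
Proof.
move=> dA.
have e : (fun h : R => \prod_j A j ((h *: delta_mx ord0 i + x) ord0 j)) =
    (fun h : R => A i (h + x ord0 i) * \prod_(j | j != i) A j (x ord0 j)).
  apply/funext => h; rewrite (bigD1 i)//= !mxE !eqxx mulr1; congr (_ * _).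
  by apply: eq_bigr => j ji; rewrite !mxE eqxx (negPf ji) mulr0 add0r.
have d0 : is_derive (0 : R) 1 (fun h : R => h + x ord0 i) 1.
  by apply: isd_eq (isdD (isd_id 0) (isd_cst 0 (x ord0 i))) _; rewrite addr0.
have dA' : is_derive (0 + x ord0 i) 1 (A i) c by rewrite add0r.
have d1 := isdM (isd_comp (g := fun h => h + x ord0 i) dA' d0)
   (isd_cst 0 (\prod_(j | j != i) A j (x ord0 j))).
have d2 := isd_eq d1 (erefl _).
have [_ ->] := partial_is (i := i) (phi := fun y => \prod_j A j (y ord0 j)) (x := x)
   (eq_ind_r (fun F => is_derive (0 : R) 1 F _) d2 e).
rewrite mulr1 mulr0 addr0 [RHS](bigD1 i)//= eqxx; congr (_ * _).
by apply: eq_bigr => j /negPf ->.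
Qed.

(** The Neumann kernel is a tensor product; reflection and jump sit in the last factor alone, so
    partial derivatives reduce to one variable. *)
Definition kfac t x (j : 'I_n.+1) (a : R) : R :=
  if j == ord_max then (gam t (xn x - a) + gam t (xn x + a)) * heaviside (xn x * a)
  else gam t (x ord0 j - a).

Lemma prod_max (F : 'I_n.+1 -> R) :
  \prod_j F j = F ord_max * \prod_(j | j != ord_max) F j.
Proof. exact: bigD1. Qed.

Lemma neumann_kernelE (t : R) x : 0 < t ->
  neumann_kernel t x = fun y => \prod_j kfac t x j (y ord0 j).
Proof.
move=> t0; apply/funext => y; rewrite [RHS]prod_max {1}/kfac eqxx /neumann_kernel -/(xn x) -/(xn y).
rewrite [in RHS](eq_bigr (fun j => (4 * pi * t) `^ (- 2^-1) *
   expR (- (x ord0 j - y ord0 j) ^+ 2 / (4 * t)))); last first.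
  by move=> j /negPf jm; rewrite /kfac jm /gam.
rewrite big_split/= -expR_sum (_ : \sum_(i | i != ord_max) _ / _ =
    - (\sum_(i | i != ord_max) (x ord0 i - y ord0 i) ^+ 2) / (4 * t)); last first.
  by rewrite -sumrN mulr_suml.
rewrite /gam (_ : (4 * pi * t) `^ (- (n.+1%:R / 2)) = (4 * pi * t) `^ (- 2^-1) *
   \prod_(i < n.+1 | i != ord_max) (4 * pi * t) `^ (- 2^-1)); last first.
  transitivity (\prod_(i < n.+1) (4 * pi * t) `^ (- 2^-1)).
    rewrite prodr_const card_ord -powR_mulrn ?powR_ge0// -powRrM; congr powR; ring.
  by rewrite prod_max.
by ring.
Qed.

Lemma isd_kfac_max (t : R) x (a : R) : t != 0 -> xn x * a != 0 ->
  is_derive a 1 (kfac t x ord_max)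
    ((- dgam 1 t (xn x - a) + dgam 1 t (xn x + a)) * heaviside (xn x * a)).
Proof.
move=> t0 xa.
have dg (z : R) : is_derive z 1 (gam t) (dgam 1 t z).
  by apply: (isd_eq (isd_gam z t0)); rewrite dgam1.
have d1 := isd_comp (g := fun a => xn x - a) (dg (xn x - a)) (isdB (isd_cst a (xn x)) (isd_id a)).
have d2 := isd_comp (g := fun a => xn x + a) (dg (xn x + a)) (isdD (isd_cst a (xn x)) (isd_id a)).
have d3 := isdM (isdD d1 d2) (isd_cst a (heaviside (xn x * a))).
apply: (isd_eq (a := (dgam 1 t (xn x - a) * (0 - 1) + dgam 1 t (xn x + a) * (0 + 1)) *
  heaviside (xn x * a) + (gam t (xn x - a) + gam t (xn x + a)) * 0)); last by ring.
apply: near_eq_is_derive d3.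
have : \forall b \near a, heaviside (xn x * b) = heaviside (xn x * a).
  have cb : {for a, continuous (fun b : R => xn x * b)} by apply: mulrl_continuous.
  rewrite /heaviside; case: ltP => [xa0|xa0].
    by near=> b; rewrite ifT//; near: b; exact: (cvgr_lt _ cb).
  have {}xa0 : 0 < xn x * a by rewrite lt_neqAle eq_sym xa.
  by near=> b; rewrite ifF//; apply/negbTE; rewrite -leNgt; near: b; exact: (cvgr_ge _ cb).
by apply: filterS => b hb; rewrite /kfac eqxx hb.
Unshelve. all: by end_near.
Qed.

(** Method of images: on the side of x the kernel is the sum of Gauss kernels at x - y and at refl x
    - y. A derivative in y gives both the same sign, also in the normal direction, so the potentials
    at x and at its mirror image are simply added. *)
Lemma partial_neumann i (t : R) x y : 0 < t -> xn x * xn y != 0 ->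
  partial i (neumann_kernel t x) y =
  - (DGam i t (x - y) + DGam i t (refl x - y)) * heaviside (xn x * xn y).
Proof.
move=> t0 xy; have tn0 : t != 0 by rewrite gt_eqF.
rewrite neumann_kernelE// !DGam_prod !prod_max.
rewrite (_ : (x - y) ord0 ord_max = xn x - xn y); last by rewrite !mxE.
rewrite (_ : (refl x - y) ord0 ord_max = - (xn x + xn y)); last first.
  by rewrite !mxE eqxx expr1 /xn; ring.
pose Q := \prod_(j | j != ord_max) dgam (j == i) t (x ord0 j - y ord0 j).
rewrite [X in - (_ * X + _)](_ : _ = Q); last first.
  by apply: eq_bigr => j _; rewrite !mxE.
rewrite [X in - (_ + _ * X)](_ : _ = Q); last first.
  by apply: eq_bigr => j jm; rewrite mxE refl_other// mxE.
have [im|im] := eqVneq i ord_max.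
  subst i.
  rewrite (partial_prod (isd_kfac_max tn0 xy)) prod_max eqxx -/(xn y) dgamN expr1 mulN1r.
  rewrite (_ : \prod_(j | j != ord_max) _ = Q); last first.
    by apply: eq_bigr => j /negPf jm; rewrite jm /kfac jm dgam0.
  by ring.
have dA : is_derive (y ord0 i) 1 (kfac t x i) (- dgam 1 t (x ord0 i - y ord0 i)).
  have -> : kfac t x i = (fun a => gam t (x ord0 i - a)).
    by apply/funext => a; rewrite /kfac (negPf im).
  apply: (isd_eq (isd_comp (g := fun a => x ord0 i - a) (isd_gam _ tn0)
     (isdB (isd_cst _ (x ord0 i)) (isd_id _)))).
  by rewrite dgam1; ring.
rewrite (partial_prod dA) prod_max eq_sym (negPf im) {1}/kfac eqxx -/(xn y) !dgam0 gamN.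
rewrite (_ : \prod_(j | j != ord_max) _ = - Q); last first.
  rewrite /Q (bigD1 i)//= eqxx [in RHS](bigD1 i)//= eqxx mulNr; congr (- (_ * _)).
  by apply: eq_bigr => j /andP[/negPf jm /negPf ji]; rewrite ji /kfac jm dgam0.
by ring.
Qed.

Lemma neumann_heat_divE (t : R) (al : Rn -> Rn) x : 0 < t -> xn x != 0 ->
  neumann_heat_div t al x =
  \int[lebn]_y \sum_i (DGam i t (x - y) + DGam i t (refl x - y)) *
    (heaviside (xn x * xn y) * al y ord0 i).
Proof.
move=> t0 x0; rewrite /neumann_heat_div -RintegralNT; apply: Rintegral_ae.
apply: aeS hyper_ae => y y0.
rewrite -sumrN; apply: eq_bigr => i _; rewrite partial_neumann ?mulf_neq0//; ring.
Qed.

End neumann_derivative.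

(** * The Duhamel operator *)

Section neumann_duhamel.
Context {R : realType} {n : nat}.
Local Notation Rn := 'rV[R]_n.+1.
Local Notation leb := (@lebesgue_measure R).
Local Notation lebn := (@lebesgue_rV R n.+1).
Local Notation mu := (@stm R n.+1).
Implicit Types (x y : Rn) (g h : 'I_n.+1 -> Rn * R -> R).

Definition side (b : bool) g : 'I_n.+1 -> Rn * R -> R := fun i z =>
  if (if b then 0 < xn z.1 else xn z.1 < 0) then g i z else 0.

Definition reflq (q : Rn * R) : Rn * R := (refl q.1, q.2).

(* Integrating [g] against the Neumann kernel over one half-space is applying
   [Sop] to its extension by zero at both [q] and the mirror image of [q]. *)
Definition Nop g (q : Rn * R) : R :=
  if 0 < xn q.1 then Sop (side true g) q + Sop (side true g) (reflq q)
  else if xn q.1 < 0 then Sop (side false g) q + Sop (side false g) (reflq q)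
  else 0.

Lemma measf_xn d (S : measurableType d) (f : S -> Rn) :
  measurable_fun setT f -> measurable_fun setT (fun z => xn (f z)).
Proof. by move=> mf; exact: measf_coord. Qed.

Lemma measf_refl d (S : measurableType d) (f : S -> Rn) :
  measurable_fun setT f -> measurable_fun setT (fun z => refl (f z)).
Proof. by move=> mf; exact: (measurableT_comp (measurable_flip _) mf). Qed.

Lemma measf_reflq d (S : measurableType d) (f : S -> Rn * R) :
  measurable_fun setT f -> measurable_fun setT (fun z => reflq (f z)).
Proof.
move=> mf; apply: measf_pair; last by meas.
by apply: measf_refl; meas.
Qed.

Lemma measf_side b g i : (forall i, measurable_fun setT (g i)) ->
  measurable_fun setT (side b g i).
Proof.
move=> mg; have mgi := mg i; rewrite /side.
have mx : measurable_fun setT (fun z : Rn * R => xn z.1) by apply: measf_xn; meas.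
by case: b; meas.
Qed.

Lemma side_le b g i z (w : R) : 0 <= w -> `|g i z| <= w -> `|side b g i z| <= w.
Proof. by move=> w0 gw; rewrite /side; case: ifP; rewrite ?normr0. Qed.

Lemma sqn_refl x y : sqn (refl x - refl y) = sqn (x - y).
Proof.
apply: eq_bigr => i _; rewrite !mxE -mulrBr exprMn -exprM mulnC exprM.
by rewrite sqrrN expr1n expr1n mul1r.
Qed.

Lemma ge0_integral_reflq (F : Rn * R -> R) : measurable_fun setT F ->
  (forall z, 0 <= F z) -> (\int[mu]_z (F (reflq z))%:E = \int[mu]_z (F z)%:E)%E.
Proof.
move=> mF F0.
have mFr : measurable_fun setT (fun z => F (reflq z)).
  by apply: (measurableT_comp mF); apply: measf_reflq; meas.
rewrite !stm_fubini2//; apply: eq_integral => s _.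
rewrite -[RHS](ge0_integral_flip (fun i => i == ord_max))//.
  by apply: measfE; meas.
by move=> y; rewrite lee_fin.
Qed.

Lemma tent_refl (F : Rn * R -> R) b : measurable_fun setT F ->
  (forall z, 0 <= F z) -> tent F b -> tent (fun z => F (reflq z)) b.
Proof.
move=> mF F0 tF x t t0; apply: le_trans (tF (refl x) t t0).
rewrite -[X in (_ <= X)%E]ge0_integral_reflq; last 2 first.
- by meas.
- by move=> z; case: ifP.
by rewrite /cyl /=; under [X in (_ <= X)%E]eq_integral do rewrite sqn_refl.
Qed.

(** Meant for the squares of [Sop] for the two half-spaces, at a point and at its mirror image. Only
    two are relevant at a given point; adding all four avoids splitting the integral along the
    hyperplane. *)
Lemma tent4 (F f1 f2 f3 f4 : Rn * R -> R) b :
  measurable_fun setT F -> measurable_fun setT f1 -> measurable_fun setT f2 ->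
  measurable_fun setT f3 -> measurable_fun setT f4 ->
  (forall q, 0 <= F q <= 2 * (f1 q + f2 q + (f3 q + f4 q))) ->
  tent f1 b -> tent f2 b -> tent f3 b -> tent f4 b ->
  (forall q, 0 <= f1 q) -> (forall q, 0 <= f2 q) ->
  (forall q, 0 <= f3 q) -> (forall q, 0 <= f4 q) -> tent F (8 * b).
Proof.
move=> mF mf1 mf2 mf3 mf4 FF t1 t2 t3 t4 f10 f20 f30 f40 x T T0.
pose c (f : Rn * R -> R) (q : Rn * R) := if cyl x T q then f q else 0.
have mc f : measurable_fun setT f -> measurable_fun setT (c f) by move=> mf; rewrite /c; meas.
have c0 f : (forall q, 0 <= f q) -> forall q, 0 <= c f q by move=> f0 q; rewrite /c; case: ifP.
have [F0 Fle] : (forall q, 0 <= F q) /\ (forall q, F q <= 2 * (f1 q + f2 q + (f3 q + f4 q))).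
  by split=> q; case/andP: (FF q).
have mcF := mc F mF; have cF0 := c0 F F0.
have cFle q : c F q <= 2 * (c f1 q + c f2 q + (c f3 q + c f4 q)).
  by rewrite /c; case: ifP => // _; rewrite !addr0 mulr0.
have {t1} t1 : (\int[mu]_q (c f1 q)%:E <= (b * @tpow R n T)%:E)%E by exact: (t1 x T T0).
have {t2} t2 : (\int[mu]_q (c f2 q)%:E <= (b * @tpow R n T)%:E)%E by exact: (t2 x T T0).
have {t3} t3 : (\int[mu]_q (c f3 q)%:E <= (b * @tpow R n T)%:E)%E by exact: (t3 x T T0).
have {t4} t4 : (\int[mu]_q (c f4 q)%:E <= (b * @tpow R n T)%:E)%E by exact: (t4 x T T0).
suff : (\int[mu]_q (c F q)%:E <= (8 * b * @tpow R n T)%:E)%E by [].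
move: (mc _ mf1) (mc _ mf2) (mc _ mf3) (mc _ mf4) (c0 _ f10) (c0 _ f20) (c0 _ f30) (c0 _ f40) t1 t2 t3 t4 mcF cF0 cFle.
move: (c F) (c f1) (c f2) (c f3) (c f4); clear.
move=> F f1 f2 f3 f4 m1 m2 m3 m4 p1 p2 p3 p4 t1 t2 t3 t4 mF F0 Fle.
have m12 : measurable_fun setT (fun q => f1 q + f2 q) by meas.
have m34 : measurable_fun setT (fun q => f3 q + f4 q) by meas.
have n12 q : 0 <= f1 q + f2 q by rewrite addr_ge0.
have n34 q : 0 <= f3 q + f4 q by rewrite addr_ge0.
apply: (@le_trans _ _ (\int[mu]_q (2 * (f1 q + f2 q + (f3 q + f4 q)))%:E)%E).
  by apply: ge0_le_integralT => //; meas.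
rewrite ge0_integralZlT//; [|by meas|by move=> q; rewrite addr_ge0].
rewrite !ge0_integralDT//.
have := leeD (leeD t1 t2) (leeD t3 t4).
move=> /(lee_wpmul2l (x := 2%:E)) H; apply: (le_trans (H _)); first by rewrite lee_fin.
by rewrite -!EFinD -EFinM lee_fin le_eqVlt; apply/orP; left; apply/eqP; ring.
Qed.

Lemma Nop_bounds : exists C : R, 0 <= C /\
  forall (w : Rn * R -> R) (a b : R), measurable_fun setT w ->
  (forall z, 0 <= w z) -> 0 <= a -> 0 <= b -> supb w a -> tent w b ->
  forall g, (forall i, measurable_fun setT (g i)) ->
  (forall i z, `|g i z| <= w z) ->
  [/\ measurable_fun setT (Nop g),
   (forall q, `|Nop g q| <= C * (Num.sqrt q.2)^-1 * (a + b)) &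
   tent (fun q => Nop g q ^+ 2) (C * (a + b) ^+ 2)].
Proof.
have [C [C0 HC]] := @Sop_bounds R n.
exists (8 * C); split; first by rewrite mulr_ge0.
move=> w a b mw w0 a0 b0 wa wb g mg gw.
have ab0 : 0 <= a + b by rewrite addr_ge0.
have le8 (A B D : R) : A <= D -> B <= D -> 0 <= D -> A + B <= 8 * D by clear; lra.
have sq4 (u1 u2 u3 u4 : R) :
    (u1 + u2) ^+ 2 <= 2 * (u1 ^+ 2 + u2 ^+ 2 + (u3 ^+ 2 + u4 ^+ 2)).
  have h1 := sqr_ge0 (u1 - u2); have h3 := sqr_ge0 u3; have h4 := sqr_ge0 u4.
  by clear -h1 h3 h4; nra.
have S bb := HC w a b mw w0 a0 b0 wa wb (side bb g) (fun i => measf_side bb i mg)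
  (fun i z => side_le bb (w0 z) (gw i z)).
have mS bb : measurable_fun setT (Sop (side bb g)) by case: (S bb).
have bS bb q : `|Sop (side bb g) q| <= C * (Num.sqrt q.2)^-1 * (a + b) by case: (S bb).
have tS bb : tent (fun q => Sop (side bb g) q ^+ 2) (C * (a + b) ^+ 2) by case: (S bb).
have mSr bb : measurable_fun setT (fun q => Sop (side bb g) (reflq q)).
  by apply: (measurableT_comp (mS bb)); apply: measf_reflq; meas.
have tSr bb : tent (fun q => Sop (side bb g) (reflq q) ^+ 2) (C * (a + b) ^+ 2).
  apply: (@tent_refl (fun q => Sop (side bb g) q ^+ 2)) => //.
  - by have := mS bb => h; meas.
  - by move=> z; rewrite sqr_ge0.
have mx : measurable_fun setT (fun z : Rn * R => xn z.1) by apply: measf_xn; meas.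
have mN : measurable_fun setT (Nop g).
  have key (s1 s2 s3 s4 : Rn * R -> R) : measurable_fun setT s1 ->
      measurable_fun setT s2 -> measurable_fun setT s3 -> measurable_fun setT s4 ->
      measurable_fun setT (fun q : Rn * R => if 0 < xn q.1 then s1 q + s2 q
        else if xn q.1 < 0 then s3 q + s4 q else 0).
    by move=> m1 m2 m3 m4; meas.
  exact: (key _ _ _ _ (mS true) (mSr true) (mS false) (mSr false)).
split => //.
- move=> q; have X0 : 0 <= C * (Num.sqrt q.2)^-1 * (a + b).
    by rewrite !mulr_ge0// invr_ge0 sqrtr_ge0.
  have bd bb : `|Sop (side bb g) q + Sop (side bb g) (reflq q)| <=
     8 * (C * (Num.sqrt q.2)^-1 * (a + b)).
    apply: (le_trans (ler_normD _ _)).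
    have h1 := bS bb q; have h2 : `|Sop (side bb g) (reflq q)| <=  C * (Num.sqrt q.2)^-1 * (a + b) := bS bb (reflq q).
    exact: (le8 _ _ _ h1 h2 X0).
  rewrite (_ : 8 * C * _ * _ = 8 * (C * (Num.sqrt q.2)^-1 * (a + b))); last by rewrite !mulrA.
  rewrite /Nop; case: ifP => _; first exact: bd.
  case: ifP => _; first exact: bd.
  by rewrite normr0 mulr_ge0.
- rewrite -mulrA; apply: (tent4 _ _ _ _ _ _ (tS true) (tSr true) (tS false) (tSr false)).
  + by apply: measfX; exact: mN.
  + by apply: measfX; exact: mS.
  + by apply: measfX; exact: mSr.
  + by apply: measfX; exact: mS.
  + by apply: measfX; exact: mSr.
  + move=> q; rewrite sqr_ge0 /Nop /=; case: ifP => _; [|case: ifP => _].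
    + exact: (sq4 (Sop (side true g) q) (Sop (side true g) (reflq q))).
    + rewrite [_ + (_ + _)]addrC.
      exact: (sq4 (Sop (side false g) q) (Sop (side false g) (reflq q))).
    + by rewrite expr0n /= mulr_ge0// !addr_ge0// sqr_ge0.
  + by move=> q; exact: sqr_ge0.
  + by move=> q; exact: sqr_ge0.
  + by move=> q; exact: sqr_ge0.
  + by move=> q; exact: sqr_ge0.
Qed.

Lemma Sop_sub (w : Rn * R -> R) (a b : R) g h : measurable_fun setT w ->
  (forall z, 0 <= w z) -> 0 <= a -> 0 <= b -> supb w a -> tent w b ->
  (forall i, measurable_fun setT (g i)) -> (forall i, measurable_fun setT (h i)) ->
  (forall i z, `|g i z| <= w z) -> (forall i z, `|h i z| <= w z) ->
  forall q, Sop (fun i z => g i z - h i z) q = Sop g q - Sop h q.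
Proof.
move=> mw w0 a0 b0 wa wb mg mh gw hw q.
have [C [C0 HC]] := @DK_int R n.
rewrite /Sop -sumrB; apply: eq_bigr => i _.
have [Ig _] := HC w a b mw w0 a0 b0 wa wb i q (g i) (mg i) (gw i).
have [Ih _] := HC w a b mw w0 a0 b0 wa wb i q (h i) (mh i) (hw i).
rewrite -RintegralB//; apply: eq_Rintegral => z _; ring.
Qed.

Lemma Nop_sub (w : Rn * R -> R) (a b : R) g h : measurable_fun setT w ->
  (forall z, 0 <= w z) -> 0 <= a -> 0 <= b -> supb w a -> tent w b ->
  (forall i, measurable_fun setT (g i)) -> (forall i, measurable_fun setT (h i)) ->
  (forall i z, `|g i z| <= w z) -> (forall i z, `|h i z| <= w z) ->
  forall q, Nop (fun i z => g i z - h i z) q = Nop g q - Nop h q.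
Proof.
move=> mw w0 a0 b0 wa wb mg mh gw hw q.
have S bb q' : Sop (side bb (fun i z => g i z - h i z)) q' =
    Sop (side bb g) q' - Sop (side bb h) q'.
  rewrite -(Sop_sub mw w0 a0 b0 wa wb).
  - congr Sop; apply/funext => i; apply/funext => z; rewrite /side.
    by case: (if bb then _ else _); rewrite ?subr0.
  - by move=> i; exact: measf_side.
  - by move=> i; exact: measf_side.
  - by move=> i z; exact: side_le.
  - by move=> i z; exact: side_le.
rewrite /Nop; case: ifP => _; last case: ifP => _; last by rewrite subr0.
- rewrite (S true q) (S true (reflq q)).
  move: (Sop (side true g) q) (Sop (side true g) (reflq q)) => A B.
  by move: (Sop (side true h) q) (Sop (side true h) (reflq q)) => A' B'; ring.
- rewrite (S false q) (S false (reflq q)).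
  move: (Sop (side false g) q) (Sop (side false g) (reflq q)) => A B.
  by move: (Sop (side false h) q) (Sop (side false h) (reflq q)) => A' B'; ring.
Qed.

(** The iterated integral of a mild solution is identified with one over space-time, by absolute
    convergence and Fubini. [al] need agree with the measurable source only off the hyperplane and
    at positive times, which a null set permits. *)
Lemma Nop_mild (w : Rn * R -> R) (a b : R) g (al : R -> Rn -> Rn) :
  measurable_fun setT w ->
  (forall z, 0 <= w z) -> 0 <= a -> 0 <= b -> supb w a -> tent w b ->
  (forall i, measurable_fun setT (g i)) -> (forall i z, `|g i z| <= w z) ->
  (forall i z, 0 < z.2 -> xn z.1 != 0 -> al z.2 z.1 ord0 i = g i z) ->
  forall x (t : R), 0 < t -> xn x != 0 ->
  \int[leb]_(s in `]0, t[) neumann_heat_div (t - s) (al s) x = Nop g (x, t).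
Proof.
move=> mw w0 a0 b0 wa wb mg gw alg x t t0 x0.
have [C [C0 HC]] := @DK_int R n.
pose sg := 0 < xn x.
pose H (z : Rn * R) : R := \sum_i (DK i (x, t) z * side sg g i z + DK i (reflq (x, t)) z * side sg g i z).
have I q i : mu.-integrable setT (fun z => (DK i q z * side sg g i z)%:E).
  have [//] := HC w a b mw w0 a0 b0 wa wb i q (side sg g i) (measf_side sg i mg)
    (fun z => side_le sg (w0 z) (gw i z)).
have I2 i : mu.-integrable setT (fun z => (DK i (x, t) z * side sg g i z +
    DK i (reflq (x, t)) z * side sg g i z)%:E).
  by apply: (integrableD measurableT (I _ i) (I _ i)).
have IH : mu.-integrable setT (fun z => (H z)%:E).
  rewrite /H (_ : (fun z => _) = (fun z => (\sum_i (DK i (x, t) z * side sg g i z +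
    DK i (reflq (x, t)) z * side sg g i z)%:E)%E)).
    by apply: integrable_sum.
  by apply/funext => z; rewrite sumEFin.
have NE : Nop g (x, t) = \int[mu]_z H z.
  transitivity (Sop (side sg g) (x, t) + Sop (side sg g) (reflq (x, t))).
    rewrite /Nop /sg /=; case: ifPn => // x1; rewrite ifT//.
    by rewrite lt_neqAle x0 leNgt.
  rewrite /H /Sop -big_split/=.
  transitivity (\sum_i \int[mu]_z (DK i (x, t) z * side sg g i z +
    DK i (reflq (x, t)) z * side sg g i z)).
    by apply: eq_bigr => i _; rewrite (RintegralD measurableT (I _ i) (I _ i)).
  rewrite [in RHS]/Rintegral; under [in RHS]eq_integral do rewrite -sumEFin.
  rewrite integral_sum//.
  rewrite (eq_bigr (fun i => (\int[mu]_z (DK i (x, t) z * side sg g i z +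
    DK i (reflq (x, t)) z * side sg g i z))%:E)); last first.
    by move=> i _; exact/esym/(Rintegral_EFin (I2 i)).
  by rewrite sumEFin.
rewrite NE -(@pm_Rint21 R _ _ _ _ lebn leb H IH) Rintegral_mkcond.
apply: eq_Rintegral => s _; rewrite patchE; case: ifPn; rewrite ?inE ?notin_setE /= in_itv /=.
  move=> /andP[s0 st]; rewrite neumann_heat_divE ?subr_gt0//.
  apply: Rintegral_ae; apply: aeS hyper_ae => y y0.
  rewrite /H; apply: eq_bigr => i _; rewrite -mulrDl /DK /slab /= s0 st /=.
  congr (_ * _); rewrite (alg i (y, s))//= /side /sg /heaviside /=.
  have [xp|xm] := ltP 0 (xn x).
    rewrite pmulr_rlt0//; case: ltP => yp; first by rewrite ltNge (ltW yp) mul0r.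
    by rewrite lt_neqAle eq_sym y0 yp mul1r.
  have {}xm : xn x < 0 by rewrite lt_neqAle x0.
  rewrite nmulr_rlt0//; case: ltP => yp; first by rewrite ltNge (ltW yp) mul0r.
  by rewrite lt_neqAle y0 yp mul1r.
move=> /negP st; rewrite /Rintegral integral0_eq// => y _.
by rewrite /H big1// => i _; rewrite /DK /slab /= (negPf st) !mul0r addr0.
Qed.

End neumann_duhamel.

(** * Tempered distributions on the two half-spaces *)

Lemma near_eq_differentiable {R : realType} (V W : normedModType R) (f g : V -> W) (x : V) :
  (\near x, f x = g x) -> differentiable f x -> differentiable g x.
Proof.
move=> fg df; have [cdf fE] := (diff_locallyP x f).1 df.
have fgx : f x = g x by exact: (nbhs_singleton fg).
have fg0 : \forall h \near (0 : V), f (h + x) = g (h + x).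
  by move: fg; rewrite (near_shift 0) subr0.
have gE : g \o shift x = cst (g x) + 'd f x +o_ (0 : V) id.
  apply/eqaddoP => e e0.
  have /eqaddoP/(_ e e0) := fE; move: fg0; apply: filterS2 => h.
  by rewrite /= !fctE /= /shift /= => -> ; rewrite fgx.
have dE := diff_unique cdf gE.
apply/diff_locallyP; split; first by rewrite dE.
by rewrite dE.
Qed.

Section jets.
Context {R : realType} {n : nat}.
Local Notation Rn := 'rV[R]_n.+1.
Implicit Types (x y z : Rn) (D : seq 'I_n.+1 -> Rn -> R) (phi : Rn -> R).

(** A candidate for every iterated derivative, compatible on Omega alone. Nothing refers to values
    on the hyperplane, and jets can be combined linearly and integrated in a parameter by formula,
    whereas [partials] is an iterated limit. *)
Definition jet D := forall i a y, Omega y ->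
  differentiable (D a) y /\ partial i (D a) y = D (i :: a) y.

(* [D] lists the partial derivatives of [phi] on [Omega]. *)
Definition jet_of D phi := jet D /\ forall y, Omega y -> phi y = D [::] y.

Definition jet_le (k : nat) (M : R) D := forall a y, (size a <= k)%N -> Omega y ->
  (1 + enorm y) ^+ k * `|D a y| <= M.

Lemma near_Omega y : Omega y -> \forall z \near y, Omega z.
Proof.
move=> y0; have c := @coord_continuous R 1 n.+1 ord0 ord_max y.
exact: (c [set a | a != 0] (open_nbhs_nbhs (conj (@open_neq R 0) y0))).
Qed.

(** Omega is open, so a derivative at one of its points sees only nearby points of Omega, and the
    comparison propagates by induction on the list. *)
Lemma jet_partials D phi : jet_of D phi -> forall a y, Omega y ->
  partials a phi y = D a y /\ differentiable (partials a phi) y.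
Proof.
move=> [jD phiD].
have pD a y : Omega y -> partials a phi y = D a y.
  elim: a y => [|i a IH] y Oy; first exact: phiD.
  have [_ <-] := jD i a y Oy; rewrite /= /partial; apply: near_eq_derive.
  by apply: filterS (near_Omega Oy) => z; exact: IH.
move=> a y Oy; split; first exact: pD.
have [dD _] := jD ord0 a y Oy; apply: near_eq_differentiable dD.
by apply: filterS (near_Omega Oy) => z /(pD a) ->.
Qed.

Lemma enorm_ge0 x : 0 <= enorm x.
Proof. exact: sqrtr_ge0. Qed.

Lemma jet_schwartz D phi : jet_of D phi -> (forall k, exists M, jet_le k M D) ->
  (forall a k, exists M, forall y, Omega y -> (1 + enorm y) ^+ k * `|D a y| <= M) ->
  schwartz_on Omega phi.
Proof.
move=> jD _ bD; split=> [a y /(jet_partials jD a)[]//|a k].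
have [M HM] := bD a k; exists M => y Oy.
by have [-> _] := jet_partials jD a Oy; exact: HM.
Qed.

Lemma jet_schwartz_le D phi : jet_of D phi -> (forall k, exists M, jet_le k M D) ->
  schwartz_on Omega phi.
Proof.
move=> jD bD; apply: (jet_schwartz jD) => // a k.
have [M HM] := bD (maxn (size a) k); exists M => y Oy.
apply: le_trans (HM a y (leq_maxl _ _) Oy); rewrite ler_wpM2r//.
by rewrite ler_weXn2l ?leq_maxr// lerDl enorm_ge0.
Qed.

Lemma partial_lin (c : R) (f g : Rn -> R) i y : differentiable f y -> differentiable g y ->
  differentiable (fun z => c * f z + g z) y /\
  partial i (fun z => c * f z + g z) y = c * partial i f y + partial i g y.
Proof.
move=> df dg; have dcf : differentiable (c *: f) y by exact: differentiableZ.
split; first exact: (differentiableD dcf dg).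
have -> : (fun z => c * f z + g z) = (c *: f + g) by [].
rewrite /partial deriveD ?deriveZ//; exact: diff_derivable.
Qed.

Lemma jet_lin (c : R) D E phi psi : jet_of D phi -> jet_of E psi ->
  jet_of (fun a y => c * D a y + E a y) (fun y => c * phi y + psi y).
Proof.
move=> [jD pD] [jE pE]; split=> [i a y Oy|y Oy]; last by rewrite pD// pE.
have [dD eD] := jD i a y Oy; have [dE eE] := jE i a y Oy.
by have [? ->] := partial_lin c i dD dE; rewrite eD eE.
Qed.

Lemma jet_le_lin (c : R) D E k M N : jet_le k M D -> jet_le k N E ->
  jet_le k (`|c| * M + N) (fun a y => c * D a y + E a y).
Proof.
move=> HM HN a y ak Oy.
have k0 : 0 <= (1 + enorm y) ^+ k by rewrite exprn_ge0// addr_ge0// enorm_ge0.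
apply: (@le_trans _ _ ((1 + enorm y) ^+ k * (`|c| * `|D a y| + `|E a y|))).
  by rewrite ler_wpM2l// -normrM ler_normD.
rewrite mulrDr mulrCA lerD ?HN// ler_wpM2l// HM//.
Qed.

Lemma jet0 : jet_of (fun _ _ => 0) (fun _ : Rn => 0).
Proof.
split => // i a y _; split; first exact: differentiable_cst.
by rewrite /partial; exact: derive_cst.
Qed.

Section functional.
Variable (T : (Rn -> R) -> R).
Hypothesis tT : tempered_on Omega T.

Definition sjet D phi := jet_of D phi /\ forall k, exists M, jet_le k M D.

Lemma sjet_schwartz D phi : sjet D phi -> schwartz_on Omega phi.
Proof. by move=> [j b]; exact: jet_schwartz_le j b. Qed.

Lemma sjet0 : sjet (fun _ _ => 0) (fun _ : Rn => 0).
Proof.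
split; first exact: jet0.
by move=> k; exists 0 => a y _ _; rewrite normr0 mulr0.
Qed.

Lemma sjet_lin (c : R) D E phi psi : sjet D phi -> sjet E psi ->
  sjet (fun a y => c * D a y + E a y) (fun y => c * phi y + psi y).
Proof.
move=> [jD bD] [jE bE]; split; first exact: jet_lin.
by move=> k; have [M HM] := bD k; have [N HN] := bE k; exists (`|c| * M + N); exact: jet_le_lin.
Qed.

Lemma T_lin (c : R) D E phi psi : sjet D phi -> sjet E psi ->
  T (fun y => c * phi y + psi y) = c * T phi + T psi.
Proof. by move=> sD sE; exact: (tT.1 c phi psi (sjet_schwartz sD) (sjet_schwartz sE)). Qed.

Lemma T_0 : T (fun _ => 0) = 0.
Proof.
have := T_lin 1 sjet0 sjet0.
rewrite (_ : (fun _ => 1 * 0 + 0) = (fun _ => 0)); last by apply/funext => y; rewrite mulr0 addr0.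
by move=> h; move: h; rewrite mul1r => h; lra.
Qed.

Lemma T_sum (I : Type) (r : seq I) (c : I -> R) (D : I -> seq 'I_n.+1 -> Rn -> R)
    (phi : I -> Rn -> R) : (forall i, sjet (D i) (phi i)) ->
  sjet (fun a y => \sum_(i <- r) c i * D i a y) (fun y => \sum_(i <- r) c i * phi i y) /\
  T (fun y => \sum_(i <- r) c i * phi i y) = \sum_(i <- r) c i * T (phi i).
Proof.
move=> sD; elim: r => [|i r [IH1 IH2]].
  rewrite big_nil; split.
    rewrite (_ : (fun a y => _) = (fun _ _ => 0)); last first.
      by apply/funext => a; apply/funext => y; rewrite big_nil.
    rewrite (_ : (fun y => _) = (fun _ => 0)); last by apply/funext => y; rewrite big_nil.
    exact: sjet0.
  rewrite (_ : (fun y => _) = (fun _ => 0)); last by apply/funext => y; rewrite big_nil.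
  exact: T_0.
have e1 : (fun y => \sum_(j <- i :: r) c j * phi j y) =
    (fun y => c i * phi i y + \sum_(j <- r) c j * phi j y).
  by apply/funext => y; rewrite big_cons.
have e2 : (fun a y => \sum_(j <- i :: r) c j * D j a y) =
    (fun a y => c i * D i a y + \sum_(j <- r) c j * D j a y).
  by apply/funext => a; apply/funext => y; rewrite big_cons.
rewrite e1 e2; split; first exact: sjet_lin.
by rewrite (T_lin _ (sD i) IH1) IH2 big_cons.
Qed.

Lemma T_bound : exists (k : nat) (C : R), 0 <= C /\
  forall D phi M, sjet D phi -> jet_le k M D -> `|T phi| <= C * M.
Proof.
have [_ [k [C HC]]] := tT; exists k, `|C|; split => // D phi M sD bD.
(* The seminorm bound evaluated at one point of Omega; with it C may be replaced by its absolute
   value. *)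
have M0 : 0 <= M.
  pose y : Rn := const_mx 1.
  have Oy : Omega y by rewrite /Omega /= mxE oner_eq0.
  apply: le_trans (bD [::] y (leq0n _) Oy).
  by rewrite mulr_ge0// exprn_ge0// addr_ge0// enorm_ge0.
apply: (@le_trans _ _ (C * M)); last by rewrite ler_wpM2r// ler_norm.
apply: HC; first exact: sjet_schwartz sD.
by move=> a y ak Oy; have [-> _] := jet_partials sD.1 a Oy; exact: bD.
Qed.

(** The difference has all seminorms on Omega equal to 0, so continuity and linearity make the
    functional blind to the values on the hyperplane. *)
Lemma T_eq D phi psi : sjet D phi -> sjet D psi -> T phi = T psi.
Proof.
move=> sp sq; have [k [C [C0 HC]]] := T_bound.
have sd := sjet_lin (-1) sp sq.
have b0 : jet_le k 0 (fun a y => -1 * D a y + D a y).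
  by move=> a y _ _; rewrite mulN1r addNr normr0 mulr0.
have := HC _ _ _ sd b0; rewrite mulr0 normr_le0 (T_lin _ sp sq) => /eqP h; lra.
Qed.

Lemma T_diff (k : nat) (C : R) : 
  (forall D phi M, sjet D phi -> jet_le k M D -> `|T phi| <= C * M) ->
  forall D E phi psi M, sjet D phi -> sjet E psi ->
  (forall a y, (size a <= k)%N -> Omega y ->
     (1 + enorm y) ^+ k * `|D a y - E a y| <= M) -> `|T phi - T psi| <= C * M.
Proof.
move=> HC D E phi psi M sD sE h.
have := HC _ _ M (sjet_lin (-1) sE sD); rewrite (T_lin _ sE sD) mulN1r addrC; apply.
by move=> a y ak Oy; rewrite mulN1r [- E a y + _]addrC; exact: h.
Qed.

End functional.
End jets.

(** * Weighted bounds for translated Gaussians *)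

Section one_dimensional.
Context {R : realType}.
Local Notation leb := (@lebesgue_measure R).

Lemma weight_add (k : nat) (a z : R) : (1 + `|a|) ^+ k <= (1 + `|a - z|) ^+ k * (1 + `|z|) ^+ k.
Proof.
have h (u : R) : 0 <= 1 + `|u| by rewrite addr_ge0.
rewrite -exprMn lerXn2r ?nnegrE ?mulr_ge0//.
have h0 : `|a| <= `|a - z| + `|z| by rewrite -{1}(subrK z a) ler_normD.
by rewrite mulrDr mulr1 mulrDl mul1r; have := mulr_ge0 (normr_ge0 (a - z)) (normr_ge0 z); lra.
Qed.

Lemma weight_ge1 (k : nat) (z : R) : 1 <= (1 + `|z|) ^+ k.
Proof. by rewrite exprn_ege1// lerDl. Qed.

Lemma dgam_unif (t : R) k K : 0 < t -> exists M : R, 1 <= M /\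
  forall m x, (m <= K)%N -> (1 + `|x|) ^+ k * `|dgam m t x| <= M.
Proof.
move=> t0; elim: K => [|K [M [M1 HM]]].
  have [M [M0 HM]] := dgam_bounded 0 k t0; exists (1 + M); split; first by rewrite lerDl.
  by move=> m x; rewrite leqn0 => /eqP ->; apply: (le_trans (HM x)); rewrite lerDr.
have [N [N0 HN]] := dgam_bounded K.+1 k t0; exists (M + N); split; first by rewrite ler_wpDr.
move=> m x; rewrite leq_eqVlt => /orP[/eqP ->|mK].
  by apply: (le_trans (HN x)); rewrite lerDr (le_trans _ M1).
by apply: (le_trans (HM m x mK)); rewrite lerDl.
Qed.

Lemma dgam_mvt m (t u v : R) : 0 < t -> exists xi,
  (u <= xi <= v \/ v <= xi <= u) /\
  `|dgam m t u - dgam m t v| = `|dgam m.+1 t xi| * `|u - v|.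
Proof.
move=> t0; have tn : t != 0 by rewrite gt_eqF.
wlog uv : u v / u <= v.
  move=> H; have [|/ltW] := leP u v; first exact: H.
  move=> /H [xi [h1 h2]]; exists xi; split; first by case: h1; [right|left].
  by rewrite distrC [`|u - v|]distrC.
have [|xi xuv] := @MVT_segment _ (dgam m t) (dgam m.+1 t) u v uv (fun z _ => isd_dgam m z tn).
  by apply: continuous_subspaceT => z; exact: isd_continuous (isd_dgam m z tn).
move=> e; exists xi; split; first by left; move: xuv; rewrite in_itv.
by rewrite distrC e normrM [`|v - u|]distrC.
Qed.

(** By the mean value theorem the difference is a derivative of one higher order, whence [k.+1]
    below, at some xi between a - z and a - z'; then 1 + |a| <= (1 + |xi|) (1 + |z|) (1 + |z'|)
    moves the weight to xi. *)
Lemma dgam_shift_lip (t : R) k : 0 < t -> exists M : R, 1 <= M /\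
  forall m a z z', (m <= k)%N ->
  (1 + `|a|) ^+ k * `|dgam m t (a - z) - dgam m t (a - z')| <=
    M * ((1 + `|z|) ^+ k * (1 + `|z'|) ^+ k) * `|z - z'|.
Proof.
move=> t0; have [M [M1 HM]] := dgam_unif k k.+1 t0; exists M; split => // m a z z' mk.
have [xi [hxi ->]] := dgam_mvt m (a - z) (a - z') t0.
rewrite (_ : `|a - z - (a - z')| = `|z - z'|); last first.
  by rewrite distrC; congr (`|_|); ring.
rewrite mulrA ler_wpM2r//.
have hp (u : R) : 0 <= 1 + `|u| by rewrite addr_ge0.
have ha : 1 + `|a| <= (1 + `|xi|) * ((1 + `|z|) * (1 + `|z'|)).
  have : `|a| <= `|xi| + (`|z| + `|z'|).
    have h3 : `|a - xi| <= `|z| + `|z'|.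
      rewrite ler_norml.
      have := ler_norm z; have := ler_norm z'; have := ler_norm (- z); have := ler_norm (- z').
      rewrite !normrN => A1 A2 A3 A4.
      have B1 := normr_ge0 z; have B2 := normr_ge0 z'.
      by case: hxi => /andP[h1 h2]; apply/andP; split; clear -A1 A2 A3 A4 B1 B2 h1 h2; lra.
    by rewrite -{1}(subrK xi a) [`|xi| + _]addrC; apply: (le_trans (ler_normD _ _)); rewrite lerD2r.
  move=> h3; have := normr_ge0 xi; have := normr_ge0 z; have := normr_ge0 z'.
  move: h3; move: `|a| `|xi| `|z| `|z'| => A X Z Z' h3 p1 p2 p3.
  have q1 := mulr_ge0 p2 p1; have q2 := mulr_ge0 p3 p2; have q3 := mulr_ge0 p3 p1.
  have q4 := mulr_ge0 p3 q1.
  by clear -h3 q1 q2 q3 q4; nra.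
apply: (@le_trans _ _ (((1 + `|xi|) * ((1 + `|z|) * (1 + `|z'|))) ^+ k * `|dgam m.+1 t xi|)).
  by rewrite ler_wpM2r// lerXn2r ?nnegrE ?mulr_ge0.
rewrite !exprMn mulrAC ler_wpM2r ?mulr_ge0 ?exprn_ge0//.
by apply: HM; rewrite ltnS.
Qed.

End one_dimensional.

(** * Kernels with a free pole and their Schwartz seminorms *)

Section kernels.
Context {R : realType} {n : nat}.
Local Notation Rn := 'rV[R]_n.+1.
Local Notation leb := (@lebesgue_measure R).
Local Notation lebn := (@lebesgue_rV R n.+1).
Implicit Types (x y z : Rn) (s t c : R) (b : bool) (j : 'I_n.+1).

Definition sgb b (a : R) : bool := if b then 0 < a else a < 0.

(* [Phi b s z] below is the Neumann kernel with pole [z] when [z] lies on the side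
   [b] of the hyperplane; here it is extended evenly to all [z], so that it obeys
   the Chapman-Kolmogorov equation with the whole-space kernel. *)
Definition Bk b s j (z : R) (m : nat) (a : R) : R :=
  if j == ord_max then
    (if sgb b a then dgam m s (a - z) + dgam m s (a + z) else 0)
  else dgam m s (a - z).

Definition Phi b s z y : R := \prod_j Bk b s j (z ord0 j) 0 (y ord0 j).

Definition DPhi b s z (a : seq 'I_n.+1) y : R :=
  \prod_j Bk b s j (z ord0 j) (count_mem j a) (y ord0 j).

(** It dominates the Euclidean weight and, being a product, lets the estimates for tensor kernels be
    made one coordinate at a time. *)
Definition wt (k : nat) z : R := \prod_j (1 + `|z ord0 j|) ^+ k.

Lemma isd_Bk b s j (z : R) m (a : R) : s != 0 -> (j == ord_max -> a != 0) ->
  is_derive a 1 (Bk b s j z m) (Bk b s j z m.+1 a).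
Proof.
move=> s0 ja; rewrite /Bk.
have d1 (c : R) : is_derive c 1 (fun a => dgam m s (a - z)) (dgam m.+1 s (c - z)).
  apply: (isd_eq (isd_comp (g := fun a => a - z) (isd_dgam m _ s0) (isdB (isd_id c) (isd_cst c z)))).
  by rewrite subr0 mulr1.
have d2 (c : R) : is_derive c 1 (fun a => dgam m s (a + z)) (dgam m.+1 s (c + z)).
  apply: (isd_eq (isd_comp (g := fun a => a + z) (isd_dgam m _ s0) (isdD (isd_id c) (isd_cst c z)))).
  by rewrite addr0 mulr1.
case: eqP ja => [jm /(_ isT) a0|_ _]; last exact: d1.
have nb : \forall c \near a, sgb b c = sgb b a.
  case/orP: (lt_total a0) => al.
    have h : \forall c \near a, c < 0 by exact: lt_nbhsl.
    apply: filterS h => c c0; rewrite /sgb.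
    by case: b; rewrite ?al ?c0// !ltNge (ltW al) (ltW c0).
  have h : \forall c \near a, 0 < c by exact: lt_nbhsr.
  apply: filterS h => c c0; rewrite /sgb.
  by case: b; rewrite ?al ?c0// !ltNge (ltW al) (ltW c0).
case e : (sgb b a).
  apply: (near_eq_is_derive (f := fun a => dgam m s (a - z) + dgam m s (a + z))).
    by apply: filterS nb => c ->; rewrite e.
apply: (near_eq_is_derive (f := fun _ => 0)).
by apply: filterS nb => c ->; rewrite e.
Qed.

Lemma differentiable_prod_coord (F : 'I_n.+1 -> R -> R) y :
  (forall j, derivable (F j) (y ord0 j) 1) ->
  differentiable (fun y => \prod_j F j (y ord0 j)) y.
Proof.
move=> dF; have H (r : seq 'I_n.+1) : differentiable (fun y => \prod_(j <- r) F j (y ord0 j)) y.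
  elim: r => [|j r IH].
    rewrite (_ : (fun y => _) = cst 1); first exact: differentiable_cst.
    by apply/funext => u; rewrite big_nil.
  rewrite (_ : (fun y => _) = (F j \o (fun y : Rn => y ord0 j)) * (fun y => \prod_(j <- r) F j (y ord0 j))).
    apply: differentiableM => //; apply: differentiable_comp.
      exact: differentiable_coord.
    by apply/derivable1_diffP; exact: dF.
  by apply/funext => u; rewrite big_cons.
exact: H.
Qed.

Lemma jet_Phi b s z : 0 < s -> jet_of (DPhi b s z) (Phi b s z).
Proof.
move=> s0; have sn : s != 0 by rewrite gt_eqF.
split => // i a y Oy.
have dB j m : is_derive (y ord0 j) 1 (Bk b s j (z ord0 j) m) (Bk b s j (z ord0 j) m.+1 (y ord0 j)).
  by apply: isd_Bk => // /eqP ->.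
split.
  apply: (differentiable_prod_coord (F := fun j => Bk b s j (z ord0 j) (count_mem j a))) => j.
  by have [] := dB j (count_mem j a).
rewrite (partial_prod (A := fun j => Bk b s j (z ord0 j) (count_mem j a)) (dB i (count_mem i a))).
apply: eq_bigr => j _; rewrite /= eq_sym; by case: eqP => [->|_] //=.
Qed.

Lemma wt_ge1 k z : 1 <= wt k z.
Proof.
rewrite /wt; elim/big_rec: _ => // j u _ u1.
by apply: mulr_ege1 => //; exact: weight_ge1.
Qed.

Lemma wt_ge0 k z : 0 <= wt k z.
Proof. exact: le_trans (wt_ge1 k z). Qed.

(** The Euclidean norm is at most the sum of the |y_j|, and 1 plus this sum is at most the product
    of the 1 + |y_j|. *)
Lemma enorm_wt k y : (1 + enorm y) ^+ k <= wt k y.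
Proof.
have e0 : 0 <= 1 + enorm y by rewrite addr_ge0// enorm_ge0.
have p0 : 0 <= \prod_j (1 + `|y ord0 j|) by apply: prodr_ge0 => j _; rewrite addr_ge0.
rewrite /wt prodrXl lerXn2r ?nnegrE//.
have sp (r : seq 'I_n.+1) : [/\ 0 <= \sum_(j <- r) `|y ord0 j|,
   1 + \sum_(j <- r) `|y ord0 j| <= \prod_(j <- r) (1 + `|y ord0 j|) &
   \sum_(j <- r) y ord0 j ^+ 2 <= (\sum_(j <- r) `|y ord0 j|) ^+ 2].
  elim: r => [|j r [IH0 IH1 IH2]]; first by rewrite !big_nil addr0 expr0n.
  rewrite !big_cons; set S := \sum_(j <- r) _ in IH0 IH1 IH2 *.
  have yj := normr_ge0 (y ord0 j); split; first by rewrite addr_ge0.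
    apply: (@le_trans _ _ ((1 + `|y ord0 j|) * (1 + S))).
      have := mulr_ge0 yj IH0; move: `|_| => A; clear; lra.
    by rewrite ler_wpM2l// addr_ge0.
  rewrite -(real_normK (num_real (y ord0 j))).
  have := mulr_ge0 yj IH0; move: yj IH2; move: `|_| => A yj; clear; nra.
have [S0 S1 S2] := sp (index_enum 'I_n.+1).
apply: le_trans S1; rewrite lerD2l /enorm -[leRHS]ger0_norm// -sqrtr_sqr.
by rewrite ler_sqrt// sqr_ge0.
Qed.

Lemma Bk_bounds s k : 0 < s -> exists M : R, [/\ 1 <= M,
  (forall b j m (z a : R), (m <= k)%N ->
    (1 + `|a|) ^+ k * `|Bk b s j z m a| <= M * (1 + `|z|) ^+ k) &
  (forall b j m (z z' a : R), (m <= k)%N ->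
    (1 + `|a|) ^+ k * `|Bk b s j z m a - Bk b s j z' m a| <=
      M * ((1 + `|z|) ^+ k * (1 + `|z'|) ^+ k) * `|z - z'|)].
Proof.
move=> s0; have [M1 [M11 H1]] := dgam_unif k k s0.
have [M2 [M21 H2]] := dgam_shift_lip k s0.
have M10 : 0 <= M1 by exact: le_trans M11.
have M20 : 0 <= M2 by exact: le_trans M21.
exists (2 * M1 + 2 * M2); split.
- by lra.
- move=> b j m z a mk.
  have w0 (u : R) : 0 <= (1 + `|u|) ^+ k by rewrite exprn_ge0// addr_ge0.
  have g (c : R) : (1 + `|a|) ^+ k * `|dgam m s (a - c)| <= M1 * (1 + `|c|) ^+ k.
    apply: (@le_trans _ _ ((1 + `|a - c|) ^+ k * (1 + `|c|) ^+ k * `|dgam m s (a - c)|)).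
      by rewrite ler_wpM2r// weight_add.
    by rewrite mulrAC ler_wpM2r// H1.
  have g2 : (1 + `|a|) ^+ k * `|dgam m s (a + z)| <= M1 * (1 + `|z|) ^+ k.
    by have := g (- z); rewrite opprK normrN.
  have X0 : 0 <= M1 * (1 + `|z|) ^+ k by rewrite mulr_ge0.
  have Y0 : 0 <= M2 * (1 + `|z|) ^+ k by rewrite mulr_ge0.
  have ge2 : 0 <= (2 * M1 + 2 * M2) * (1 + `|z|) ^+ k by rewrite mulr_ge0// addr_ge0// mulr_ge0.
  have le1 : M1 * (1 + `|z|) ^+ k + M1 * (1 + `|z|) ^+ k <= (2 * M1 + 2 * M2) * (1 + `|z|) ^+ k by lra.
  rewrite /Bk; case: ifP => _; last by apply: le_trans le1; rewrite ler_wpDr.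
  case: ifP => _; last by rewrite normr0 mulr0.
  apply: le_trans le1; apply: le_trans (lerD (g z) g2).
  by rewrite -mulrDr ler_wpM2l// ler_normD.
- move=> b j m z z' a mk.
  have w0 (u : R) : 0 <= (1 + `|u|) ^+ k by rewrite exprn_ge0// addr_ge0.
  have g1 := H2 m a z z' mk; have := H2 m a (- z) (- z') mk.
  rewrite !opprK !normrN (_ : `|- z + z'| = `|z - z'|); last first.
    by rewrite distrC addrC.
  move=> g2; set W := (1 + `|z|) ^+ k * _ in g1 g2 *.
  have X0 : 0 <= M2 * W * `|z - z'| by rewrite !mulr_ge0.
  have Y0 : 0 <= M1 * W * `|z - z'| by rewrite !mulr_ge0.
  have le1 : M2 * W * `|z - z'| + M2 * W * `|z - z'| <= (2 * M1 + 2 * M2) * W * `|z - z'|.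
    rewrite [leRHS](_ : _ = 2 * (M1 * W * `|z - z'|) + 2 * (M2 * W * `|z - z'|)); last by ring.
    by move: X0 Y0; clear; lra.
  rewrite /Bk; case: ifP => _; last by apply: le_trans le1; rewrite ler_wpDr.
  case: ifP => _; last by rewrite subrr normr0 mulr0; apply: le_trans le1; rewrite addr_ge0.
  apply: le_trans le1; apply: le_trans (lerD g1 g2).
  by rewrite -mulrDr ler_wpM2l// opprD addrACA ler_normD.
Qed.

(** Telescoping, one factor exchanged at a time: p P - q Q = p (P - Q) + (p - q) Q. *)
Lemma prod_dist (p q W d : 'I_n.+1 -> R) (r : seq 'I_n.+1) :
  (forall i, `|p i| <= W i) -> (forall i, `|q i| <= W i) -> (forall i, 0 <= d i) ->
  (forall i, `|p i - q i| <= W i * d i) ->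
  `|\prod_(i <- r) q i| <= \prod_(i <- r) W i /\
  `|\prod_(i <- r) p i - \prod_(i <- r) q i| <= \prod_(i <- r) W i * \sum_(i <- r) d i.
Proof.
move=> pW qW d0 pq; have W0 i : 0 <= W i by exact: le_trans (pW i).
elim: r => [|i r [IH1 IH2]]; first by rewrite !big_nil normr1 subrr normr0 mulr0.
rewrite !big_cons; set P := \prod_(j <- r) p j; set Q := \prod_(j <- r) q j.
set V := \prod_(j <- r) W j; set S := \sum_(j <- r) d j.
have V0 : 0 <= V by exact: le_trans IH1.
split; first by rewrite normrM ler_pM.
rewrite (_ : p i * P - q i * Q = p i * (P - Q) + (p i - q i) * Q); last by ring.
apply: (le_trans (ler_normD _ _)); rewrite !normrM.
apply: (@le_trans _ _ (W i * (V * S) + W i * d i * V)).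
  by apply: lerD; rewrite ler_pM.
by rewrite le_eqVlt; apply/orP; left; apply/eqP; ring.
Qed.

(** The seminorms grow at most polynomially in the pole and are Lipschitz in it with polynomial
    constants. Any polynomial rate will do, because poles are integrated against a Gaussian. *)
Lemma DPhi_bounds s k : 0 < s -> exists M : R, [/\ 0 <= M,
  (forall b z a y, (size a <= k)%N ->
    (1 + enorm y) ^+ k * `|DPhi b s z a y| <= M * wt k z) &
  (forall b z z' a y, (size a <= k)%N ->
    (1 + enorm y) ^+ k * `|DPhi b s z a y - DPhi b s z' a y| <=
      M * (wt k z * wt k z') * \sum_j `|z ord0 j - z' ord0 j|)].
Proof.
move=> s0; have [M [M1 HB HL]] := Bk_bounds k s0.
have M0 : 0 <= M by exact: le_trans M1.
have cnt (a : seq 'I_n.+1) j : (size a <= k)%N -> (count_mem j a <= k)%N.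
  by apply: leq_trans; exact: count_size.
exists (M ^+ n.+1); split; first exact: exprn_ge0.
- move=> b z a y ak; apply: (@le_trans _ _ (wt k y * `|DPhi b s z a y|)).
    by rewrite ler_wpM2r// enorm_wt.
  rewrite /wt /DPhi normr_prod -big_split/= -[M ^+ n.+1](_ : \prod_(j < n.+1) M = _); last first.
    by rewrite prodr_const card_ord.
  rewrite -big_split/=; apply: ler_prod => j _; rewrite HB ?cnt// andbT.
  by rewrite mulr_ge0// exprn_ge0// addr_ge0.
- move=> b z z' a y ak.
  apply: (@le_trans _ _ (wt k y * `|DPhi b s z a y - DPhi b s z' a y|)).
    by rewrite ler_wpM2r// enorm_wt.
  pose p (u : Rn) (j : 'I_n.+1) : R := (1 + `|y ord0 j|) ^+ k * Bk b s j (u ord0 j) (count_mem j a) (y ord0 j).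
  pose W (j : 'I_n.+1) : R := M * ((1 + `|z ord0 j|) ^+ k * (1 + `|z' ord0 j|) ^+ k).
  have pE (u : Rn) : wt k y * DPhi b s u a y = \prod_j p u j by rewrite /wt /DPhi -big_split.
  rewrite -(ger0_norm (wt_ge0 k y)) -normrM mulrBr !pE.
  have w0 (u : R) : 0 <= (1 + `|u|) ^+ k by rewrite exprn_ge0// addr_ge0.
  have pn (u : Rn) j : `|p u j| <= M * (1 + `|u ord0 j|) ^+ k.
    by rewrite /p normrM ger0_norm// HB// cnt.
  have [] := @prod_dist (p z) (p z') W (fun j => `|z ord0 j - z' ord0 j|) (index_enum 'I_n.+1).
  + move=> j; apply: (le_trans (pn z j)); rewrite /W ler_wpM2l//.
    by rewrite ler_peMr// weight_ge1.
  + move=> j; apply: (le_trans (pn z' j)); rewrite /W ler_wpM2l//.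
    by rewrite ler_peMl// weight_ge1.
  + by [].
  + move=> j; rewrite /p -mulrBr normrM (ger0_norm (w0 _)) /W.
    by apply: HL; exact: cnt.
  move=> _ /le_trans; apply; rewrite le_eqVlt; apply/orP; left; apply/eqP; congr (_ * _).
  by rewrite /W big_split/= prodr_const card_ord big_split.
Qed.

Lemma sjet_Phi b s z : 0 < s -> sjet (DPhi b s z) (Phi b s z).
Proof.
move=> s0; split; first exact: jet_Phi.
move=> k; have [M [M0 HM _]] := DPhi_bounds k s0.
by exists (M * wt k z) => a y ak _; exact: HM.
Qed.

End kernels.

Section kernels_conv.
Context {R : realType} {n : nat}.
Local Notation Rn := 'rV[R]_n.+1.
Local Notation leb := (@lebesgue_measure R).
Local Notation lebn := (@lebesgue_rV R n.+1).
Implicit Types (s t c : R) (b : bool) (j : 'I_n.+1).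

(** The side test involves only a, so the integration over the pole is an ordinary Gaussian
    convolution on the whole line; the image term is brought to the same form by parity. *)
Lemma Bk_conv b s c j (v a : R) m : 0 < s -> 0 < c ->
  leb.-integrable setT (EFin \o (fun z : R => gam c (v - z) * Bk b s j z m a)) /\
  (\int[leb]_z (gam c (v - (z : R)) * Bk b s j (z : R) m a)%:E = (Bk b (s + c) j v m a)%:E)%E.
Proof.
move=> s0 c0; have sc0 : 0 < s + c by rewrite addr_gt0.
have Id (a' : R) : leb.-integrable setT (EFin \o (fun z : R => gam c (v - z) * dgam m s (a' - z))) /\
    (\int[leb]_z (gam c (v - (z : R)) * dgam m s (a' - (z : R)))%:E = (dgam m (s + c) (a' - v))%:E)%E.
  split.
    have [N [N0 HN]] := dgam_bounded m 0 s0.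
    have := @integrable_dgamM R 0 c v (fun z : R => dgam m s (a' - z)) N c0.
    rewrite (_ : (fun z : R => dgam 0 c (v - z) * _) = (fun z : R => gam c (v - z) * dgam m s (a' - z))); last first.
      by apply/funext => z; rewrite dgam0.
    apply; first by apply: measf_dgam; meas.
    by move=> z; have := HN (a' - z); rewrite expr0 mul1r.
  have := dgam_conv m 0 a' v s0 c0; rewrite addn0 => <-.
  by apply: eq_integral => z _; rewrite dgam0 mulrC -gamN opprB.
have Id2 : leb.-integrable setT (EFin \o (fun z : R => gam c (v - z) * dgam m s (a + z))) /\
    (\int[leb]_z (gam c (v - (z : R)) * dgam m s (a + (z : R)))%:E = (dgam m (s + c) (a + v))%:E)%E.
  have e (z : R) : gam c (v - z) * dgam m s (a + z) = (-1) ^+ m * (gam c (v - z) * dgam m s (- a - z)).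
    by rewrite -opprD dgamN [gam c _ * (_ ^+ m * _)]mulrCA [RHS]mulrA -expr2 sqrr_sign mul1r.
  have [I E] := Id (- a).
  rewrite (_ : (fun z : R => _) = (fun z : R => (-1) ^+ m * (gam c (v - z) * dgam m s (- a - z)))); last first.
    by apply/funext => z; exact: e.
  split; first exact: (integrableZl measurableT ((-1) ^+ m) I).
  under eq_integral do rewrite e EFinM.
  rewrite integralZl// E -EFinM -opprD dgamN mulrA -expr2 sqrr_sign mul1r//.
rewrite /Bk; case: ifP => _; last exact: Id.
case: ifP => _; last first.
  rewrite (_ : (fun z : R => _) = (fun _ => 0)); last by apply/funext => z; rewrite mulr0.
  split; first exact: integrable0.
  by rewrite integral0_eq// => z _; rewrite mulr0.
have [I1 E1] := Id a; have [I2 E2] := Id2.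
split.
  have := integrableD measurableT I1 I2; congr (_.-integrable _ _).
  by apply/funext => z; rewrite /= mulrDr.
under eq_integral do rewrite mulrDr EFinD.
by rewrite integralD// E1 E2.
Qed.

Lemma DPhi_conv b s c (x : Rn) (a : seq 'I_n.+1) (y : Rn) : 0 < s -> 0 < c ->
  lebn.-integrable setT (fun z => (Gam c (x - z) * DPhi b s z a y)%:E) /\
  (\int[lebn]_z (Gam c (x - z) * DPhi b s z a y)%:E = (DPhi b (s + c) x a y)%:E)%E.
Proof.
move=> s0 c0.
have := @integral_prod_rV R n.+1
  (fun j (z : R) => gam c (x ord0 j - z) * Bk b s j z (count_mem j a) (y ord0 j))
  (fun j => Bk b (s + c) j (x ord0 j) (count_mem j a) (y ord0 j)).
have e (z : Rn) : \prod_j (gam c (x ord0 j - z ord0 j) * Bk b s j (z ord0 j) (count_mem j a) (y ord0 j)) =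
    Gam c (x - z) * DPhi b s z a y.
  rewrite big_split/=; congr (_ * _).
  by apply: eq_bigr => j _; rewrite !mxE.
under eq_fun do rewrite e.
by apply => j; have [] := Bk_conv b j (x ord0 j) (y ord0 j) (count_mem j a) s0 c0.
Qed.

End kernels_conv.

(** * The semigroup law for distributions *)

Section rounding.
Context {R : realType}.

(** Rounding goes down to the grid of mesh 1/(N+1) on [-(N+1), N+1], outside points going to the
    nearest end. The shift by N+1 makes the argument of [Num.truncn] nonnegative, and the result
    takes finitely many values. *)
Definition clamp (N : nat) (a : R) : R :=
  if a < - N.+1%:R then 0 else if N.+1%:R < a then 2 * N.+1%:R else a + N.+1%:R.

Definition cell (N : nat) (a : R) : nat := Num.truncn (clamp N a * N.+1%:R).

Definition gridpt (N i : nat) : R := i%:R / N.+1%:R - N.+1%:R.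

Definition rd (N : nat) (a : R) : R := gridpt N (cell N a).

Lemma clamp_ge0 N a : 0 <= clamp N a <= 2 * N.+1%:R.
Proof.
have N0 : 0 <= N.+1%:R :> R by [].
rewrite /clamp; case: ltP => h1; first by rewrite lexx mulr_ge0.
case: ltP => h2; first by rewrite lexx mulr_ge0.
by apply/andP; split; lra.
Qed.

Lemma clamp_mono N a c : a <= c -> clamp N a <= clamp N c.
Proof.
move=> ac; have N0 : 0 <= N.+1%:R :> R by [].
rewrite /clamp; case: (ltP a) => h1; first by case/andP: (clamp_ge0 N c).
have h3 := le_trans h1 ac; rewrite (ltNge c) h3 /=.
case: (ltP _ a) => h2; first by rewrite (lt_le_trans h2).
by case: ltP => h4; lra.
Qed.

Lemma cell_lt N a : (cell N a < (2 * N.+1 * N.+1).+1)%N.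
Proof.
rewrite ltnS /cell; have /andP[c0 c1] := clamp_ge0 N a.
have c2 : 0 <= clamp N a * N.+1%:R by rewrite mulr_ge0.
have /andP[h _] := truncn_itv c2.
rewrite -(ler_nat R); apply: (le_trans h).
by rewrite !natrM ler_wpM2r.
Qed.

Lemma rd_mono N a c : a <= c -> rd N a <= rd N c.
Proof.
move=> ac; rewrite /rd /gridpt lerD2r ler_wpM2r ?invr_ge0// ler_nat /cell.
by apply: le_truncn; rewrite ler_wpM2r// clamp_mono.
Qed.

Lemma measf_rd N : measurable_fun setT (rd N).
Proof. by apply: nondecreasing_measurable => // a c ac; exact: rd_mono. Qed.

Lemma rd_clamp N a : - N.+1%:R + clamp N a - N.+1%:R^-1 <= rd N a <= - N.+1%:R + clamp N a.
Proof.
have N0 : 0 < N.+1%:R :> R by [].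
have /andP[c0 c1] := clamp_ge0 N a.
have c2 : 0 <= clamp N a * N.+1%:R by rewrite mulr_ge0.
have /andP[h1 h2] := truncn_itv c2; rewrite -/(cell N a) in h1 h2.
rewrite /rd /gridpt [_ - N.+1%:R]addrC -addrA !lerD2l; apply/andP; split.
  rewrite -(ler_pM2r N0) mulrBl mulVf ?gt_eqF// divfK ?gt_eqF//.
  by move: h2; rewrite -natr1; lra.
by rewrite ler_pdivrMr.
Qed.

Lemma rd_close N a : `|a| <= N.+1%:R -> `|a - rd N a| <= N.+1%:R^-1.
Proof.
rewrite ler_norml => /andP[h1 h2]; have /andP[] := rd_clamp N a.
have -> : clamp N a = a + N.+1%:R by rewrite /clamp !ltNge h1 h2.
have i0 : 0 <= N.+1%:R^-1 :> R by rewrite invr_ge0.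
move: i0; move: (N.+1%:R^-1 : R) (N.+1%:R : R) (rd N a) => I K r i0 h3 h4.
by rewrite ler_norml; apply/andP; split; lra.
Qed.

Lemma rd_le N a : `|rd N a| <= `|a| + 1.
Proof.
have K1 : 1 <= N.+1%:R :> R by rewrite ler1n.
have i0 : 0 <= N.+1%:R^-1 :> R by rewrite invr_ge0.
have i1 : N.+1%:R^-1 <= 1 :> R by rewrite invf_le1.
have [aN|aN] := leP `|a| N.+1%:R.
  have := rd_close aN => h; rewrite -[rd N a](subKr a).
  apply: (le_trans (ler_normB _ _)); rewrite lerD2l; exact: le_trans i1.
have /andP[c0 c1] := clamp_ge0 N a; have /andP[h1 h2] := rd_clamp N a.
move: K1 i0 i1 aN c0 c1 h1 h2; rewrite ler_norml /clamp.
have := ler_norm a; have := ler_norm (- a); rewrite normrN.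
move: `|a| (N.+1%:R^-1 : R) (N.+1%:R : R) (rd N a) => A I K r u v K1 i0 i1 aN.
by case: ltP => h1; [|case: ltP => h2]; move=> c0 c1 h3 h4; apply/andP; split; lra.
Qed.

Lemma gridpt_inj N : injective (gridpt N).
Proof.
move=> i j /addIr/mulIf; rewrite invr_neq0 ?pnatr_eq0// => /(_ isT)/eqP.
by rewrite eqr_nat => /eqP.
Qed.

Lemma rd_dist N a : `|a - rd N a| <= 2 * (1 + `|a|).
Proof.
apply: (le_trans (ler_normB _ _)); have := rd_le N a; have := normr_ge0 a; lra.
Qed.

Lemma rd_cvg a : (fun N => `|a - rd N a|) @ \oo --> 0.
Proof.
have inv0 : (fun N : nat => N.+1%:R^-1 : R) @ \oo --> 0 by exact: cvg_harmonic.
apply: (squeeze_cvgr _ (cvg_cst 0) inv0).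
near=> N; rewrite normr_ge0 /=; apply: rd_close.
near: N; exists (Num.truncn `|a|) => // N /= h.
apply: (le_trans (ltW (Num.Theory.truncnS_gt _))).
by rewrite ler_nat ltnS.
Unshelve. all: by end_near.
Qed.

End rounding.

Section semigroup.
Context {R : realType} {n : nat}.
Local Notation Rn := 'rV[R]_n.+1.
Local Notation leb := (@lebesgue_measure R).
Local Notation lebn := (@lebesgue_rV R n.+1).
Implicit Types (x y z : Rn) (s t c : R) (b : bool) (j : 'I_n.+1).

Definition rdV (N : nat) z : Rn := \row_j rd N (z ord0 j).

Local Notation gidx N := {ffun 'I_n.+1 -> 'I_(2 * N.+1 * N.+1).+1}.

Definition gpt N (rho : gidx N) : Rn := \row_j gridpt N (rho j).

Definition gind N (rho : gidx N) z : R :=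
  \prod_j (if rd N (z ord0 j) == gridpt N (rho j) then 1 else 0).

(** Exactly one grid index matches the rounded coordinates of z. A function of the rounded point is
    thus a finite combination of fixed indicators, so its integral becomes a finite sum, with which
    the functional commutes. *)
Lemma gind_sum N (h : Rn -> R) z :
  h (rdV N z) = \sum_(rho : gidx N) gind rho z * h (gpt rho).
Proof.
pose r0 : gidx N := [ffun j => Ordinal (cell_lt N (z ord0 j))].
have rE j : gridpt N (r0 j) = rd N (z ord0 j) by rewrite ffunE.
rewrite (bigD1 r0)//= big1.
  rewrite addr0 /gind big1; last by move=> j _; rewrite rE eqxx.
  rewrite mul1r; congr h; apply/rowP => j; rewrite !mxE rE//.
move=> rho rho0; have [j rj] : exists j, rho j != r0 j.
  apply/existsP; rewrite -negb_forall; apply: contra rho0 => /forallP h'.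
  by apply/eqP/ffunP => j; apply/eqP.
rewrite /gind (bigD1 j)//= -rE ifF ?mul0r//.
apply/negbTE; apply: contra rj => /eqP/gridpt_inj e.
by apply/eqP/val_inj; rewrite /= e.
Qed.

Lemma measf_gind N (rho : gidx N) : measurable_fun setT (gind rho).
Proof.
apply: measf_prod => j; apply: measf_if; [exact: measurableT| |exact: measf_cst|exact: measf_cst].
apply: measurable_fun_eqr; last exact: measf_cst.
apply: (measurableT_comp (measf_rd N)); exact: measurable_rV_coord.
Qed.

Lemma gind01 N (rho : gidx N) z : 0 <= gind rho z <= 1.
Proof.
rewrite /gind; apply/andP; split; first by apply: prodr_ge0 => j _; case: ifP.
by apply: prodr_ile1 => j _; case: ifP => _; rewrite ?ler01 ?lexx.
Qed.

Lemma wt_rdV k N z : wt k (rdV N z) <= (2 ^+ k) ^+ n.+1 * wt k z.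
Proof.
rewrite /wt (_ : (2 ^+ k) ^+ n.+1 = \prod_(j < n.+1) 2 ^+ k :> R); last first.
  by rewrite prodr_const card_ord.
rewrite -big_split/=; apply: ler_prod => j _; rewrite exprn_ge0 ?addr_ge0//=.
rewrite -exprMn lerXn2r ?nnegrE ?mulr_ge0 ?addr_ge0// mxE.
have := rd_le N (z ord0 j); have := normr_ge0 (z ord0 j); lra.
Qed.

Lemma wtM k l z : wt k z * wt l z = wt (k + l) z.
Proof. by rewrite /wt -big_split/=; apply: eq_bigr => j _; rewrite exprD. Qed.

Lemma wt1_coord z j : 1 + `|z ord0 j| <= wt 1 z.
Proof.
rewrite /wt (bigD1 j)//= expr1 ler_peMr ?addr_ge0//.
by elim/big_rec: _ => // i u _ u1; rewrite expr1 mulr_ege1// lerDl.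
Qed.

Lemma measf_wt k : measurable_fun setT (wt k : Rn -> R).
Proof.
apply: measf_prod => j; apply: measfX; apply: measfD; first exact: measf_cst.
by apply: measf_norm; exact: measurable_rV_coord.
Qed.

Lemma Gam_wt_integrable c x k : 0 < c ->
  lebn.-integrable setT (fun z => (Gam c (x - z) * wt k z)%:E).
Proof.
move=> c0.
pose f j (a : R) := gam c (x ord0 j - a) * (1 + `|a|) ^+ k.
have If j : leb.-integrable setT (EFin \o f j).
  have [M [M0 HM]] := dgam_bound 0 k c0; have c20 : 0 < 2 * c by rewrite mulr_gt0.
  have mf : measurable_fun setT (f j) by rewrite /f; meas.
  apply: (@le_integrable _ _ _ leb setT measurableT _ (fun a =>
    ((M * (1 + `|x ord0 j|) ^+ k)%:E * (gam (2 * c) (x ord0 j - a))%:E)%E)).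
  - exact: measfE.
  - move=> a _; rewrite /f /= lee_fin normrM (ger0_norm (gam_ge0 _ _)).
    rewrite [X in _ * X <= _]ger0_norm ?exprn_ge0 ?addr_ge0//.
    have r0 : 0 <= M * (1 + `|x ord0 j|) ^+ k * gam (2 * c) (x ord0 j - a).
      apply: mulr_ge0; last exact: gam_ge0.
      by rewrite mulr_ge0// exprn_ge0// addr_ge0.
    rewrite [leRHS](ger0_norm r0).
    have := HM (x ord0 j - a); rewrite dgam0 (ger0_norm (gam_ge0 _ _)) => H.
    have := weight_add k a (x ord0 j); rewrite distrC => W.
    apply: (le_trans (ler_wpM2l (gam_ge0 _ _) W)).
    rewrite mulrA [gam _ _ * _]mulrC [leRHS]mulrAC.
    by rewrite ler_wpM2r ?exprn_ge0 ?addr_ge0.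
  - by apply: integrableZl => //; exact: integrable_gam.
have [I _] := @integral_prod_rV R n.+1 f (fun j => \int[leb]_a f j a) If
  (fun j => esym (Rintegral_EFin (If j))).
congr (_.-integrable _ _): I; apply/funext => z; rewrite /f big_split/=; congr (_ * _)%:E.
by apply: eq_bigr => j _; rewrite !mxE.
Qed.

Variable (T : (Rn -> R) -> R).
Hypothesis tT : tempered_on Omega T.

(** The heat evolution seen from the side b and extended evenly in z: it obeys the semigroup law of
    the whole space, which the Neumann evolution read on both sides at once does not. *)
Definition vb b z s : R := T (Phi b s z).

Lemma vb_bounds s : 0 < s -> exists (k : nat) (L : R), [/\ 0 <= L,
  (forall b z, `|vb b z s| <= L * wt k z) &
  (forall b z z', `|vb b z s - vb b z' s| <=
     L * (wt k z * wt k z') * \sum_j `|z ord0 j - z' ord0 j|)].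
Proof.
move=> s0; have [k [C [C0 HC]]] := T_bound tT.
have [M [M0 HB HL]] := @DPhi_bounds R n s k s0.
exists k, (C * M); split; first by rewrite mulr_ge0.
- move=> b z; rewrite -mulrA; apply: HC (sjet_Phi b z s0) _ => a y ak _.
  exact: HB.
- move=> b z z'.
  rewrite (_ : C * M * _ * _ = C * (M * (wt k z * wt k z') * \sum_j `|z ord0 j - z' ord0 j|)); last by rewrite !mulrA.
  apply: (T_diff tT HC (sjet_Phi b z s0) (sjet_Phi b z' s0)) => a y ak _.
  exact: HL.
Qed.

Lemma measf_rdV N : measurable_fun setT (rdV N).
Proof.
apply: measf_rV => j; rewrite (_ : (fun z => _) = (fun z : Rn => rd N (z ord0 j))).
  by apply: (measurableT_comp (measf_rd N)); exact: measurable_rV_coord.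
by apply/funext => z; rewrite mxE.
Qed.

(** h is arbitrary: only its finitely many values on the grid matter. *)
Lemma measf_rounded N (h : Rn -> R) : measurable_fun setT (fun z => h (rdV N z)).
Proof.
rewrite (_ : (fun z => _) = (fun z => \sum_(rho : gidx N) gind rho z * h (gpt rho))).
  apply: measf_sum => rho; apply: measfM; [exact: measf_gind|exact: measf_cst].
by apply/funext => z; rewrite gind_sum.
Qed.

Lemma dist_cvg z : (fun N => \sum_j `|z ord0 j - rdV N z ord0 j|) @ \oo --> 0.
Proof.
rewrite [X in _ --> X](_ : 0 = \sum_(j < n.+1) 0); last by rewrite big1.
apply: cvg_sumr => j; rewrite (_ : (fun N => _) = (fun N => `|z ord0 j - rd N (z ord0 j)|)).
  exact: rd_cvg.
by apply/funext => N; rewrite mxE.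
Qed.

Lemma vb_cvg b s z : 0 < s -> (fun N => vb b (rdV N z) s) @ \oo --> vb b z s.
Proof.
move=> s0; have [k [L [L0 _ HL]]] := vb_bounds s0.
apply/subr_cvg0; apply: norm_cvg0.
pose c := L * ((2 ^+ k) ^+ n.+1 * wt k z * wt k z).
have cv : (fun N => c * \sum_j `|z ord0 j - rdV N z ord0 j|) @ \oo --> 0.
  by rewrite -[X in _ --> X](mulr0 c); apply: cvgM; [exact: cvg_cst|exact: dist_cvg].
apply: (squeeze_cvgr _ (cvg_cst 0) cv); apply: nearW => N.
rewrite normr_ge0 /= distrC; apply: (le_trans (HL b z (rdV N z))).
rewrite ler_wpM2r ?sumr_ge0// /c ler_wpM2l// mulrC ler_wpM2r ?wt_ge0//.
exact: wt_rdV.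
Qed.

Lemma measf_vb b s : 0 < s -> measurable_fun setT (fun z => vb b z s).
Proof.
move=> s0; apply: (@measurable_fun_cvg _ _ _ _ (fun N z => vb b (rdV N z) s)).
  by move=> N; exact: (measf_rounded N (fun z => vb b z s)).
by move=> z _; exact: vb_cvg.
Qed.

Lemma Gam_vb_integrable b s c x : 0 < s -> 0 < c ->
  lebn.-integrable setT (fun z => (Gam c (x - z) * vb b z s)%:E).
Proof.
move=> s0 c0; have [k [L [L0 HB _]]] := vb_bounds s0.
have mv := measf_vb b s0.
have m : measurable_fun setT (fun z : Rn => Gam c (x - z) * vb b z s).
  by apply: measfM => //; meas.
apply: (le_integrable measurableT (measfE m) _
  (integrableZl measurableT L (Gam_wt_integrable x k c0))) => z _.
rewrite /= lee_fin normrM (ger0_norm (Gam_ge0 _ _)).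
rewrite [leRHS]ger0_norm ?mulr_ge0 ?Gam_ge0 ?wt_ge0//.
by rewrite [leRHS]mulrCA ler_wpM2l ?Gam_ge0.
Qed.

Lemma Rintegral_sum (I : Type) (r : seq I) (F : I -> Rn -> R) :
  (forall i, lebn.-integrable setT (fun z => (F i z)%:E)) ->
  \int[lebn]_z (\sum_(i <- r) F i z) = \sum_(i <- r) \int[lebn]_z F i z.
Proof.
move=> IF; rewrite {1}/Rintegral; under eq_integral do rewrite -sumEFin.
rewrite integral_sum//.
rewrite (eq_bigr (fun i => (\int[lebn]_z F i z)%:E)); first by rewrite sumEFin.
by move=> i _; rewrite (Rintegral_EFin (IF i)).
Qed.

Lemma gind_integral N (h : Rn -> R) c x : 0 < c ->
  \int[lebn]_z (Gam c (x - z) * h (rdV N z)) =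
  \sum_(rho : gidx N) (\int[lebn]_z (Gam c (x - z) * gind rho z)) * h (gpt rho).
Proof.
move=> c0; have Ir (rho : gidx N) : lebn.-integrable setT (fun z => (Gam c (x - z) * gind rho z)%:E).
  have m : measurable_fun setT (fun z : Rn => Gam c (x - z) * gind rho z).
    by apply: measfM; [meas|exact: measf_gind].
  apply: (le_integrable measurableT (measfE m) _ (Gam_wt_integrable x 0 c0)) => z _.
  rewrite /= lee_fin normrM (ger0_norm (Gam_ge0 _ _)).
  rewrite [leRHS]ger0_norm ?mulr_ge0 ?Gam_ge0 ?wt_ge0//.
  have /andP[g0 g1] := gind01 rho z.
  by rewrite ler_wpM2l ?Gam_ge0// ger0_norm// (le_trans g1)// wt_ge1.
transitivity (\int[lebn]_z (\sum_(rho : gidx N) h (gpt rho) * (Gam c (x - z) * gind rho z))).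
  apply: eq_Rintegral => z _; rewrite gind_sum mulr_sumr.
  by apply: eq_bigr => rho _; ring.
rewrite Rintegral_sum; last by move=> rho; exact: (integrableZl measurableT _ (Ir rho)).
by apply: eq_bigr => rho _; rewrite (RintegralZl _ measurableT (Ir rho)) mulrC.
Qed.

(** Both sides are compared with the finite sum obtained by rounding the pole: one error is a
    seminorm of kernels estimated through continuity of the functional, the other the effect of
    rounding on [vb]. The same integral of [u N] controls both and tends to 0. *)
Lemma vb_semigroup b s c x : 0 < s -> 0 < c ->
  vb b x (s + c) = \int[lebn]_z (Gam c (x - z) * vb b z s).
Proof.
move=> s0 c0; have sc0 : 0 < s + c by rewrite addr_gt0.
have [k [C [C0 HC]]] := T_bound tT.
have [M [M0 HB HL]] := @DPhi_bounds R n s k s0.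
pose W (z : Rn) := Gam c (x - z).
have W0 z : 0 <= W z by exact: Gam_ge0.
have mW : measurable_fun setT W by rewrite /W; meas.
pose dd N (z : Rn) := \sum_j `|z ord0 j - rdV N z ord0 j|.
have mdd N : measurable_fun setT (dd N).
  apply: measf_sum => j; apply: measf_norm; apply: measfB; first exact: measurable_rV_coord.
  exact: (measurableT_comp (measurable_rV_coord j) (measf_rdV N)).
(* The first factor comes from the weight of the rounded pole, the second from the crude distance
   bound [rd_dist] summed over coordinates; that distance also costs the extra 1 in the exponent k +
   k + 1 of [dom]. *)
pose K : R := (2 ^+ k) ^+ n.+1 * (n.+1%:R * 2).
pose u N (z : Rn) := W z * (M * (wt k z * wt k (rdV N z)) * dd N z).
pose dom (z : Rn) := M * K * (W z * wt (k + k + 1) z).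
have dd0 N z : 0 <= dd N z by rewrite sumr_ge0.
have mu N : measurable_fun setT (u N).
  have m1 := measf_rounded N (wt k : Rn -> R); have m2 := @measf_wt k; have m3 := mdd N.
  by rewrite /u; apply: measfM => //; apply: measfM => //; apply: measfM; [exact: measf_cst|apply: measfM].
have u0 N z : 0 <= u N z by rewrite /u mulr_ge0// mulr_ge0// mulr_ge0// mulr_ge0 ?wt_ge0.
have ud N z : `|u N z| <= dom z.
  rewrite (_ : dom z = W z * (M * (K * wt (k + k + 1) z))); last by rewrite /dom; ring.
  rewrite ger0_norm// /u ler_wpM2l// -[leLHS]mulrA ler_wpM2l// -wtM -wtM /K.
  have h1 : dd N z <= n.+1%:R * 2 * wt 1 z.
    rewrite /dd; apply: (@le_trans _ _ (\sum_(j < n.+1) 2 * wt 1 z)).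
      apply: ler_sum => j _; rewrite mxE; apply: (le_trans (rd_dist _ _)).
      by rewrite ler_wpM2l// wt1_coord.
    by rewrite sumr_const card_ord -[_ *+ n.+1]mulr_natl mulrA.
  have h2 := wt_rdV k N z.
  apply: (@le_trans _ _ (wt k z * ((2 ^+ k) ^+ n.+1 * wt k z) * (n.+1%:R * 2 * wt 1 z))).
    rewrite ler_pM ?mulr_ge0 ?wt_ge0// ler_wpM2l ?wt_ge0//.
  by rewrite le_eqVlt; apply/orP; left; apply/eqP; ring.
have Idom : lebn.-integrable setT (EFin \o dom).
  exact: (integrableZl measurableT (M * K) (Gam_wt_integrable x (k + k + 1) c0)).
have ucv z : (fun N => u N z) @ \oo --> (0 : R).
  pose q := W z * (M * (wt k z * ((2 ^+ k) ^+ n.+1 * wt k z))).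
  have cv : (fun N => q * dd N z) @ \oo --> 0.
    by rewrite -[X in _ --> X](mulr0 q); apply: cvgM; [exact: cvg_cst|exact: dist_cvg].
  apply: (squeeze_cvgr _ (cvg_cst 0) cv); apply: nearW => N.
  rewrite u0 /= /u /q -[leRHS]mulrA ler_wpM2l// ler_wpM2r// ler_wpM2l// ler_wpM2l ?wt_ge0//.
  exact: wt_rdV.
have [_] := @Rdominated R _ _ lebn u (fun _ => 0) dom mu ucv Idom ud.
rewrite (_ : \int[lebn]_z 0 = 0); last by rewrite /Rintegral integral0.
move=> eN; have Iu N : lebn.-integrable setT (EFin \o u N).
  by apply: (le_integrable measurableT (measfE (mu N)) _ Idom) => z _;
    rewrite /= lee_fin (le_trans (ud N z))// ler_norm.
have key N : `|vb b x (s + c) - \int[lebn]_z (W z * vb b z s)| <= 2 * C * \int[lebn]_z u N z.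
  pose m (rho : gidx N) := \int[lebn]_z (W z * gind rho z).
  have [sPsi TPsi] := T_sum tT (index_enum (gidx N)) m
     (fun rho => sjet_Phi b (gpt rho) s0).
  have TE : T (fun y => \sum_(rho : gidx N) m rho * Phi b s (gpt rho) y) =
      \int[lebn]_z (W z * vb b (rdV N z) s).
    by rewrite TPsi (gind_integral N (fun z => vb b z s) x c0).
  have mr : measurable_fun setT (fun z => W z * vb b (rdV N z) s).
    by apply: measfM => //; exact: (measf_rounded N (fun z => vb b z s)).
  have d1 : `|vb b x (s + c) - \int[lebn]_z (W z * vb b (rdV N z) s)| <= C * \int[lebn]_z u N z.
    rewrite -TE; apply: (T_diff tT HC (sjet_Phi b x sc0) sPsi) => a y ak _.
    have [Ic Ec] := DPhi_conv b x a y s0 c0.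
    have Ir : lebn.-integrable setT (fun z => (W z * DPhi b s (rdV N z) a y)%:E).
      have mD : measurable_fun setT (fun z => W z * DPhi b s (rdV N z) a y).
        by apply: measfM => //; exact: (measf_rounded N (fun z => DPhi b s z a y)).
      have e0 : 0 < (1 + enorm y) ^+ k by rewrite exprn_gt0// ltr_pwDl// enorm_ge0.
      pose G := ((1 + enorm y) ^+ k)^-1 * M * (2 ^+ k) ^+ n.+1.
      have G0 : 0 <= G by rewrite !mulr_ge0 ?exprn_ge0// invr_ge0 ltW.
      apply: (le_integrable measurableT (measfE mD) _
        (integrableZl measurableT G (Gam_wt_integrable x k c0))) => z _.
      rewrite /= lee_fin normrM (ger0_norm (W0 z)).
      have r0 : 0 <= G * (W z * wt k z).
        by apply: mulr_ge0 => //; apply: mulr_ge0 => //; exact: wt_ge0.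
      rewrite [leRHS](ger0_norm r0) [leRHS]mulrCA ler_wpM2l//.
      rewrite /G -!mulrA ler_pdivlMl//; apply: (le_trans (HB b (rdV N z) a y ak)).
      by rewrite ler_wpM2l// wt_rdV.
    have -> : \sum_(rho : gidx N) m rho * DPhi b s (gpt rho) a y =
        \int[lebn]_z (W z * DPhi b s (rdV N z) a y).
      by rewrite (gind_integral N (fun z => DPhi b s z a y) x c0).
    have -> : DPhi b (s + c) x a y = \int[lebn]_z (W z * DPhi b s z a y).
      by rewrite /Rintegral Ec.
    rewrite -RintegralB//.
    have e0 : 0 <= (1 + enorm y) ^+ k by rewrite exprn_ge0// addr_ge0// enorm_ge0.
    have Id := integrableB measurableT Ic Ir.
    apply: (le_trans (ler_wpM2l e0 (le_normr_Rintegral measurableT Id))).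
    have Idn := integrable_norm Id.
    rewrite -RintegralZl//; apply: le_Rintegral => //.
      exact: (integrableZl measurableT _ Idn).
    move=> z _; rewrite -mulrBr normrM (ger0_norm (W0 z)) mulrCA /u ler_wpM2l//.
    apply: le_trans (HL b z (rdV N z) a y ak) _ => //.
  have d2 : `|\int[lebn]_z (W z * vb b (rdV N z) s) - \int[lebn]_z (W z * vb b z s)| <=
      C * \int[lebn]_z u N z.
    have Ivb := Gam_vb_integrable b x s0 c0.
    have vdiff z : `|W z * vb b (rdV N z) s - W z * vb b z s| <= C * u N z.
      rewrite -mulrBr normrM (ger0_norm (W0 z)) /u mulrCA ler_wpM2l// distrC.
      apply: (T_diff tT HC (sjet_Phi b z s0) (sjet_Phi b (rdV N z) s0)) => a y ak _.
      exact: HL.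
    have ICu : lebn.-integrable setT (fun z => (C * u N z)%:E) := integrableZl measurableT C (Iu N).
    have Id : lebn.-integrable setT (fun z => (W z * vb b (rdV N z) s - W z * vb b z s)%:E).
      have md : measurable_fun setT (fun z => W z * vb b (rdV N z) s - W z * vb b z s).
        by apply: measfB => //; apply: measfM => //; exact: measf_vb.
      apply: (le_integrable measurableT (measfE md) _ ICu) => z _.
      by rewrite /= lee_fin (le_trans (vdiff z))// ler_norm.
    have Ir : lebn.-integrable setT (fun z => (W z * vb b (rdV N z) s)%:E).
      have := integrableD measurableT Id Ivb; congr (_.-integrable _ _).
      by apply/funext => z /=; rewrite -EFinD /W subrK.
    rewrite -RintegralB// -RintegralZl//.
    apply: (le_trans (le_normr_Rintegral measurableT Id)).
    by apply: le_Rintegral => //; exact: (integrable_norm Id).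
  rewrite -(subrKA (\int[lebn]_z (W z * vb b (rdV N z) s))).
  apply: (le_trans (ler_normD _ _)); apply: (le_trans (lerD d1 d2)).
  by rewrite -mulrA mulr_natl mulr2n.
have cv : (fun N => 2 * C * \int[lebn]_z u N z) @ \oo --> 0.
  by rewrite -[X in _ --> X](mulr0 (2 * C)); apply: cvgM; [exact: cvg_cst|exact: eN].
apply/eqP; rewrite -subr_eq0 -normr_le0.
by apply: (cvgr_to_ge cv); apply: nearW.
Qed.

End semigroup.

(** * The linear evolution *)

Section linear.
Context {R : realType} {n : nat}.
Local Notation Rn := 'rV[R]_n.+1.
Local Notation leb := (@lebesgue_measure R).
Local Notation lebn := (@lebesgue_rV R n.+1).
Local Notation mu := (@stm R n.+1).
Implicit Types (x y z : Rn) (s t : R) (b : bool).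

Lemma poweR_half_le (a e : R) (I : \bar R) : 0 < a -> 0 <= e -> (0 <= I)%E ->
  (((a^-1)%:E * I) `^ 2^-1 <= e%:E)%E <-> (I <= (e ^+ 2 * a)%:E)%E.
Proof.
move=> a0 e0; case: I => [r|_|]; last by [].
  rewrite lee_fin => r0; rewrite -EFinM poweR_EFin !lee_fin.
  have ar : 0 <= a^-1 * r by rewrite mulr_ge0// invr_ge0 ltW.
  rewrite powR12_sqrt// -(ler_sqr (x := Num.sqrt _)) ?nnegrE ?sqrtr_ge0// sqr_sqrtr//.
  by rewrite ler_pdivrMl// mulrC.
by rewrite gt0_muley ?lte_fin ?invr_gt0// poweRyr ?invr_neq0.
Qed.

Lemma eball_sqrt x t y : 0 < t -> eball x (Num.sqrt t) y <-> sqn (y - x) < t.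
Proof. by move=> t0; rewrite /eball /= /enorm -/(sqn (y - x)) ltr_sqrt. Qed.

(** u is only known to agree with U almost everywhere on each time slice; the iterated integral is
    unchanged and Tonelli is applied to U. *)
Lemma tent_intE (u : R -> Rn -> R) (U : Rn * R -> R) x t : measurable_fun setT U ->
  (forall s, 0 < s -> {ae lebn, forall y, u s y = U (y, s)}) -> 0 < t ->
  (\int[leb]_(s in `]0%R, t[) \int[lebn]_(y in eball x (Num.sqrt t)) (u s y ^+ 2)%:E =
   \int[mu]_z (if cyl x t z then U z ^+ 2 else 0)%:E)%E.
Proof.
move=> mU uU t0; rewrite integral_mkcond.
rewrite stm_fubini2; last 2 first.
- by meas.
- by move=> z; case: ifP => // _; exact: sqr_ge0.
apply: eq_integral => s _; rewrite patchE; case: ifPn; rewrite ?inE ?notin_setE /= in_itv/=.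
  move=> st; have /andP[s0 _] := st.
  rewrite (integral_if lebn (p := fun y => sqn (y - x) < t)); last first.
    by move=> y; exact: eball_sqrt.
  apply: integral_ae; apply: aeS (uU s s0) => y -> /=.
  by rewrite /cyl /= st.
move=> /negP st; rewrite integral0_eq// => y _.
by rewrite /cyl /= (negbTE st).
Qed.

Section heat.
Variable (T : (Rn -> R) -> R).
Hypothesis tT : tempered_on Omega T.

(** The two kernels differ on the hyperplane, where [heaviside] is 1 and [sgb] is false, but they
    share a jet on Omega. *)
Lemma heat_vb t x : 0 < t -> xn x != 0 -> neumann_heat t T x = vb T (0 < xn x) x t.
Proof.
move=> t0 x0; have [[jP _] bP] := sjet_Phi (0 < xn x) x t0.
apply: (T_eq tT (D := DPhi (0 < xn x) t x)); last exact: sjet_Phi.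
split=> //; split=> // y Oy; rewrite neumann_kernelE// /DPhi.
apply: eq_bigr => j _; rewrite /kfac /Bk /=; case: eqP => [->|_].
  rewrite -/(xn x) -/(xn y) !dgam0 -[gam t (xn x - _)]gamN opprB [xn x + _]addrC /heaviside.
  have y0 : xn y != 0 by [].
  rewrite /sgb; case: (ltP 0 (xn x)) x0 => [x1 _|x1 x0].
    by rewrite pmulr_rlt0//; case: ltgtP y0; rewrite ?mulr1 ?mulr0.
  have x2 : xn x < 0 by rewrite lt_neqAle x0.
  by rewrite nmulr_rlt0//; case: ltgtP y0; rewrite ?mulr1 ?mulr0.
by rewrite dgam0 -[gam t _]gamN opprB.
Qed.

Lemma vb_refl b s z : vb T b (refl z) s = vb T b z s.
Proof.
congr T; apply/funext => y; apply: eq_bigr => j _; rewrite /Bk.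
case: eqP => [->|/eqP jm]; last by rewrite refl_other.
by rewrite -/(xn (refl z)) refl_max opprK addrC.
Qed.

Definition vbm b (q : Rn * R) : R := if 0 < q.2 then vb T b q.1 q.2 else 0.

(** Joint measurability follows from the semigroup law: after time 1/(k+1) the evolution is a
    Gaussian integral of its slice at that time, which is measurable in space and time together, and
    every positive time is eventually reached. *)
Lemma measf_vbm b : measurable_fun setT (vbm b).
Proof.
pose F (k : nat) (q : Rn * R) : R := if k.+1%:R^-1 < q.2 then
  \int[lebn]_z (Gam (q.2 - k.+1%:R^-1) (q.1 - z) * vb T b z k.+1%:R^-1) else 0.
apply: (@measurable_fun_cvg _ _ _ _ F) => [k|q _].
  apply: measf_if; [exact: measurableT|by meas| |exact: measf_cst].
  have mv : measurable_fun setT (fun z => vb T b z k.+1%:R^-1).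
    by apply: measf_vb => //; rewrite invr_gt0.
  have mq : measurable_fun setT (fun p : (Rn * R) * Rn =>
      Gam (p.1.2 - k.+1%:R^-1) (p.1.1 - p.2) * vb T b p.2 k.+1%:R^-1).
    by apply: measfM; [by meas|apply: (measurableT_comp mv); meas].
  exact: (@measf_Rint1 R _ _ _ _ lebn _ mq).
rewrite /vbm; case: ltP => q0.
  apply: cvg_near_cst; near=> k; rewrite /F.
  have kq : k.+1%:R^-1 < q.2.
    near: k; have inv0 : (fun N : nat => N.+1%:R^-1 : R) @ \oo --> 0 by exact: cvg_harmonic.
    exact: cvgr_lt inv0 _ q0.
  have k0 : 0 < k.+1%:R^-1 :> R by rewrite invr_gt0.
  rewrite kq -(vb_semigroup tT)//; last by rewrite subr_gt0.
  by rewrite addrC subrK.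
apply: cvg_near_cst; apply: nearW => k; rewrite /F ifF//.
by apply/negbTE; rewrite -leNgt (le_trans q0)// invr_ge0.
Unshelve. all: by end_near.
Qed.

(** Jensen's inequality: m is the Gaussian mean of the slice at time s, and the integral of the
    kernel against (v - m)^2 is nonnegative. *)
Lemma vb_sqr_le b x s c : 0 < s -> 0 < c ->
  ((vb T b x (s + c) ^+ 2)%:E <= \int[lebn]_z (Gam c (x - z) * vb T b z s ^+ 2)%:E)%E.
Proof.
move=> s0 c0; set m := vb T b x (s + c).
have IG : lebn.-integrable setT (fun z => (Gam c (x - z))%:E).
  apply: normP_integrable; first by meas.
  under eq_integral do rewrite ger0_norm ?Gam_ge0//.
  by rewrite integral_Gam// ltry.
have Iv := Gam_vb_integrable tT b x s0 c0.
have mv := measf_vb tT b s0.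
have I1 := integrableZl measurableT (2 * m) Iv.
have I2 := integrableZl measurableT (m ^+ 2) IG.
have I3 := integrableB measurableT I1 I2.
have e : (\int[lebn]_z (2 * m * (Gam c (x - z) * vb T b z s) - m ^+ 2 * Gam c (x - z))%:E = (m ^+ 2)%:E)%E.
  rewrite [LHS](integralB measurableT I1 I2) integralZl// integralZl// integral_Gam//.
  rewrite -Rintegral_EFin// -vb_semigroup// -/m mule1 -EFinM -EFinB; congr EFin; ring.
rewrite -[X in (X <= _)%E]e.
have G0 z : 0 <= Gam c (x - z) * vb T b z s ^+ 2 by rewrite mulr_ge0 ?Gam_ge0 ?sqr_ge0.
have [h|h] := ltP (\int[lebn]_z (Gam c (x - z) * vb T b z s ^+ 2)%:E)%E +oo%E; last first.
  by rewrite (le_trans _ h)// leey.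
have I4 : lebn.-integrable setT (fun z => (Gam c (x - z) * vb T b z s ^+ 2)%:E).
  apply: normP_integrable; first by apply: measfM; [by meas|apply: measfX].
  by under eq_integral do rewrite ger0_norm//.
apply: le_integral => // z _; rewrite lee_fin.
have := mulr_ge0 (Gam_ge0 c (x - z)) (sqr_ge0 (vb T b z s - m)); lra.
Qed.

End heat.

End linear.

Section linear_bounds.
Context {R : realType} {n : nat}.
Local Notation Rn := 'rV[R]_n.+1.
Local Notation leb := (@lebesgue_measure R).
Local Notation lebn := (@lebesgue_rV R n.+1).
Local Notation mu := (@stm R n.+1).

Lemma heat_bounds : exists H : R, 1 <= H /\
  forall T (e : R), tempered_on Omega T -> 0 < e -> (bmo_norm T < e%:E)%E ->
  exists V : Rn * R -> R, [/\ measurable_fun setT V,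
    (forall x t, 0 < t -> xn x != 0 -> V (x, t) = neumann_heat t T x),
    tent (fun q => V q ^+ 2) (e ^+ 2) &
    forall q, Num.sqrt q.2 * `|V q| <= H * e].
Proof.
have [K [K0 HK]] := @gauss_tent R n 1 ltr01.
(* The integration over s < t/2 gives (t/2) v^2 <= c2 K (2 e^2), hence the 4; in the witness, (1 +
   A)^2 >= A allows taking a square root. *)
pose A := 4 * @c2 R n.+1 * K; have A0 : 0 <= A by rewrite !mulr_ge0// c2_ge0.
exists (1 + A); split; first by lra.
move=> T e tT e0 Te.
pose V (q : Rn * R) : R := if 0 < xn q.1 then vbm T true q else
  if xn q.1 < 0 then vbm T false q else 0.
have mxn : measurable_fun setT (fun q : Rn * R => xn q.1) by apply: measf_xn; meas.
have mV : measurable_fun setT V.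
  have m1 := measf_vbm tT true; have m2 := measf_vbm tT false.
  by rewrite /V; apply: measf_if; [by []|by meas|by []|apply: measf_if; [by []|by meas|by []|by meas]].
have VE x t : 0 < t -> xn x != 0 -> V (x, t) = neumann_heat t T x.
  move=> t0 x0; rewrite heat_vb// /V /vbm /= t0.
  by case: ltgtP x0.
have tV : tent (fun q => V q ^+ 2) (e ^+ 2).
  move=> x t t0.
  rewrite -(tent_intE (u := fun s y => neumann_heat s T y) x mV _ t0); last first.
    by move=> s s0; apply: aeS hyper_ae => y y0; rewrite VE.
  have s0 : 0 < Num.sqrt t ^+ n.+1 by rewrite exprn_gt0 ?sqrtr_gt0.
  rewrite (tpow_sqrt (ltW t0)); apply: (proj1 (poweR_half_le s0 (ltW e0) _)).
    by apply: integral_ge0 => s _; apply: integral_ge0 => y _; rewrite lee_fin sqr_ge0.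
  apply: (le_trans _ (ltW Te)); apply: ereal_sup_ubound.
  exists x, (Num.sqrt t); split; first by rewrite sqrtr_gt0.
  by rewrite sqr_sqrtr ?ltW.
(* The average runs over the whole space. On the opposite side the even extension takes the value of
   V at the mirror point, whence the second term. *)
pose w q := V q ^+ 2 + V (reflq q) ^+ 2.
have mVr : measurable_fun setT (fun q => V (reflq q)).
  by apply: (measurableT_comp mV); apply: measf_reflq; meas.
have mw : measurable_fun setT w by apply: measfD; exact: measfX.
have w0 q : 0 <= w q by rewrite addr_ge0 ?sqr_ge0.
have tw : tent w (2 * e ^+ 2).
  have tVr := tent_refl (measfX 2 mV) (fun z : Rn * R => sqr_ge0 _) tV.
  move=> x t t0.
  have m1 : measurable_fun setT (fun z => if cyl x t z then V z ^+ 2 else 0).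
    by apply: measf_if; [by []|by meas|exact: measfX|exact: measf_cst].
  have m2 : measurable_fun setT (fun z => if cyl x t z then V (reflq z) ^+ 2 else 0).
    by apply: measf_if; [by []|by meas|exact: measfX|exact: measf_cst].
  rewrite (_ : (fun z => _) = (fun z => ((if cyl x t z then V z ^+ 2 else 0) +
    (if cyl x t z then V (reflq z) ^+ 2 else 0))%:E)); last first.
    by apply/funext => z; rewrite /w; case: ifP => //; rewrite addr0.
  rewrite ge0_integralDT//; try by move=> z; case: ifP => // _; exact: sqr_ge0.
  apply: (le_trans (leeD (tV x t t0) (tVr x t t0))).
  by rewrite -EFinD lee_fin -mulrA [leRHS]mulr_natl mulr2n.
have key b x t : 0 < t -> t * vb T b x t ^+ 2 <= A * e ^+ 2.
  move=> t0; set v := vb T b x t ^+ 2.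
  pose F (z : Rn * R) := if slab t z then Gam (1 * t) (x - z.1) * w z else 0.
  have mF : measurable_fun setT F.
    rewrite /F; apply: measf_if; [by []|by apply: measf_slab; meas| |exact: measf_cst].
    by apply: measfM => //; meas.
  have F0 z : 0 <= F z by rewrite /F; case: ifP => // _; rewrite mulr_ge0 ?Gam_ge0.
  have step s : 0 < s -> s < t / 2 ->
      (v%:E <= \int[lebn]_z (@c2 R n.+1 * F (z, s))%:E)%E.
    move=> s0 st; have c0 : 0 < t - s by lra.
    rewrite /v [in X in (X <= _)%E](_ : t = s + (t - s)); last by ring.
    apply: (le_trans (vb_sqr_le tT b x s0 c0)).
    apply: ae_ge0_le_integral => //.
    - by move=> z _; rewrite lee_fin mulr_ge0 ?Gam_ge0 ?sqr_ge0.
    - by apply: measfE; apply: measfM; [by meas|apply: measfX; exact: measf_vb].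
    - by move=> z _; rewrite lee_fin mulr_ge0 ?c2_ge0.
    - apply: measfE; apply: measfM; first exact: measf_cst.
      by apply: (measurableT_comp mF); meas.
    apply: aeS hyper_ae => z z0 _; rewrite lee_fin /F /slab /= s0 (_ : s < t)/=; last by lra.
    rewrite mulrA ler_pM ?Gam_ge0 ?sqr_ge0//.
      by rewrite mul1r; apply: Gam_le2 => //; lra.
    have rz0 : xn (refl z) != 0 by rewrite refl_max oppr_eq0.
    rewrite /w /reflq /= (VE z)// (VE (refl z))// !heat_vb// vb_refl refl_max oppr_gt0.
    by case: b {v}; case: ltgtP z0 => // _ _; rewrite ?lerDl ?lerDr sqr_ge0.
  have int1 : (\int[leb]_s (if (0 < s) && (s < t / 2) then v else 0)%:E = (t / 2 * v)%:E)%E.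
    rewrite (_ : (fun s => _) = (fun s => (v * (if (0 < s) && (s < t / 2) then 1 else 0))%:E)).
      rewrite ge0_integralZlT//; last 3 first.
      - by meas.
      - by move=> s; case: ifP.
      - exact: sqr_ge0.
      by rewrite integral_oo_itv ?divr_gt0// -EFinM subr0 mulrC.
    by apply/funext => s; case: ifP; rewrite ?mulr1 ?mulr0.
  have int2 : ((t / 2 * v)%:E <= \int[mu]_z (@c2 R n.+1 * F z)%:E)%E.
    rewrite stm_fubini2; last 2 first.
    - by apply: measfM => //; exact: measf_cst.
    - by move=> z; rewrite mulr_ge0 ?c2_ge0.
    rewrite -int1; apply: ge0_le_integral => //.
    - by move=> s _; rewrite lee_fin; case: ifP => // _; exact: sqr_ge0.
    - by apply: measfE; meas.
    - apply: (@measf_int2 R _ _ _ _ lebn (fun z => @c2 R n.+1 * F z)).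
        by apply: measfM => //; exact: measf_cst.
      by move=> z; rewrite mulr_ge0 ?c2_ge0.
    move=> s _; case: ifPn => [/andP[s0 st]|_]; first exact: step.
    by apply: integral_ge0 => z _; rewrite lee_fin mulr_ge0 ?c2_ge0.
  rewrite ge0_integralZlT ?c2_ge0// in int2.
  have hK := lee_wpmul2l (_ : (0 <= (@c2 R n.+1)%:E)%E) (HK w _ mw w0 tw x t t0).
  have := le_trans int2 (hK (@c2_ge0 R n.+1)); rewrite -EFinM lee_fin /A.
  clear step int1 int2 hK; clearbody v.
  by move: (@c2 R n.+1) v (e ^+ 2) => c v' E h; lra.
exists V; split => //.
have He : 0 <= (1 + A) * e by apply: mulr_ge0; [lra|exact: ltW].
move=> q; have [q0|q0] := ltP 0 q.2; last by rewrite ler0_sqrtr// mul0r.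
have k2 : q.2 * V q ^+ 2 <= A * e ^+ 2.
  rewrite /V /vbm q0; case: ifP => _; first exact: key.
  by case: ifP => _; [exact: key|rewrite expr0n/= mulr0 mulr_ge0// sqr_ge0].
rewrite -(ler_sqr (x := _ * _)) ?nnegrE ?(mulr_ge0 (sqrtr_ge0 _))//.
rewrite exprMn sqr_sqrtr ?(ltW q0)// real_normK ?num_real// (le_trans k2)//.
rewrite exprMn ler_wpM2r ?sqr_ge0// expr2.
by have := mulr_ge0 A0 A0; lra.
Qed.

End linear_bounds.

(** * The fixed point *)

Section bounds.
Context {R : realType} {n : nat}.
Local Notation Rn := 'rV[R]_n.+1.
Local Notation leb := (@lebesgue_measure R).
Local Notation lebn := (@lebesgue_rV R n.+1).
Local Notation mu := (@stm R n.+1).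
Implicit Types (U V W F f : Rn * R -> R).

Lemma ae_foralln d (T : measurableType d) (m : {measure set T -> \bar R}) (P : nat -> T -> Prop) :
  (forall k, {ae m, forall z, P k z}) -> {ae m, forall z, forall k, P k z}.
Proof.
move=> aP; have := negligible_bigcup aP; apply: negligibleS => z /= /existsNP[k nP].
by exists k.
Qed.

(** Mild solutions are determined almost everywhere on each slice, while the sup bound lives on
    space-time; Tonelli applied to the indicator of the exceptional set connects the two. *)
Lemma stm_ae (P : Rn * R -> bool) : measurable_fun setT P ->
  (forall t, 0 < t -> {ae lebn, forall x, P (x, t)}) ->
  {ae mu, forall z, 0 < z.2 -> P z}.
Proof.
move=> mP aP; pose F (z : Rn * R) : R := if (0 < z.2) && ~~ P z then 1 else 0.
have mF : measurable_fun setT F.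
  apply: measf_if; [by []| |exact: measf_cst|exact: measf_cst].
  by apply: measf_and; [by meas|apply: measurable_neg].
have F0 z : 0 <= F z by rewrite /F; case: ifP.
have : (\int[mu]_z `|(F z)%:E| = 0)%E.
  under eq_integral do rewrite abse_EFin ger0_norm//.
  rewrite stm_fubini2// integral0_eq// => t _.
  have [t0|t0] := ltP 0 t; last by apply: integral0_eq => x _; rewrite /F /= ltNge t0.
  rewrite (integral_ae (g := fun _ => 0%E)) ?integral0//.
  by apply: aeS (aP t t0) => x Px; rewrite /F /= Px andbF.
move=> /(ae_eq_integral_abs mu measurableT (measfE mF)).
apply: aeS => z /(_ I) /= [] + z0; rewrite /F z0 /=; case: (P z) => // /eqP.
by rewrite oner_eq0.
Qed.

Lemma tent_le2 F (f1 f2 : Rn * R -> R) (c1 c2 b1 b2 : R) :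
  measurable_fun setT F -> measurable_fun setT f1 -> measurable_fun setT f2 ->
  0 <= c1 -> 0 <= c2 -> (forall z, 0 <= f1 z) -> (forall z, 0 <= f2 z) ->
  (forall z, 0 <= F z) -> (forall z, F z <= c1 * f1 z + c2 * f2 z) ->
  tent f1 b1 -> tent f2 b2 -> tent F (c1 * b1 + c2 * b2).
Proof.
move=> mF m1 m2 c10 c20 f10 f20 F0 Fle t1 t2 x t t0.
pose g (f : Rn * R -> R) z := if cyl x t z then f z else 0.
have mg f : measurable_fun setT f -> measurable_fun setT (g f).
  by move=> mf; apply: measf_if; [by []|by apply: measf_cyl; meas|by []|exact: measf_cst].
have g0 f : (forall z, 0 <= f z) -> forall z, 0 <= g f z.
  by move=> f0 z; rewrite /g; case: ifP.
have mg1 := mg _ m1; have mg2 := mg _ m2; have g10 := g0 _ f10; have g20 := g0 _ f20.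
apply: (@le_trans _ _ (\int[mu]_z (c1 * g f1 z + c2 * g f2 z)%:E)%E).
  apply: ge0_le_integralT; [exact: (mg F mF)| |exact: (g0 F F0)|].
    by apply: measfD; apply: measfM => //; exact: measf_cst.
  by move=> z; rewrite /g; case: ifP => // _; rewrite !mulr0 addr0.
rewrite ge0_integralDT; last 4 first.
- by apply: measfM => //; exact: measf_cst.
- by apply: measfM => //; exact: measf_cst.
- by move=> z; apply: mulr_ge0.
- by move=> z; apply: mulr_ge0.
rewrite !ge0_integralZlT//.
apply: (le_trans (leeD (lee_wpmul2l _ (t1 x t t0)) (lee_wpmul2l _ (t2 x t t0)))) => //.
by rewrite -!EFinM -EFinD lee_fin mulrDl !mulrA.
Qed.

Lemma supb_le2 F (f1 f2 : Rn * R -> R) (c1 c2 a1 a2 : R) : 0 <= c1 -> 0 <= c2 ->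
  (forall z, F z <= c1 * f1 z + c2 * f2 z) ->
  supb f1 a1 -> supb f2 a2 -> supb F (c1 * a1 + c2 * a2).
Proof.
move=> c10 c20 Fle; apply: aeS2 => z h1 h2 z0.
have {}h1 := ler_wpM2l c10 (h1 z0); have {}h2 := ler_wpM2l c20 (h2 z0).
apply: (le_trans (ler_wpM2l (ltW z0) (Fle z))); apply: le_trans (lerD h1 h2).
by rewrite mulrDr !(mulrCA z.2).
Qed.

(** Each of the two pieces of the solution norm is at most e for nonnegative e, for a measurable
    function on space-time; the squares match the quadratic nonlinearity. *)
Definition Ebd U (e : R) := [/\ measurable_fun setT U,
  supb (fun z => U z ^+ 2) (e ^+ 2) & tent (fun z => U z ^+ 2) (e ^+ 2)].

Lemma tent_mono F (b c : R) : b <= c -> tent F b -> tent F c.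
Proof.
move=> bc tF x t t0; apply: (le_trans (tF x t t0)).
by rewrite lee_fin ler_wpM2r// ltW// tpow_gt0.
Qed.

Lemma supb_mono F (b c : R) : b <= c -> supb F b -> supb F c.
Proof. by move=> bc; apply: aeS => z h z0; exact: le_trans (h z0) bc. Qed.

(** A substitute for the triangle inequality that needs no Minkowski inequality for the tent part;
    it loses at most a factor sqrt 2. *)
Lemma Ebd_le2 U V W (a b c : R) : Ebd U a -> Ebd V b -> measurable_fun setT W ->
  (forall z, W z ^+ 2 <= 2 * U z ^+ 2 + 2 * V z ^+ 2) ->
  2 * a ^+ 2 + 2 * b ^+ 2 <= c ^+ 2 -> Ebd W c.
Proof.
move=> [mU sU tU] [mV sV tV] mW WUV abc; split => //.
  by apply: supb_mono abc _; exact: supb_le2 WUV sU sV.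
apply: tent_mono abc _; apply: tent_le2 WUV tU tV => //; try (exact: measfX).
- by move=> z; exact: sqr_ge0.
- by move=> z; exact: sqr_ge0.
- by move=> z; exact: sqr_ge0.
Qed.

Lemma Ebd_mono U (a b : R) : 0 <= a -> a <= b -> Ebd U a -> Ebd U b.
Proof.
move=> a0 ab [mU sU tU]; have h : a ^+ 2 <= b ^+ 2 by rewrite ler_sqr ?nnegrE// (le_trans a0).
by split => //; [apply: supb_mono h _|apply: tent_mono h _].
Qed.

Lemma Ebd0 (a : R) : Ebd (fun _ => 0) a.
Proof.
split; first exact: measf_cst.
  by apply: aeW => z _; rewrite expr0n/= mulr0 sqr_ge0.
move=> x t t0; rewrite (_ : (fun z => _) = (fun _ => 0%E)).
  by rewrite integral0 lee_fin mulr_ge0 ?sqr_ge0// ltW// tpow_gt0.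
by apply/funext => z; rewrite expr0n/=; case: ifP.
Qed.

Lemma Ebd_ext U W (a : R) : measurable_fun setT W ->
  (forall t, 0 < t -> {ae lebn, forall x, W (x, t) = U (x, t)}) -> Ebd U a -> Ebd W a.
Proof.
move=> mW WU [mU sU tU].
have aeWU : {ae mu, forall z, 0 < z.2 -> W z == U z}.
  apply: (@stm_ae (fun z => W z == U z)); first exact: measurable_fun_eqr.
  by move=> t t0; apply: aeS (WU t t0) => x /eqP.
split => //; first by apply: aeS2 aeWU sU => z h1 h2 z0; rewrite (eqP (h1 z0)) h2.
move=> x t t0; rewrite [X in (X <= _)%E](_ : _ = (\int[mu]_z (if cyl x t z then U z ^+ 2 else 0)%:E)%E).
  exact: tU.
apply: integral_ae; apply: aeS aeWU => z h; rewrite /cyl; case: ltP h => //= z0 h.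
by rewrite (eqP (h isT)).
Qed.

(** Fatou on each cylinder. With it, pointwise convergence of the iterates replaces completeness of
    the function space. *)
Lemma Ebd_lim (Wk : nat -> Rn * R -> R) W (a : R) : (forall k, Ebd (Wk k) a) ->
  (forall z, (fun k => Wk k z) @ \oo --> W z) -> Ebd W a.
Proof.
move=> EW WW; have mW : measurable_fun setT W.
  by apply: (@measurable_fun_cvg _ _ _ _ Wk) => [k|z _ //]; case: (EW k).
have W2 z : (fun k => Wk k z ^+ 2) @ \oo --> W z ^+ 2.
  by rewrite expr2; under eq_fun do rewrite expr2; exact: cvgM.
split => //.
  have : {ae mu, forall z, forall k, 0 < z.2 -> z.2 * Wk k z ^+ 2 <= a ^+ 2}.
    by apply: ae_foralln => k; case: (EW k).
  apply: aeS => z h z0; 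
  have cv : (fun k => z.2 * Wk k z ^+ 2) @ \oo --> z.2 * W z ^+ 2.
    by apply: cvgM; [exact: cvg_cst|exact: W2].
  by apply: (cvgr_to_le cv); apply: nearW => k; exact: h.
move=> x t t0; apply: (@fatou_le R _ _ mu (fun k z => if cyl x t z then Wk k z ^+ 2 else 0)).
- move=> k; have [mk _ _] := EW k.
  by apply: measf_if; [by []|by apply: measf_cyl; meas|exact: measfX|exact: measf_cst].
- by move=> k z; case: ifP => // _; exact: sqr_ge0.
- by move=> z; case: ifP => _; [exact: W2|exact: cvg_cst].
- by move=> k; have [_ _] := EW k; exact.
Qed.

End bounds.

(** * The contraction estimate and the fixed point *)

Section nonlinearity.
Context {R : realType} {n : nat}.
Local Notation Rn := 'rV[R]_n.+1.
Local Notation leb := (@lebesgue_measure R).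
Local Notation lebn := (@lebesgue_rV R n.+1).
Local Notation mu := (@stm R n.+1).
Variables (phi : 'I_n.+1 -> R -> R) (L : R).
Hypothesis L0 : 0 < L.
Hypothesis phi0 : forall i, phi i 0 = 0.
Hypothesis phiL : forall i a b, `|phi i a - phi i b| <= L * `|a - b|.
Implicit Types (U V W F : Rn * R -> R).

Definition gN U (i : 'I_n.+1) (z : Rn * R) : R := phi i (U z ^+ 2).

Lemma measf_phi i : measurable_fun setT (phi i).
Proof.
apply: continuous_measurable_fun => a; apply/subr_cvg0.
apply: norm_cvg0; apply: (@squeeze_cvgr _ _ _ _ (fun _ => 0) (fun b : R => L * `|b - a|)).
- by apply: nearW => b; rewrite normr_ge0 phiL.
- exact: cvg_cst.
- rewrite -[X in _ --> X](mulr0 L); apply: cvgM; first exact: cvg_cst.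
  rewrite -[X in _ --> X](@normr0 _ R) -[X in `|X|](subrr a).
  by apply: cvg_norm; apply: cvgB; [exact: cvg_id|exact: cvg_cst].
Qed.

Lemma measf_gN U i : measurable_fun setT U -> measurable_fun setT (gN U i).
Proof. by move=> mU; apply: (measurableT_comp (measf_phi i)); exact: measfX. Qed.

Lemma gN_le U i z : `|gN U i z| <= L * U z ^+ 2.
Proof.
have := phiL i (U z ^+ 2) 0; rewrite phi0 !subr0 => h; apply: (le_trans h).
by rewrite ger0_norm ?sqr_ge0.
Qed.

Lemma Nop_0 (g : 'I_n.+1 -> Rn * R -> R) : (forall i z, g i z = 0) -> forall q, Nop g q = 0.
Proof.
move=> g0 q; have [C [C0 HC]] := @Nop_bounds R n.
have s0 : supb (fun _ : Rn * R => 0 : R) 0 by apply: aeW => z _; rewrite mulr0.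
have t0 : tent (fun _ : Rn * R => 0 : R) 0.
  by have [_ _] := @Ebd0 R n 0; rewrite expr0n/=.
have mg i : measurable_fun setT (g i).
  by rewrite (_ : g i = fun _ => 0); [exact: measf_cst|apply/funext => z].
have g1 i z : `|g i z| <= 0 by rewrite g0 normr0.
have m0 : measurable_fun setT (fun _ : Rn * R => 0 : R) by exact: measf_cst.
have [_ + _] := HC (fun _ => 0) 0 0 m0 (fun _ => lexx 0) (lexx 0) (lexx 0) s0 t0 g mg g1.
by move=> /(_ q); rewrite addr0 mulr0 normr_le0 => /eqP.
Qed.

(** The source difference is at most L |U - V| |U + V|. Young's inequality with weights adapted to r
    and d turns this product into a combination of squares, for which sup and Carleson bounds are
    available, and the result is linear in d. *)
Lemma Nop_contraction : exists K : R, 0 < K /\ forall U V (r d : R), 0 < r -> 0 < d ->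
  Ebd U r -> Ebd V r -> Ebd (fun z => U z - V z) d ->
  [/\ measurable_fun setT (Nop (gN U)),
      Ebd (fun q => Nop (gN U) q - Nop (gN V) q) (K * r * d) &
      forall q, `|Nop (gN U) q - Nop (gN V) q| <= K * r * d * (Num.sqrt q.2)^-1].
Proof.
have [C [C0 HC]] := @Nop_bounds R n.
(* The bounds of [Nop_bounds] with both parameters equal to 2 L r d give 4 L r d; the factor 1 + C
   serves both C and, through C <= (1 + C)^2, the squared estimate. *)
exists ((1 + C) * (4 * L)); split; first by rewrite mulr_gt0 ?mulr_gt0// ltr_pwDl.
move=> U V r d r0 d0 [mU sU tU] [mV sV tV] [mD sD tD].
have sq0 F : forall z, 0 <= F z ^+ 2 by move=> z; exact: sqr_ge0.
pose S z := 1 * U z ^+ 2 + 1 * V z ^+ 2.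
have mS : measurable_fun setT S.
  by apply: measfD; apply: measfM; [exact: measf_cst|exact: measfX|exact: measf_cst|exact: measfX].
have S0 z : 0 <= S z by rewrite /S !mul1r addr_ge0 ?sqr_ge0.
have sS : supb S (1 * r ^+ 2 + 1 * r ^+ 2) by apply: supb_le2 sU sV.
have tS : tent S (1 * r ^+ 2 + 1 * r ^+ 2) by apply: tent_le2 tU tV => //; exact: measfX.
have gS (X : Rn * R -> R) i z : X z ^+ 2 <= S z -> `|gN X i z| <= L * S z.
  by move=> h; apply: (le_trans (gN_le X i z)); rewrite ler_wpM2l// ltW.
have US z : U z ^+ 2 <= S z by rewrite /S !mul1r lerDl sqr_ge0.
have VS z : V z ^+ 2 <= S z by rewrite /S !mul1r lerDr sqr_ge0.
(* A rough majorant of both sources, used only for measurability and for the linearity of [Nop]. The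
   zero term gives it the shape of the two-term lemmas. *)
pose w0 z := L * S z + 0 * S z.
have w00 z : 0 <= w0 z by rewrite /w0 mul0r addr0 mulr_ge0// ltW.
have mw0 : measurable_fun setT w0.
  by apply: measfD; apply: measfM => //; exact: measf_cst.
pose a0 := L * (1 * r ^+ 2 + 1 * r ^+ 2) + 0 * (1 * r ^+ 2 + 1 * r ^+ 2).
have a00 : 0 <= a0 by rewrite /a0 mul0r addr0 mulr_ge0 ?(ltW L0)// !mul1r addr_ge0 ?sqr_ge0.
have sw0 : supb w0 a0 by apply: (supb_le2 _ _ _ sS sS) => //; exact: ltW.
have tw0 : tent w0 a0 by apply: (tent_le2 _ _ _ _ _ _ _ _ _ tS tS) => //; exact: ltW.
have gUw i z : `|gN U i z| <= w0 z by rewrite /w0 mul0r addr0; exact: gS.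
have gVw i z : `|gN V i z| <= w0 z by rewrite /w0 mul0r addr0; exact: gS.
have mgU i : measurable_fun setT (gN U i) by exact: measf_gN.
have mgV i : measurable_fun setT (gN V i) by exact: measf_gN.
have [mNU _ _] := HC w0 a0 a0 mw0 w00 a00 a00 sw0 tw0 (gN U) mgU gUw.
(* These weights balance the two terms: c1 d^2 and c3 (2 r^2) both equal L r d. *)
pose c1 := L * (r / d); pose c3 := L * (d / (2 * r)).
have c10 : 0 <= c1 by rewrite /c1 mulr_ge0 ?divr_ge0// ltW.
have c30 : 0 <= c3 by rewrite /c3 mulr_ge0 ?divr_ge0 ?mulr_ge0// ltW.
pose w z := c1 * (U z - V z) ^+ 2 + c3 * S z.
have mw : measurable_fun setT w.
  by apply: measfD; apply: measfM; [exact: measf_cst|exact: measfX|exact: measf_cst|].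
have w_ge0 z : 0 <= w z by rewrite /w addr_ge0// mulr_ge0// sqr_ge0.
pose a := 2 * L * r * d.
have aE : c1 * d ^+ 2 + c3 * (1 * r ^+ 2 + 1 * r ^+ 2) = a.
  by rewrite /c1 /c3 /a; field; rewrite !gt_eqF.
have a_ge0 : 0 <= a by rewrite /a !mulr_ge0// ltW.
have sw : supb w a by rewrite -aE; apply: supb_le2 sD sS.
have tw : tent w a by rewrite -aE; apply: tent_le2 tD tS => //; [exact: measfX|by move=> z; exact: sqr_ge0].
have gw i z : `|gN U i z - gN V i z| <= w z.
  apply: (le_trans (phiL i _ _)).
  have -> : w z = L * (r / d * (U z - V z) ^+ 2 + d / (2 * r) * S z).
    by rewrite mulrDr (mulrA L (r / d)) (mulrA L (d / (2 * r))).
  rewrite ler_wpM2l ?(ltW L0)// subr_sqr normrM.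
  have h : `|U z + V z| ^+ 2 <= 2 * S z.
    rewrite real_normK ?num_real// /S; have := sqr_ge0 (U z - V z).
    by rewrite !mul1r sqrrB sqrrD; lra.
  have : 0 <= (2 * r * d)^-1 * (2 * r * `|U z - V z| - d * `|U z + V z|) ^+ 2.
    by rewrite mulr_ge0 ?sqr_ge0// invr_ge0 !mulr_ge0// ltW.
  rewrite -[X in r / d * X]real_normK ?num_real//.
  have h2 : d / (2 * r) * (`|U z + V z| ^+ 2) <= d / (2 * r) * (2 * S z).
    by rewrite ler_wpM2l// divr_ge0 ?mulr_ge0// ltW.
  move: h2; move: `|U z - V z| `|U z + V z| (S z) => x y s h2.
  have -> : (2 * r * d)^-1 * (2 * r * x - d * y) ^+ 2 =
      2 * (r / d * x ^+ 2) - 2 * (x * y) + d / (2 * r) * y ^+ 2.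
    by field; rewrite !gt_eqF.
  by move: (r / d * x ^+ 2) (x * y) (d / (2 * r)) h2 => X Y Z; lra.
have mgD i : measurable_fun setT (fun z => gN U i z - gN V i z) by exact: measfB.
have [mN bN tN] := HC w a a mw w_ge0 a_ge0 a_ge0 sw tw _ mgD gw.
have NE q : Nop (fun i z => gN U i z - gN V i z) q = Nop (gN U) q - Nop (gN V) q.
  exact: (Nop_sub mw0 w00 a00 a00 sw0 tw0 mgU mgV gUw gVw).
have NEf : Nop (fun i z => gN U i z - gN V i z) = (fun q => Nop (gN U) q - Nop (gN V) q).
  by apply/funext.
rewrite NEf in mN bN tN.
have a4 : a + a = 4 * L * r * d by rewrite /a; ring.
have bN' q : `|Nop (gN U) q - Nop (gN V) q| <= (1 + C) * (4 * L) * r * d * (Num.sqrt q.2)^-1.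
  apply: (le_trans (bN q)); rewrite a4 mulrAC ler_wpM2r ?invr_ge0 ?sqrtr_ge0//.
  rewrite -!mulrA ler_wpM2r ?lerDr//.
  by rewrite !mulr_ge0// ltW.
split => //; split => //.
  apply: aeW => q q0; rewrite -ler_pdivlMl//.
  rewrite -(real_normK (num_real _)); apply: (@le_trans _ _ (((1 + C) * (4 * L) * r * d * (Num.sqrt q.2)^-1) ^+ 2)).
    by rewrite ler_sqr ?nnegrE// (le_trans _ (bN' q)).
  by rewrite exprMn exprVn (sqr_sqrtr (ltW q0)) [leRHS]mulrC.
apply: tent_mono tN; rewrite a4 -!mulrA [leRHS]exprMn ler_wpM2r ?sqr_ge0// expr2.
by have := mulr_ge0 C0 C0; lra.
Qed.

Section fixpoint.
Variable K : R.
Hypothesis K0 : 0 < K.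
Hypothesis HK : forall U V (r d : R), 0 < r -> 0 < d ->
  Ebd U r -> Ebd V r -> Ebd (fun z => U z - V z) d ->
  [/\ measurable_fun setT (Nop (gN U)),
      Ebd (fun q => Nop (gN U) q - Nop (gN V) q) (K * r * d) &
      forall q, `|Nop (gN U) q - Nop (gN V) q| <= K * r * d * (Num.sqrt q.2)^-1].

Lemma Nop_self U (r : R) : 0 < r -> Ebd U r ->
  [/\ measurable_fun setT (Nop (gN U)), Ebd (Nop (gN U)) (K * r * r) &
      forall q, `|Nop (gN U) q| <= K * r * r * (Num.sqrt q.2)^-1].
Proof.
move=> r0 EU; have e0 q : Nop (gN (fun _ => 0)) q = 0.
  by apply: Nop_0 => i z; rewrite /gN expr0n/= phi0.
have EU0 : Ebd (fun z => U z - 0) r.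
  by rewrite (_ : (fun z => _) = U)//; apply/funext => z; rewrite subr0.
have [mN EN bN] := HK r0 r0 EU (Ebd0 r) EU0; split => //.
  by congr Ebd : EN; apply/funext => q; rewrite e0 subr0.
by move=> q; have := bN q; rewrite e0 subr0.
Qed.

(** The iteration stays in the ball of radius 2 e and its increments decay like 8^-k, both in norm
    and pointwise with the factor t^(-1/2). The pointwise geometric series gives a limit at every
    point, so the fixed-point equation holds everywhere and not just almost everywhere. *)
Lemma picard V (e : R) : 0 < e -> Ebd V e -> 16 * K * e <= 1 ->
  exists U, Ebd U (2 * e) /\ forall q, U q = V q + Nop (gN U) q.
Proof.
move=> e0 EV Ke; have e20 : 0 < 2 * e by rewrite mulr_gt0.
have mV : measurable_fun setT V by case: EV.
pose us k := iter k (fun U q => V q + Nop (gN U) q) V.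
have usS k q : us k.+1 q = V q + Nop (gN (us k)) q by [].
(* On the ball of radius 2 e the assumption 16 K e <= 1 makes the contraction ratio 1/8. *)
have Kd (d : R) : 0 <= d -> K * (2 * e) * d <= d / 8.
  by move=> d0; rewrite [leRHS]mulrC ler_wpM2r//; lra.
have Eus k : Ebd (us k) (2 * e).
  elim: k => [|k IH]; first by apply: Ebd_mono EV; lra.
  have [mN EN _] := Nop_self e20 IH.
  apply: (Ebd_le2 EV EN); first exact: (measfD mV mN).
    by move=> z; rewrite usS; have := sqr_ge0 (V z - Nop (gN (us k)) z);
       move: (V z) (Nop _ z) => a b; rewrite sqrrB sqrrD; lra.
  have h := Kd _ (ltW e20); have h0 : 0 <= K * (2 * e) * (2 * e) by rewrite !mulr_ge0// ltW.
  have : (K * (2 * e) * (2 * e)) ^+ 2 <= (2 * e / 8) ^+ 2 by rewrite ler_sqr ?nnegrE// (le_trans h0).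
  by move: (K * _ * _) => a; rewrite !exprMn exprVn; have := sqr_ge0 e; lra.
pose c k : R := e * 8^-1 ^+ k.
have c0 k : 0 < c k by rewrite /c mulr_gt0// exprn_gt0.
have cS k : c k.+1 = c k / 8 by rewrite /c exprSr mulrA.
have D k : Ebd (fun q => us k.+1 q - us k q) (c k) /\
    forall q, `|us k.+1 q - us k q| <= c k * (Num.sqrt q.2)^-1.
  elim: k => [|k [IH _]].
    have [mN EN bN] := Nop_self e0 EV.
    have h : K * e * e <= c 0.
      by rewrite /c expr0 mulr1 -[leRHS]mul1r ler_wpM2r ?ltW//; have := mulr_gt0 K0 e0; lra.
    have E q : us 1%N q - us 0%N q = Nop (gN V) q by rewrite usS addrC addKr.
    split; last first.
      by move=> q; rewrite E (le_trans (bN q))// ler_wpM2r// invr_ge0 sqrtr_ge0.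
    rewrite (_ : (fun q => _) = Nop (gN V)); last exact/funext.
    by apply: Ebd_mono EN => //; rewrite !mulr_ge0// ltW.
  have [_ EN bN] := HK e20 (c0 k) (Eus k.+1) (Eus k) IH.
  have E q : us k.+2 q - us k.+1 q = Nop (gN (us k.+1)) q - Nop (gN (us k)) q.
    by rewrite !usS opprD addrACA subrr add0r.
  have h := Kd _ (ltW (c0 k)); rewrite -cS in h.
  split; last first.
    by move=> q; rewrite E (le_trans (bN q))// ler_wpM2r// invr_ge0 sqrtr_ge0.
  rewrite (_ : (fun q => _) = (fun q => Nop (gN (us k.+1)) q - Nop (gN (us k)) q)); last exact/funext.
  by apply: Ebd_mono EN => //; rewrite !mulr_ge0// ltW.
(* The ratio 1/8 leaves room for the weak triangle inequality: with x = c k, 2 (x/4)^2 + 2 x^2 <= (2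
   x)^2, so the constant 2 does not deteriorate along the induction on j. *)
have D2 j k : Ebd (fun q => us (j + k)%N q - us k q) (2 * c k).
  elim: j k => [|j IH] k.
    rewrite (_ : (fun q => _) = (fun _ => 0)); first exact: Ebd0.
    by apply/funext => q; rewrite subrr.
  have IH1 := IH k.+1; have [Dk _] := D k;
  have E q : us (j.+1 + k)%N q - us k q = (us (j + k.+1)%N q - us k.+1 q) + (us k.+1 q - us k q).
    by rewrite addrA subrK addSnnS.
  apply: (Ebd_le2 IH1 Dk).
    by have [m3 _ _] := Eus (j.+1 + k)%N; have [m4 _ _] := Eus k; exact: (measfB m3 m4).
    move=> q; rewrite E; move: (_ - _) (_ - _) => a b.
    by have := sqr_ge0 (a - b); rewrite sqrrB sqrrD; lra.
  rewrite cS; move: (c k) => x; have := sqr_ge0 x.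
  have -> : (2 * (x / 8)) ^+ 2 = x ^+ 2 / 16 by field.
  by rewrite exprMn; lra.
have cvU q : cvgn (fun k => us k q).
  pose d k := us k.+1 q - us k q.
  have : cvgn (series d).
    apply: normed_cvg; apply: (@series_le_cvg R _ (geometric (e * (Num.sqrt q.2)^-1) 8^-1)).
    - by move=> k; exact: normr_ge0.
    - by move=> k; rewrite /geometric /= !mulr_ge0 ?invr_ge0 ?sqrtr_ge0 ?exprn_ge0// ltW.
    - by move=> k; have [_ b] := D k; rewrite /geometric /= mulrAC; exact: b.
    - by apply: is_cvg_geometric_series; rewrite ger0_norm//; lra.
  have -> : series d = (fun k => us k q - us 0%N q).
    exact: (telescopeK (fun k => us k q)).
  move=> /cvg_ex [l cl]; apply/cvg_ex; exists (l + us 0%N q).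
  rewrite (_ : (fun k => _) = (fun k => us k q - us 0%N q + us 0%N q)).
    by apply: cvgD => //; exact: cvg_cst.
  by apply/funext => k; rewrite subrK.
pose U q := limn (fun k => us k q).
have UU q : (fun k => us k q) @ \oo --> U q by exact: cvU.
have EU : Ebd U (2 * e) by exact: Ebd_lim Eus UU.
have DU k : Ebd (fun q => U q - us k q) (2 * c k).
  apply: (@Ebd_lim _ _ (fun j q => us (j + k)%N q - us k q)) => [j|q]; first exact: D2.
  apply: cvgB; last exact: cvg_cst.
  by have := UU q; rewrite -(cvg_shiftn k).
exists U; split => // q.
have cN : (fun k => Nop (gN (us k)) q) @ \oo --> Nop (gN U) q.
  apply/subr_cvg0; apply: norm_cvg0.
  have g0 : (fun k => geometric (K * (2 * e) * (2 * e) * (Num.sqrt q.2)^-1) 8^-1 k) @ \oo --> 0.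
    by apply: cvg_geometric; rewrite ger0_norm//; lra.
  apply: (squeeze_cvgr _ (cvg_cst 0) g0); apply: nearW => k; rewrite normr_ge0 distrC /=.
  have [_ _ b] := HK e20 (mulr_gt0 (@ltr0n R 2) (c0 k)) EU (Eus k) (DU k).
  by apply: (le_trans (b q)); rewrite /geometric /= /c le_eqVlt; apply/orP; left; apply/eqP; ring.
have c1 : (fun k => us k.+1 q) @ \oo --> V q + Nop (gN U) q.
  by apply: cvgD; [exact: cvg_cst|exact: cN].
have c2 : (fun k => us k.+1 q) @ \oo --> U q by have := UU q; rewrite -cvg_shiftS.
exact: (cvg_unique _ c2 c1).
Qed.

(** The contraction is fed back into itself: the difference satisfies [Ebd] with 2 r 4^-k for every
    k. The equation is known only almost everywhere on slices, hence [Ebd_ext], but the pointwise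
    bound on the Duhamel terms makes the conclusion hold everywhere. *)
Lemma fixpoint_unique U W (r : R) : 0 < r -> Ebd U r -> Ebd W r -> 4 * K * r <= 1 ->
  (forall t, 0 < t -> {ae lebn, forall x,
     W (x, t) - U (x, t) = Nop (gN W) (x, t) - Nop (gN U) (x, t)}) ->
  forall q, Nop (gN W) q = Nop (gN U) q.
Proof.
move=> r0 EU EW Kr WU.
have [mU _ _] := EU; have [mW _ _] := EW.
have mD : measurable_fun setT (fun z => W z - U z) by exact: measfB.
pose c k : R := 2 * r * 4^-1 ^+ k.
have c0 k : 0 < c k by rewrite /c !mulr_gt0// exprn_gt0.
have h k : K * r * c k <= c k.+1.
  have -> : c k.+1 = c k / 4 by rewrite /c exprSr mulrA.
  by rewrite [leRHS]mulrC ler_wpM2r ?(ltW (c0 k))//; lra.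
have E k : Ebd (fun z => W z - U z) (c k).
  elim: k => [|k IH].
    apply: (Ebd_le2 EW EU mD); last by rewrite /c expr0 mulr1 exprMn; have := sqr_ge0 r; lra.
    move=> z; move: (W z) (U z) => a b.
    by have := sqr_ge0 (a + b); rewrite sqrrB sqrrD; lra.
  have [_ EN _] := HK r0 (c0 k) EW EU IH.
  apply: (Ebd_ext mD _ (Ebd_mono _ (h k) EN)) => //.
  by rewrite !mulr_ge0// ltW.
move=> q; apply/eqP; rewrite -subr_eq0 -normr_le0.
have g0 : (fun k => geometric (K * r * (2 * r) * (Num.sqrt q.2)^-1) 4^-1 k) @ \oo --> 0.
  by apply: cvg_geometric; rewrite ger0_norm//; lra.
apply: (cvgr_to_ge g0); apply: nearW => k.
have [_ _ b] := HK r0 (c0 k) EW EU (E k).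
by apply: (le_trans (b q)); rewrite /geometric /= /c le_eqVlt; apply/orP; left; apply/eqP; ring.
Qed.

End fixpoint.

End nonlinearity.

(** * Translation between the solution norm and its two bounds *)

Section norms.
Context {R : realType} {n : nat}.
Local Notation Rn := 'rV[R]_n.+1.
Local Notation leb := (@lebesgue_measure R).
Local Notation lebn := (@lebesgue_rV R n.+1).
Local Notation mu := (@stm R n.+1).

Lemma tent_norm_le (u : Rn -> R -> R) (U : Rn * R -> R) (e : R) : 0 <= e ->
  measurable_fun setT U -> (forall x t, 0 < t -> U (x, t) = u x t) ->
  (tent_norm u <= e%:E)%E <-> tent (fun z => U z ^+ 2) (e ^+ 2).
Proof.
move=> e0 mU Uu.
have key x t : 0 < t ->
    ((((t `^ (- (n.+1%:R / 2)))%R%:E *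
      \int[leb]_(s in `]0%R, t[) \int[lebn]_(y in eball x (Num.sqrt t))
        (u y s ^+ 2)%R%:E) `^ 2^-1)%E <= e%:E)%E <->
    (\int[mu]_z (if cyl x t z then U z ^+ 2 else 0)%:E <= (e ^+ 2 * @tpow R n t)%:E)%E.
  move=> t0; rewrite powRN -/(@tpow R n t) (tent_intE (u := fun s y => u y s) x mU _ t0); last first.
    by move=> s s0; apply: aeW => y; rewrite Uu.
  apply: poweR_half_le => //; first exact: tpow_gt0.
  by apply: integral_ge0 => z _; rewrite lee_fin; case: ifP => // _; exact: sqr_ge0.
split=> [h x t t0|h].
  apply/(key x t t0); apply: le_trans h; apply: ereal_sup_ubound.
  by exists x, t.
by apply: ge_ereal_sup => _ [x [t [t0 ->]]]; apply/(key x t t0); exact: h.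
Qed.

Lemma Lnorm_space_time_le (u : Rn -> R -> R) (e : R) : 0 <= e ->
  ('N[(lebn \x leb)]_+oo[
      (fun z : Rn * R => (Num.sqrt z.2 * u z.1 z.2)%:E) \_ space_time ] <= e%:E)%E <->
  {ae mu, forall z : Rn * R, 0 < z.2 -> z.2 * u z.1 z.2 ^+ 2 <= e ^+ 2}.
Proof.
move=> e0; set h := (X in Lnorm _ _ X).
have key (z : Rn * R) : (`|h z| <= e%:E)%E <-> (0 < z.2 -> z.2 * u z.1 z.2 ^+ 2 <= e ^+ 2).
  rewrite /h patchE; case: ifPn; rewrite ?inE ?notin_setE /space_time /= in_itv/= andbT.
    move=> [_ z0]; rewrite lee_fin -(ler_sqr (x := `| _ |)) ?nnegrE//.
    by rewrite real_normK ?num_real// exprMn (sqr_sqrtr (ltW z0)); split => // ->.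
  by move=> h1; rewrite normr0 lee_fin; split => // _ z0; exfalso; apply: h1.
rewrite unlock /Lnorm; case: ifPn => [m0|m0].
  split=> [/ess_sup_inf.ess_supP|] hh; last apply/ess_sup_inf.ess_supP.
    by apply: aeS hh => z /key.
  by apply: aeS hh => z /key.
(* The degenerate branch in the definition of the norm: if the whole space had measure 0 the norm
   would be 0 and every property would hold almost everywhere. *)
rewrite lee_fin; split => // _; exists setT; split => //.
by apply/eqP; rewrite eq_le measure_ge0 andbT leNgt.
Qed.

(** Extension by 0 to nonpositive times gives a measurable function on all of space-time; each piece
    of the norm is at most the sum. *)
Lemma E_norm_Ebd (v : Rn -> R -> R) (e : R) : 0 <= e ->
  measurable_fun space_time (fun z : Rn * R => v z.1 z.2) -> (E_norm v <= e%:E)%E ->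
  Ebd (fun z : Rn * R => if 0 < z.2 then v z.1 z.2 else 0) e.
Proof.
move=> e0 mv Ev; set V := (V in Ebd V _).
have mV : measurable_fun setT V.
  have mst : measurable (space_time : set (Rn * R)).
    by apply: measurableX => //; exact: measurable_itv.
  have := (measurable_restrictT _ mst).1 mv.
  congr measurable_fun; apply/funext => z; rewrite patchE /V.
  case: ifPn; rewrite ?inE ?notin_setE /space_time /= in_itv/= andbT; first by case=> _ ->.
  by case: ltP => // h1 []; split.
have [N1 N2] : (('N[(lebn \x leb)]_+oo[
      (fun z : Rn * R => (Num.sqrt z.2 * v z.1 z.2)%:E) \_ space_time ] <= e%:E)%E /\
      tent_norm v <= e%:E)%E.
  split; apply: le_trans Ev; rewrite /E_norm.
    rewrite leeDl// /tent_norm.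
    apply: le_trans (ereal_sup_ubound (ex_intro _ 0 (ex_intro _ 1 (conj ltr01 erefl)))).
    exact: poweR_ge0.
  by rewrite leeDr// Lnorm_ge0.
split => //.
  by move/(Lnorm_space_time_le v e0) : N1; apply: aeS => z h z0; rewrite /V z0 h.
apply/(tent_norm_le (u := v) e0 mV) => // x t t0.
by rewrite /V /= t0.
Qed.

Lemma Ebd_E_norm (U : Rn * R -> R) (e : R) : 0 <= e -> Ebd U e ->
  E_space (fun x t => U (x, t)) /\ (E_norm (fun x t => U (x, t)) <= (e + e)%:E)%E.
Proof.
move=> e0 [mU sU tU].
have h : (E_norm (fun x t => U (x, t)) <= (e + e)%:E)%E.
  rewrite EFinD; apply: leeD.
    apply/(Lnorm_space_time_le (fun x t => U (x, t)) e0).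
    by apply: aeS sU => -[x t] /= hh t0; exact: hh.
  exact/(tent_norm_le (u := fun x t => U (x, t)) e0 mU).
split => //; split; last by rewrite (le_lt_trans h)// ltry.
apply: (@measurable_funS _ _ _ _ setT) => //.
by rewrite (_ : (fun z => _) = U)//; apply/funext => -[].
Qed.

End norms.

Lemma coord_le_norm (R : realType) (n : nat) (x : 'rV[R]_n) i : `|x ord0 i| <= `|x|.
Proof.
rewrite [leRHS]mx_normrE.
exact: (le_bigmax _ (fun ij => `|x ij.1 ij.2|) (ord0, i)).
Qed.

(* The smallness threshold [eps] also fixes the radius [2 * eps] of the ball.  It
   may depend on [u0], but it is at least [eps0], which depends only on [f] and the
   dimension; without this lower bound [eps] could be taken equal to the norm
   of [u0].  A single [eps] for all [u0] is impossible in high dimension, since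
   for [f = 0] the [E_norm] of the heat extension of [u0] can exceed twice the norm of
   [u0] (take [u0 = cos x_1]). *)
Theorem theorem1p4 (R : realType) (n : nat) (f : R -> 'rV[R]_n.+1) (C : R)
    (f_lip : lipschitz f)
    (f_growth : forall x : R, enorm (f x) <= C * `|x|) :
  exists2 eps0 : R, 0 < eps0 &
  forall u0 : ('rV[R]_n.+1 -> R) -> R, bmo u0 ->
  exists2 eps : R, eps0 <= eps &
    ((bmo_norm u0 < eps%:E)%E ->
     exists u : 'rV[R]_n.+1 -> R -> R,
       [/\ E_space u, (E_norm u <= (2 * eps)%:E)%E, mild_solution f u0 u &
         forall v : 'rV[R]_n.+1 -> R -> R,
           E_space v -> (E_norm v <= (2 * eps)%:E)%E -> mild_solution f u0 v ->
           forall t : R, 0 < t ->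
             {ae @lebesgue_rV R n.+1, forall x, v x t = u x t}]).
Proof.
have [L [L0 fL]] : exists L : R, 0 < L /\ forall a b, `|f a - f b| <= L * `|a - b|.
  case: f_lip => M [_ HM]; exists (`|M| + 1); split; first by rewrite ltr_wpDl.
  have MM : M < `|M| + 1 by rewrite ltr_pwDr// ler_norm.
  by move=> a b; exact: (HM _ MM (a, b)).
pose phi (i : 'I_n.+1) (a : R) := f a ord0 i.
have phi0 i : phi i 0 = 0.
  have := f_growth 0; rewrite normr0 mulr0 => h.
  have : Num.sqrt (sqn (f 0)) == 0 by rewrite eq_le h sqrtr_ge0.
  rewrite sqrtr_eq0 => h2; have := le_trans (sqn_coord (f 0) i) h2.
  by move=> h3; apply/eqP; rewrite -sqrf_eq0 eq_le sqr_ge0 andbT.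
have phiL i a b : `|phi i a - phi i b| <= L * `|a - b|.
  by apply: le_trans (fL a b); have := coord_le_norm (f a - f b) i; rewrite !mxE.
have [K [K0 HK]] := Nop_contraction L0 phi0 phiL.
have [H [H1 HH]] := @heat_bounds R n.
have H0 : 0 < H by rewrite (lt_le_trans _ H1).
(* For e = H eps0 this gives 16 K e = 1, which serves twice: as the condition of [picard], and as 4
   K r <= 1 for uniqueness in the ball of radius r = 4 e. *)
pose eps0 : R := (16 * K * H)^-1.
have eps00 : 0 < eps0 by rewrite invr_gt0 !mulr_gt0.
exists eps0 => // u0 [tu0 _].
(* Data of norm at least eps0 are disposed of by eps = eps0, which falsifies the smallness
   hypothesis. For the others eps is larger and their norm is compared with eps0 itself. *)
have [small|big] := ltP (bmo_norm u0) eps0%:E; last first.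
  by exists eps0 => // /(le_lt_trans big); rewrite ltxx.
pose e : R := H * eps0.
have e0 : 0 < e by rewrite mulr_gt0.
have Ke : 16 * K * e <= 1 by rewrite /e mulrA mulfV// gt_eqF// !mulr_gt0.
have ee : eps0 <= e by rewrite ler_peMl// ltW.
(* Each piece of the norm of the fixed point is at most 2 e, so their sum is at most 4 e = 2 eps. *)
exists (2 * e); first by lra.
move=> _; have [V [mV VE tV bV]] := HH u0 eps0 tu0 eps00 small.
have EV : Ebd V e.
  split => //.
    apply: aeW => z z0; have := bV z; rewrite -/e => h.
    have : (Num.sqrt z.2 * `|V z|) ^+ 2 <= e ^+ 2.
      by rewrite ler_sqr ?nnegrE// ?mulr_ge0 ?sqrtr_ge0// ltW.
    by rewrite exprMn (sqr_sqrtr (ltW z0)) real_normK ?num_real.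
  by apply: tent_mono tV; rewrite ler_sqr ?nnegrE// ltW.
(* Off the hyperplane the right-hand side of the mild formulation is V + Nop; this is used for the
   solution found and for any competitor. *)
have mildE U (u : 'rV[R]_n.+1 -> R -> R) (r : R) : 0 <= r -> Ebd U r ->
    (forall x t, 0 < t -> U (x, t) = u x t) -> forall x t, 0 < t -> xn x != 0 ->
    neumann_heat t u0 x + \int[@lebesgue_measure R]_(s in `]0, t[)
        neumann_heat_div (t - s) (fun y => f (u y s ^+ 2)) x =
    V (x, t) + Nop (gN phi U) (x, t).
  move=> r0 [mU sU tU] Uu x t t0 x0; rewrite (VE x t t0 x0); congr (_ + _).
  have U0 z : 0 <= U z ^+ 2 by exact: sqr_ge0.
  have mU2 := measfX 2 mU.
  pose F z := L * U z ^+ 2 + 0 * U z ^+ 2.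
  have mF : measurable_fun setT F by apply: measfD; apply: measfM => //; exact: measf_cst.
  have F0 z : 0 <= F z by rewrite /F mul0r addr0 mulr_ge0// ltW.
  pose a := L * r ^+ 2 + 0 * r ^+ 2.
  have a0 : 0 <= a by rewrite /a mul0r addr0 mulr_ge0 ?sqr_ge0// ltW.
  have sF : supb F a := supb_le2 (ltW L0) (lexx 0) (fun z => lexx _) sU sU.
  have tF : tent F a :=
    tent_le2 mF mU2 mU2 (ltW L0) (lexx 0) U0 U0 F0 (fun z => lexx _) tU tU.
  apply: (Nop_mild mF F0 a0 a0 sF tF) => //.
  - by move=> i; exact: (measf_gN phiL).
  - by move=> i z; rewrite /F mul0r addr0; exact: (gN_le phi0 phiL).
  - by move=> i [y s] /= s0 _; rewrite /gN -Uu.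
have [U [EU UE]] := picard phi0 K0 HK e0 EV Ke.
have e20 : 0 <= 2 * e by rewrite mulr_ge0// ltW.
have [sU nU] := Ebd_E_norm e20 EU.
exists (fun x t => U (x, t)); split => //.
- by rewrite (_ : 2 * (2 * e) = 2 * e + 2 * e); [exact: nU|lra].
- move=> t t0; apply: aeS hyper_ae => x x0.
  by rewrite (mildE U _ _ e20 EU _ x t t0 x0)// UE.
move=> v [mv _] nv mild_v t t0.
have e40 : 0 < 2 * (2 * e) by rewrite !mulr_gt0.
have EW := E_norm_Ebd (ltW e40) mv nv.
set W := (fun _ => _) in EW.
have Wv x s : 0 < s -> W (x, s) = v x s by move=> s0; rewrite /W /= s0.
(* The competitor is only known to satisfy the bound with 4 e, so the comparison takes place in that
   larger ball. *)
have EU4 : Ebd U (2 * (2 * e)) by apply: Ebd_mono EU => //; lra.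
have WE s : 0 < s -> {ae @lebesgue_rV R n.+1, forall x, W (x, s) = V (x, s) + Nop (gN phi W) (x, s)}.
  move=> s0; apply: aeS2 hyper_ae (mild_v s s0) => x x0 vx.
  by rewrite -(mildE W v _ (ltW e40) EW Wv x s s0 x0) Wv.
have NE := fixpoint_unique K0 HK e40 EU4 EW.
have {}NE : forall q, Nop (gN phi W) q = Nop (gN phi U) q.
  apply: NE; first by lra.
  move=> s s0; apply: aeS (WE s s0) => x Wx.
  by rewrite {1}Wx (UE (x, s)) opprD addrACA subrr add0r.
apply: aeS (WE t t0) => x; rewrite (Wv x t t0) => ->.
by rewrite NE UE.
Qed.
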